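(* Let $M>0$, let $E$ be an arbitrary subset of the unit circle $T$, and let $f$ be a complex-valued function on $E$. There exists a sequence of polynomials $\{P_n\}$ converging pointwise to $f$ at each point of $E$ and satisfying $|P_n(z)| \leq M$ for all $z \in \Delta$ and $n = 1, 2, \ldots$, if and only if there exist a sequence $\{f_n\}$ of continuous complex-valued functions on $T$ and a bounded analytic function $g$ in $\Delta$ such that: (i) $|f_n(z)| \leq M$ for all $z \in T$ and $n = 1, 2, \ldots$, and $\{f_n\}$ converges pointwise to $f$ at each point of $E$; and (ii) $\{f_n\}$ converges weak-star to the boundary function of $g$.
   Context: $\Delta$ denotes the open unit disc in $\mathbb{C}$ and $T$ the unit circle. Polynomials are polynomials in the complex variable $z$ with complex coefficients. By Fatou's theorem, each bounded analytic function $g$ in $\Delta$ has a radial boundary function, defined for almost every $e^{i\theta} \in T$ by $g(e^{i\theta}) = \lim_{r \to 1^-} g(re^{i\theta})$; ''almost every'' refers to Lebesgue (arc length) measure on $T$. A sequence $\{f_n\}$ in $L^\infty(T)$ converges weak-star to $g \in L^\infty(T)$ if $\lim_{n\to\infty} \int_T f_n(z) Q(z)\,dz = \int_T g(z) Q(z)\,dz$ for every $Q \in L^1(T)$. *)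

(* Defs.v *)
From HB Require Import structures.
From mathcomp Require Import all_boot all_order all_algebra.
From mathcomp Require Import all_classical all_reals all_analysis.
From mathcomp Require Import complex.

Set Implicit Arguments.
Unset Strict Implicit.
Unset Printing Implicit Defensive.

Import Order.TTheory GRing.Theory Num.Theory.
Import numFieldNormedType.Exports.

Local Open Scope classical_set_scope.
Local Open Scope complex_scope.
Local Open Scope ring_scope.

(* The topology of R[i] is the one given by the modulus, and R[i] is a normed
   module over itself, so that [derivable g z 1] is complex
   differentiability. *)
HB.instance Definition _ (R : rcfType) := NormedModule.copy R[i] R[i]^o.

Section Definitions.
Variable R : realType.
Implicit Types (g h Q : R[i] -> R[i]) (z : R[i]).

Definition unit_disc : set R[i] := [set z | `|z| < 1].

Definition unit_circle : set R[i] := [set z | `|z| = 1].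

Definition bounded_analytic g :=
  (forall z, unit_disc z -> derivable g z 1) /\
  (exists B : R, forall z, unit_disc z -> `|g z| <= B%:C).

(* At the points where the radial limit does not exist (a null set when g is
   bounded and analytic in the disc), [lim] is a default constant. *)
Definition boundary_fun g z : R[i] :=
  lim (g (r%:C * z) @[r --> (1 : R)^'-]).

(* Functions on the circle are total functions on R[i] of which only the values
   on the circle are used; measurability and integrability refer to the
   parametrization [expi] on [angles]. Elements of L^1 and L^oo are given by
   Borel representatives. *)
Definition expi (t : R) : R[i] := cos t +i* sin t.

Definition angles : set R := `[0, 2 * pi].

Definition L1_circle Q :=
  lebesgue_measure.-integrable angles (fun t => (complex.Re (Q (expi t)))%:E) /\
  lebesgue_measure.-integrable angles (fun t => (complex.Im (Q (expi t)))%:E).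

Definition Linfty_circle h :=
  [/\ measurable_fun angles (fun t => complex.Re (h (expi t))),
      measurable_fun angles (fun t => complex.Im (h (expi t))) &
      exists B : R, {ae lebesgue_measure,
        forall t, angles t -> `|h (expi t)| <= B%:C}].

(* The integral of h(z) dz over the circle: dz = i e^{it} dt. *)
Definition circle_integral h : R[i] :=
  let u t := h (expi t) * ((0 +i* 1) * expi t) in
  (\int[lebesgue_measure]_(t in angles) complex.Re (u t)) +i*
  (\int[lebesgue_measure]_(t in angles) complex.Im (u t)).

Definition weak_star_cvg (F : nat -> R[i] -> R[i]) h :=
  [/\ forall n, Linfty_circle (F n),
      Linfty_circle h &
      forall Q, L1_circle Q ->
        circle_integral (fun z => F n z * Q z) @[n --> \oo] -->
        circle_integral (fun z => h z * Q z)].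

End Definitions.

Arguments unit_disc {R}.
Arguments unit_circle {R}.

(* Main.v *)
Require Import Defs.
From mathcomp Require Import all_boot all_order all_algebra.
From mathcomp Require Import all_classical all_reals all_analysis.
From mathcomp Require Import measurable_realfun complex.
From mathcomp Require Import ring lra.

Set Implicit Arguments.
Unset Strict Implicit.
Unset Printing Implicit Defensive.

Import Order.TTheory GRing.Theory Num.Theory.
Import numFieldNormedType.Exports.
Import Normc.

Local Open Scope classical_set_scope.
Local Open Scope complex_scope.
Local Open Scope ring_scope.

(** Both conditions compare a bounded sequence of functions on the circle with polynomials,
    and both are stable under passing to convex combinations of tails: these keep a bound
    and a pointwise limit ([tail_hull_cvg]), and polynomials remain polynomials. The point
    of convex combinations is that a bounded sequence of continuous functions always has
    convex combinations of tails that converge almost everywhere ([tail_hull_cvg_ae]):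
    elements of nearly minimal mean square form a Cauchy sequence by the parallelogram
    identity.

    Given the polynomials [P n], let the polynomials [q j] be such combinations, with limit
    [h] almost everywhere on the circle. In the disc, [q j] tends to the Cauchy transform
    [g] of [h], which is therefore bounded, and the radial limits of [g] are equal to [h]
    almost everywhere ([fatou_radial_limit]). So [q j] tends to the boundary function of
    [g] almost everywhere, and weak-star by dominated convergence; the [q j] are the
    required continuous functions ([poly_sequence_weak_star]).

    Conversely, let [F] and [g] be given. It suffices to find, in the convex hull of each
    tail of [F], a function that is uniformly close to a polynomial on the circle
    ([hull_near_poly]): polynomials that are closer and closer to such functions converge
    to [f] on [E], and a factor tending to 1 restores the bound [M].

    - Closeness in the mean. Take convex combinations [G j] of the [F n], and [q j] of
      polynomials approximating [g] in the disc, that converge almost everywhere. Both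
      limits are the boundary function of [g], the first by the weak-star hypothesis, the
      second by Fatou's theorem. So [G j - q j], which is bounded, tends to 0 in mean square
      ([hull_poly_energy0]).
    - From the mean to the supremum. The sum of [N] of the functions [G j] is built as
      [S + Z], where [Z] is within [N * eta] of a polynomial and [S] is bounded by a constant
      times [sqrt N], so that the average of the [N] functions is close to a polynomial
      ([tail_hull_near_poly]). To add a function that differs from a polynomial by some
      [D] with a very small mean, choose a polynomial [phi] with values in the disc of
      diameter [0, 1], close to 1 where [|D|] is not small, and with very small
      coefficients in low degree ([cutoff_poly]), and replace [S] by
      [S * (1 - phi) + D * phi]. Its squared modulus is at most [|S|^2 + |D|^2]. What is
      left over is [D * (1 - phi)], which is small, and [S * phi], which is close to a
      polynomial because [S] is close to a trigonometric polynomial ([near_poly_mul]).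

    The cutoff [phi] is a Taylor polynomial of [1 - 1 / (1 + herglotz w)] with [w]
    proportional to [|D|]. Taylor expansions of complex differentiable functions rest on
    Goursat's theorem, proved in polar coordinates ([goursat], [taylor_remainder]). *)

(** * The modulus and the exponential *)

Section Modulus.
Variable R : realType.
Implicit Types (x y z w : R[i]) (t s r : R).

Lemma cnormE z : `|z| = (normc z)%:C.
Proof. by rewrite normc_def; case: z. Qed.

Lemma lecnormE z (B : R) : (`|z| <= B%:C) = (normc z <= B).
Proof. by rewrite cnormE lecR. Qed.

Lemma normc_ge0 z : 0 <= normc z.
Proof. by case: z => a b; exact: sqrtr_ge0. Qed.

Lemma ler_normcD z w : normc (z + w) <= normc z + normc w.
Proof. exact: le_normcD. Qed.

Lemma normcBC z w : normc (z - w) = normc (w - z).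
Proof. by rewrite -(normcN (z - w)) opprB. Qed.

Lemma ler_normcB z w : normc (z - w) <= normc z + normc w.
Proof. by rewrite -(normcN w); exact: ler_normcD. Qed.

Lemma normc_triangle y z w : normc (z - w) <= normc (z - y) + normc (y - w).
Proof. by rewrite -[z - w](subrKA y); exact: ler_normcD. Qed.

Lemma normc_real t : normc t%:C = `|t|.
Proof. by rewrite /= expr0n/= addr0 sqrtr_sqr. Qed.

Lemma normc_conj z : normc z^*%C = normc z.
Proof. by case: z => a b /=; rewrite sqrrN. Qed.

Lemma normc_sqr z : normc z ^+ 2 = complex.Re z ^+ 2 + complex.Im z ^+ 2.
Proof. by case: z => a b /=; rewrite sqr_sqrtr // addr_ge0 // sqr_ge0. Qed.

Lemma normcX z n : normc (z ^+ n) = normc z ^+ n.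
Proof. by elim: n => [|n IH]; rewrite ?normc1 // !exprS normcM IH. Qed.

Lemma normc_eq0 z : (normc z == 0) = (z == 0).
Proof. by apply/eqP/eqP => [/eq0_normc//|->]; rewrite normc0. Qed.

Lemma normc_gt0 z : (0 < normc z) = (z != 0).
Proof. by rewrite lt_neqAle normc_ge0 andbT eq_sym normc_eq0. Qed.

Lemma mul_conjc z : z * z^*%C = (normc z ^+ 2)%:C.
Proof. by rewrite -sqr_normc cnormE rmorphXn. Qed.

Lemma Re_le_normc z : `|complex.Re z| <= normc z.
Proof. by rewrite -lecR -cnormE normc_ge_Re. Qed.

Lemma Im_le_normc z : `|complex.Im z| <= normc z.
Proof.
case: z => a b /=; rewrite -[leLHS]sqrtr_sqr.
by rewrite ler_wsqrtr // lerDr sqr_ge0.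
Qed.

Lemma normc_le_ReIm z : normc z <= `|complex.Re z| + `|complex.Im z|.
Proof.
case: z => a b /=.
rewrite -[leRHS]ger0_norm ?addr_ge0 // -sqrtr_sqr ler_wsqrtr //.
rewrite sqrrD !real_normK ?num_real // -addrA lerD2l lerDr.
by rewrite mulrn_wge0 // mulr_ge0.
Qed.

Lemma cReD z w : complex.Re (z + w) = complex.Re z + complex.Re w.
Proof. by case: z w => a b [c d]. Qed.
Lemma cImD z w : complex.Im (z + w) = complex.Im z + complex.Im w.
Proof. by case: z w => a b [c d]. Qed.
Lemma cReN z : complex.Re (- z) = - complex.Re z.
Proof. by case: z. Qed.
Lemma cImN z : complex.Im (- z) = - complex.Im z.
Proof. by case: z. Qed.
Lemma cReM z w : complex.Re (z * w) =
  complex.Re z * complex.Re w - complex.Im z * complex.Im w.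
Proof. by case: z w => a b [c d]. Qed.
Lemma cImM z w : complex.Im (z * w) =
  complex.Re z * complex.Im w + complex.Im z * complex.Re w.
Proof. by case: z w => a b [c d]. Qed.

Lemma complex_eqP z w : complex.Re z = complex.Re w ->
  complex.Im z = complex.Im w -> z = w.
Proof. by case: z w => a b [c d] /= -> ->. Qed.

Lemma expi_norm t : normc (expi t) = 1.
Proof. by rewrite /= cos2Dsin2 sqrtr1. Qed.

Lemma expi_neq0 t : expi t != 0.
Proof. by rewrite -normc_eq0 expi_norm oner_eq0. Qed.

Lemma expiD s t : expi (s + t) = expi s * expi t.
Proof. by apply: complex_eqP; rewrite /= ?cosD ?sinD //; ring. Qed.

Lemma expi0 : expi 0 = 1 :> R[i].
Proof. by rewrite /expi cos0 sin0. Qed.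

Lemma expiN t : expi (- t) = (expi t)^*%C.
Proof. by rewrite /expi cosN sinN. Qed.

Lemma conj_expi t : (expi t)^*%C = (expi t)^-1.
Proof.
apply: (mulfI (expi_neq0 t)); rewrite mulfV ?expi_neq0 //.
by rewrite mul_conjc expi_norm expr1n.
Qed.

Lemma expi_circle t : unit_circle (expi t).
Proof. by rewrite /unit_circle /= cnormE expi_norm. Qed.

Lemma circleP z : unit_circle z <-> normc z = 1.
Proof.
by rewrite /unit_circle /= cnormE; split=> [[]//|->].
Qed.

Lemma discP z : unit_disc z <-> normc z < 1.
Proof. by rewrite /unit_disc /= cnormE ltcR. Qed.

Lemma circle_expi z : unit_circle z -> exists2 t, 0 <= t < 2 * pi & z = expi t.
Proof.
move=> /circleP z1; have := normc_sqr z; rewrite z1 expr1n => /esym h.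
have Re1 : -1 <= complex.Re z <= 1 by rewrite -ler_norml -z1; exact: Re_le_normc.
have pi0 := pi_gt0 R.
have acb : 0 <= acos (complex.Re z) <= pi.
  by rewrite acos_ge0 // acos_lepi.
have sn : sin (acos (complex.Re z)) = `|complex.Im z|.
  rewrite sin_acos // -sqrtr_sqr; congr Num.sqrt.
  by rewrite -h; ring.
have cs := acosK Re1.
case: (leP 0 (complex.Im z)) => I0.
  exists (acos (complex.Re z)); first by lra.
  by apply: complex_eqP; rewrite /= ?cs // sn ger0_norm.
exists (2 * pi - acos (complex.Re z)).
  have : acos (complex.Re z) != 0.
    apply/eqP => a0; move: sn; rewrite a0 sin0 => /esym/eqP; rewrite normr_eq0.
    by move/eqP; lra.
  move/eqP; have /andP[] := acb; rewrite le_eqVlt => /orP[/eqP <-//|]; lra.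
have e2 (x : R) : 2 * pi - x = - x + pi *+ 2 by rewrite -mulr_natl; ring.
apply: complex_eqP; rewrite /= e2; first by rewrite cosD2pi cosN cs.
by rewrite sinD2pi sinN sn ltr0_norm ?opprK.
Qed.

End Modulus.

(** * Complex-valued functions of a real variable *)

Section Limits.
Variable R : realType.

Lemma cvgcP (T : Type) (F : set_system T) {FF : Filter F} (f : T -> R[i]) l :
  f x @[x --> F] --> l <->
  forall e : R, 0 < e -> \forall x \near F, normc (f x - l) < e.
Proof.
split=> [/cvgrPdist_lt h e e0|h].
  have := h e%:C; rewrite ltcR => /(_ e0); apply: filterS => x.
  by rewrite cnormE ltcR normcBC.
apply/cvgrPdist_lt => e; rewrite ltcE /= => /andP[/eqP Ie Re0].
have := h _ Re0; apply: filterS => x.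
by rewrite cnormE ltcE /= Ie eqxx normcBC.
Qed.

Lemma cvgRP (T : Type) (F : set_system T) {FF : Filter F} (f : T -> R) l :
  f x @[x --> F] --> l <->
  forall e : R, 0 < e -> \forall x \near F, `|f x - l| < e.
Proof.
split=> [/cvgrPdist_lt h e e0|h].
  by have := h e e0; apply: filterS => x; rewrite distrC.
by apply/cvgrPdist_lt => e e0; have := h e e0; apply: filterS => x; rewrite distrC.
Qed.

Lemma cvgc_ReIm (T : Type) (F : set_system T) {FF : Filter F} (f : T -> R[i]) l :
  f x @[x --> F] --> l <->
  (complex.Re (f x) @[x --> F] --> complex.Re l /\
   complex.Im (f x) @[x --> F] --> complex.Im l).
Proof.
split=> [/cvgcP h|[/cvgRP h1 /cvgRP h2]].
  split; apply/cvgRP => e e0; have := h e e0; apply: filterS => x; apply: le_lt_trans.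
    by rewrite -cReN -cReD; exact: Re_le_normc.
  by rewrite -cImN -cImD; exact: Im_le_normc.
apply/cvgcP => e e0; have e2 : 0 < e / 2 by rewrite divr_gt0.
near=> x; apply: le_lt_trans (normc_le_ReIm _) _.
rewrite cReD cImD cReN cImN [ltRHS](splitr e) ltrD //; near: x; [exact: h1|exact: h2].
Unshelve. all: by end_near. Qed.

Lemma ler_dist_normc (x y : R[i]) : `|normc x - normc y| <= normc (x - y).
Proof.
have := normc_triangle y x 0; have := normc_triangle x y 0.
by rewrite !subr0 (normcBC y x) ler_norml; lra.
Qed.

Lemma cvg_normc (T : Type) (F : set_system T) {FF : Filter F} (f : T -> R[i]) l :
  f x @[x --> F] --> l -> normc (f x) @[x --> F] --> normc l.
Proof.
move=> /cvgcP h; apply/cvgRP => e e0; have := h e e0; apply: filterS => x.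
by apply: le_lt_trans; exact: ler_dist_normc.
Qed.

Lemma cvgc_unique (T : Type) (F : set_system T) {FF : ProperFilter F} (f : T -> R[i]) (l l' : R[i]) :
  f x @[x --> F] --> l -> f x @[x --> F] --> l' -> l = l'.
Proof. by move=> h h'; exact: (cvg_unique (@norm_hausdorff _ R[i]) h h'). Qed.

Lemma cvgc_le (T : Type) (F : set_system T) {FF : ProperFilter F} (f : T -> R[i]) (l c : R[i]) (B : R) :
  f x @[x --> F] --> l -> (\forall x \near F, normc (f x - c) <= B) -> normc (l - c) <= B.
Proof.
move=> /cvgcP h nB; apply/ler_addgt0Pr => e e0; near F => x.
apply: le_trans (normc_triangle (f x) _ _) _; rewrite addrC lerD //; first by near: x.
by rewrite normcBC ltW //; near: x; exact: h.
Unshelve. all: by end_near. Qed.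

Definition ccont (u : R -> R[i]) := forall t, u s @[s --> t] --> u t.

Lemma ccont_ReIm u : ccont u <->
  continuous (fun t => complex.Re (u t)) /\ continuous (fun t => complex.Im (u t)).
Proof.
split=> [h|[h1 h2] t]; last by apply/cvgc_ReIm; split; [exact: h1|exact: h2].
by split=> t; have /cvgc_ReIm[] := h t.
Qed.

Lemma ccontD u v : ccont u -> ccont v -> ccont (fun t => u t + v t).
Proof. by move=> cu cv t; apply: cvgD; [exact: cu|exact: cv]. Qed.
Lemma ccontB u v : ccont u -> ccont v -> ccont (fun t => u t - v t).
Proof. by move=> cu cv t; apply: cvgB; [exact: cu|exact: cv]. Qed.
Lemma ccontM u v : ccont u -> ccont v -> ccont (fun t => u t * v t).
Proof. by move=> cu cv t; apply: cvgM; [exact: cu|exact: cv]. Qed.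
Lemma ccont_cst c : ccont (fun=> c).
Proof. by move=> t; exact: cvg_cst. Qed.
Lemma ccontX u n : ccont u -> ccont (fun t => u t ^+ n).
Proof.
move=> cu; elim: n => [|n IH]; first exact: ccont_cst.
by under [X in ccont X]eq_fun do rewrite exprS; exact: ccontM.
Qed.
Lemma ccontV u : (forall t, u t != 0) -> ccont u -> ccont (fun t => (u t)^-1).
Proof. by move=> u0 cu t; apply: cvgV => //; exact: cu. Qed.
Lemma ccont_conj u : ccont u -> ccont (fun t => (u t)^*%C).
Proof.
move=> cu t; have /cvgcP h := cu t; apply/cvgcP => e /h; apply: filterS => s.
by rewrite -rmorphB normc_conj.
Qed.
Lemma ccont_real (f : R -> R) : continuous f -> ccont (fun t => (f t)%:C).
Proof.
by move=> cf; apply/ccont_ReIm; split => //= t; exact: cvg_cst.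
Qed.
Lemma ccont_normc u : ccont u -> continuous (fun t => normc (u t)).
Proof. by move=> cu t; apply: cvg_normc; exact: cu. Qed.

Lemma ccont_expi : ccont (@expi R).
Proof.
by apply/ccont_ReIm; split => /= t; [exact: continuous_cos|exact: continuous_sin].
Qed.

Lemma ccont_poly (p : {poly R[i]}) u : ccont u -> ccont (fun t => p.[u t]).
Proof.
move=> cu; elim/poly_ind: p => [|p c IH].
  by under [X in ccont X]eq_fun do rewrite horner0; exact: ccont_cst.
under [X in ccont X]eq_fun do rewrite hornerMXaddC.
by apply: ccontD; [exact: ccontM|exact: ccont_cst].
Qed.

End Limits.

(** * Integrals of complex-valued functions *)

Section ComplexIntegral.
Variable R : realType.
Notation mu := (@lebesgue_measure R).
Implicit Types (u v : R -> R[i]) (D : set R).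

Definition cintegrable D u :=
  mu.-integrable D (fun t => (complex.Re (u t))%:E) /\
  mu.-integrable D (fun t => (complex.Im (u t))%:E).

Definition cint D u : R[i] :=
  (\int[mu]_(t in D) complex.Re (u t)) +i* (\int[mu]_(t in D) complex.Im (u t)).

Lemma eq_cint D u v : (forall t, D t -> u t = v t) -> cint D u = cint D v.
Proof.
by move=> h; congr (_ +i* _); apply: eq_Rintegral => t /[!inE] Dt /=; rewrite h.
Qed.

Lemma eq_cintegrable D u v : measurable D -> (forall t, D t -> u t = v t) ->
  cintegrable D u -> cintegrable D v.
Proof.
move=> mD h [h1 h2]; split; [move: h1|move: h2]; apply: eq_integrable => // t /[!inE] Dt;
by rewrite h.
Qed.

Lemma integrable_EFin_comb D (f g : R -> R) (a b : R) : measurable D ->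
  mu.-integrable D (EFin \o f) -> mu.-integrable D (EFin \o g) ->
  mu.-integrable D (fun t => (a * f t + b * g t)%:E).
Proof.
move=> mD hf hg.
have -> : (fun t => (a * f t + b * g t)%:E) =
  ((fun t => a%:E * (EFin \o f) t) \+ (fun t => b%:E * (EFin \o g) t))%E by [].
by apply: integrableD => //; exact: integrableZl.
Qed.

Lemma Rintegral_comb D (f g : R -> R) (a b : R) : measurable D ->
  mu.-integrable D (EFin \o f) -> mu.-integrable D (EFin \o g) ->
  \int[mu]_(t in D) (a * f t + b * g t) =
  a * \int[mu]_(t in D) f t + b * \int[mu]_(t in D) g t.
Proof.
move=> mD hf hg; rewrite RintegralD ?RintegralZl //.
- have -> : EFin \o (fun t => a * f t) = (fun t => a%:E * (EFin \o f) t)%E by [].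
  exact: integrableZl.
- have -> : EFin \o (fun t => b * g t) = (fun t => b%:E * (EFin \o g) t)%E by [].
  exact: integrableZl.
Qed.

Lemma cintegrableZ D u c : measurable D -> cintegrable D u -> cintegrable D (fun t => c * u t).
Proof.
move=> mD [h1 h2]; split.
  have := integrable_EFin_comb (complex.Re c) (- complex.Im c) mD h1 h2.
  by apply: eq_integrable => // t _; rewrite cReM mulNr.
have := integrable_EFin_comb (complex.Re c) (complex.Im c) mD h2 h1.
by apply: eq_integrable => // t _; rewrite cImM.
Qed.

Lemma cintZ D u c : measurable D -> cintegrable D u ->
  cint D (fun t => c * u t) = c * cint D u.
Proof.
move=> mD [h1 h2]; apply: complex_eqP => /=.
  have := Rintegral_comb (complex.Re c) (- complex.Im c) mD h1 h2.
  rewrite cReM /= mulNr => <-; apply: eq_Rintegral => t _.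
  by rewrite cReM mulNr.
have := Rintegral_comb (complex.Re c) (complex.Im c) mD h2 h1.
rewrite cImM /= => <-; apply: eq_Rintegral => t _.
by rewrite cImM.
Qed.

Lemma cintegrableD D u v : measurable D -> cintegrable D u -> cintegrable D v ->
  cintegrable D (fun t => u t + v t).
Proof.
move=> mD [h1 h2] [k1 k2]; split.
  have := integrable_EFin_comb 1 1 mD h1 k1.
  by apply: eq_integrable => // t _; rewrite cReD !mul1r.
have := integrable_EFin_comb 1 1 mD h2 k2.
by apply: eq_integrable => // t _; rewrite cImD !mul1r.
Qed.

Lemma cintD D u v : measurable D -> cintegrable D u -> cintegrable D v ->
  cint D (fun t => u t + v t) = cint D u + cint D v.
Proof.
move=> mD [h1 h2] [k1 k2]; apply: complex_eqP => /=.
  have := Rintegral_comb 1 1 mD h1 k1; rewrite !mul1r => <-; apply: eq_Rintegral => t _.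
  by rewrite cReD !mul1r.
have := Rintegral_comb 1 1 mD h2 k2; rewrite !mul1r => <-; apply: eq_Rintegral => t _.
by rewrite cImD !mul1r.
Qed.

Lemma cintegrableB D u v : measurable D -> cintegrable D u -> cintegrable D v ->
  cintegrable D (fun t => u t - v t).
Proof.
move=> mD hu hv; have := cintegrableD mD hu (cintegrableZ (-1) mD hv).
by apply: eq_cintegrable => // t _; rewrite mulN1r.
Qed.

Lemma cintB D u v : measurable D -> cintegrable D u -> cintegrable D v ->
  cint D (fun t => u t - v t) = cint D u - cint D v.
Proof.
move=> mD hu hv; rewrite -[in RHS]mulN1r -cintZ // -cintD //; last exact: cintegrableZ.
by apply: eq_cint => t _; rewrite mulN1r.
Qed.

Lemma cintegrable_normc D u : measurable D -> cintegrable D u ->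
  mu.-integrable D (fun t => (normc (u t))%:E).
Proof.
move=> mD [h1 h2].
have h : mu.-integrable D (fun t => `|(complex.Re (u t))%:E| + `|(complex.Im (u t))%:E|)%E.
  by apply: integrableD => //; exact: integrable_abse.
apply: le_integrable h => //.
  apply/measurable_EFinP.
  have -> : (fun t => normc (u t)) =
     Num.sqrt \o (fun t => complex.Re (u t) ^+ 2 + complex.Im (u t) ^+ 2).
    by apply/funext => t /=; rewrite -normc_sqr sqrtr_sqr ger0_norm // normc_ge0.
  apply: measurableT_comp => //.
    by apply: continuous_measurable_fun; exact: sqrt_continuous.
  by apply: measurable_funD; apply: measurable_funX; apply/measurable_EFinP; case/integrableP: h1 h2 => [? _] /integrableP[].
move=> t _ /=; rewrite lee_fin (ger0_norm (normc_ge0 _)).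
by apply: le_trans (normc_le_ReIm _) (ler_norm _).
Qed.

(** Rotating the integral onto the positive axis reduces the complex triangle inequality to
    the monotonicity of the real integral. *)
Lemma normc_cint D u : measurable D -> cintegrable D u ->
  normc (cint D u) <= \int[mu]_(t in D) normc (u t).
Proof.
move=> mD iu; have iN := cintegrable_normc mD iu.
have [->|n0] := eqVneq (cint D u) 0.
  by rewrite normc0 Rintegral_ge0 // => t _; exact: normc_ge0.
set I := cint D u in n0 *.
pose c := I^*%C / (normc I)%:C.
have nI : normc I != 0 by rewrite normc_eq0.
have c1 : normc c = 1.
  by rewrite normcM normc_conj normcV normc_real (ger0_norm (normc_ge0 _)) mulfV.
have : c * I = (normc I)%:C.
  rewrite /c mulrAC [_ * I]mulrC mul_conjc expr2 rmorphM /= -mulrA mulfV ?mulr1 //.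
  by apply/eqP => -[]; apply/eqP.
rewrite -cintZ // => /(congr1 (@complex.Re R)) /= <-.
have [i1 _] := cintegrableZ c mD iu.
apply: le_Rintegral => // t _.
by apply: le_trans (ler_norm _) _; apply: le_trans (Re_le_normc _) _; rewrite normcM c1 mul1r.
Qed.

Lemma normc_cint_le D u (v : R -> R) : measurable D -> cintegrable D u ->
  mu.-integrable D (fun t => (v t)%:E) -> (forall t, D t -> normc (u t) <= v t) ->
  normc (cint D u) <= \int[mu]_(t in D) v t.
Proof.
move=> mD iu iv h; apply: le_trans (normc_cint mD iu) _.
by apply: le_Rintegral => //; exact: cintegrable_normc.
Qed.

End ComplexIntegral.

(** * Measurability and dominated convergence *)

Section Measurability.
Variable R : realType.
Notation mu := (@lebesgue_measure R).
Implicit Types (u v : R -> R[i]) (D : set R).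

Definition cmeasurable D u :=
  measurable_fun D (fun t => complex.Re (u t)) /\
  measurable_fun D (fun t => complex.Im (u t)).

Lemma cmeasurable_cont D u : measurable D -> ccont u -> cmeasurable D u.
Proof.
move=> mD /ccont_ReIm[h1 h2]; split; apply: measurable_funTS;
exact: continuous_measurable_fun.
Qed.

Lemma cmeasurableD D u v : cmeasurable D u -> cmeasurable D v ->
  cmeasurable D (fun t => u t + v t).
Proof.
move=> [h1 h2] [k1 k2]; split.
  by under eq_fun do rewrite cReD; exact: measurable_funD.
by under eq_fun do rewrite cImD; exact: measurable_funD.
Qed.

Lemma cmeasurableM D u v : cmeasurable D u -> cmeasurable D v ->
  cmeasurable D (fun t => u t * v t).
Proof.
move=> [h1 h2] [k1 k2]; split.
  by under eq_fun do rewrite cReM; apply: measurable_funB; exact: measurable_funM.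
by under eq_fun do rewrite cImM; apply: measurable_funD; exact: measurable_funM.
Qed.

Lemma cmeasurableN D u : cmeasurable D u -> cmeasurable D (fun t => - u t).
Proof.
move=> [h1 h2]; split.
  by under eq_fun do rewrite cReN; exact: measurable_funN.
by under eq_fun do rewrite cImN; exact: measurable_funN.
Qed.

Lemma cmeasurableB D u v : cmeasurable D u -> cmeasurable D v ->
  cmeasurable D (fun t => u t - v t).
Proof. by move=> h k; apply: cmeasurableD => //; exact: cmeasurableN. Qed.

Lemma cmeasurable_conj D u : cmeasurable D u -> cmeasurable D (fun t => (u t)^*%C).
Proof.
move=> [h1 h2]; split.
  by apply: eq_measurable_fun h1 => t _; case: (u t).
have := measurable_funN h2; apply: eq_measurable_fun => t _ /=; by case: (u t).
Qed.

Lemma cintegrable_measurable D u : cintegrable D u -> cmeasurable D u.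
Proof. by move=> [/integrableP[h1 _] /integrableP[h2 _]]; split; exact/measurable_EFinP. Qed.

Lemma ae_imply (P Q : R -> Prop) : {ae mu, forall t, P t} -> (forall t, P t -> Q t) ->
  {ae mu, forall t, Q t}.
Proof. by move=> h PQ; apply: (@filterS _ _ (ae_filter_ringOfSetsType mu) _ _ PQ). Qed.

Lemma ae_imply2 (P Q S : R -> Prop) : {ae mu, forall t, P t} -> {ae mu, forall t, Q t} ->
  (forall t, P t -> Q t -> S t) -> {ae mu, forall t, S t}.
Proof. by move=> h k PQ; apply: (@filterS2 _ _ (ae_filter_ringOfSetsType mu) _ _ _ PQ). Qed.

Lemma measurable_fun_EFin D (f : R -> R) : measurable_fun D f ->
  measurable_fun D (fun t => (f t)%:E).
Proof. by move=> mf; have /measurable_EFinP := mf. Qed.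

Lemma integrable_le_bound D (f : R -> R) B : measurable D -> (mu D < +oo)%E ->
  measurable_fun D f -> (forall t, D t -> `|f t| <= B) -> mu.-integrable D (fun t => (f t)%:E).
Proof.
move=> mD fD mf fB; apply: measurable_bounded_integrable => //.
by exists B; split; [exact: num_real|move=> x Bx t Dt /=; exact: le_trans (fB _ Dt) (ltW Bx)].
Qed.

Lemma cintegrable_bounded D u B : measurable D -> (mu D < +oo)%E ->
  cmeasurable D u -> (forall t, D t -> normc (u t) <= B) -> cintegrable D u.
Proof.
move=> mD fD [h1 h2] uB; split; apply: (integrable_le_bound (B := B)) => // t Dt.
  exact: le_trans (Re_le_normc _) (uB _ Dt).
exact: le_trans (Im_le_normc _) (uB _ Dt).
Qed.

Lemma Rintegral_dominated D (f_ : nat -> R -> R) (f b : R -> R) :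
  measurable D -> mu.-integrable D (fun t => (b t)%:E) ->
  (forall n, measurable_fun D (f_ n)) -> measurable_fun D f ->
  (forall n t, D t -> `|f_ n t| <= b t) ->
  {ae mu, forall t, D t -> f_ n t @[n --> \oo] --> f t} ->
  mu.-integrable D (fun t => (f t)%:E) /\
  \int[mu]_(t in D) f_ n t @[n --> \oo] --> \int[mu]_(t in D) f t.
Proof.
move=> mD ib mf_ mf fB cf.
have [|||||i1 _ c] := @dominated_convergence _ _ R mu D mD (fun n t => (f_ n t)%:E) (fun t => (f t)%:E) (fun t => (b t)%:E).
- by move=> n; exact: measurable_fun_EFin.
- exact: measurable_fun_EFin.
- apply: ae_imply cf _ => t h Dt; apply/fine_cvgP; split; first exact: nearW.
  exact: h.
- exact: ib.
- by apply: aeW => t n Dt /=; rewrite lee_fin fB.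
split=> //.
have iff : (\int[mu]_(t in D) (f t)%:E)%E \is a fin_num by exact: integrable_fin_num.
move: c; rewrite -(fineK iff) => /fine_cvgP[_]; apply: cvg_trans.
by apply: near_eq_cvg; exact: nearW.
Qed.

Lemma cint_dominated D (u_ : nat -> R -> R[i]) u (b : R -> R) :
  measurable D -> mu.-integrable D (fun t => (b t)%:E) ->
  (forall n, cmeasurable D (u_ n)) -> cmeasurable D u ->
  (forall n t, D t -> normc (u_ n t) <= b t) ->
  {ae mu, forall t, D t -> u_ n t @[n --> \oo] --> u t} ->
  cintegrable D u /\ cint D (u_ n) @[n --> \oo] --> cint D u.
Proof.
move=> mD ib mu_ [m1 m2] uB cu.
have [||||i1 c1] := @Rintegral_dominated D (fun n t => complex.Re (u_ n t)) (fun t => complex.Re (u t)) b mD ib.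
- by move=> n; case: (mu_ n).
- by [].
- by move=> n t Dt; exact: le_trans (Re_le_normc _) (uB _ _ Dt).
- by apply: ae_imply cu _ => t h Dt; case: ((cvgc_ReIm (fun n => u_ n t) (u t)).1 (h Dt)).
have [||||i2 c2] := @Rintegral_dominated D (fun n t => complex.Im (u_ n t)) (fun t => complex.Im (u t)) b mD ib.
- by move=> n; case: (mu_ n).
- by [].
- by move=> n t Dt; exact: le_trans (Im_le_normc _) (uB _ _ Dt).
- by apply: ae_imply cu _ => t h Dt; case: ((cvgc_ReIm (fun n => u_ n t) (u t)).1 (h Dt)).
by split; [split|apply/cvgc_ReIm; split].
Qed.

Lemma cont_itv_within (f : R -> R) (a b : R) :
  (forall t, a <= t <= b -> f s @[s --> t] --> f t) -> {within `[a, b], continuous f}.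
Proof.
move=> h; apply: continuous_in_subspaceT => t; rewrite inE /= in_itv /=; exact: h.
Qed.

Lemma cintegrable_cont_itv (a b : R) u :
  (forall t, a <= t <= b -> u s @[s --> t] --> u t) -> cintegrable `[a, b] u.
Proof.
move=> h; split; apply: continuous_compact_integrable; try exact: segment_compact;
by apply: cont_itv_within => t /h/cvgc_ReIm[].
Qed.

Lemma cintegrable_cont (a b : R) u : ccont u -> cintegrable `[a, b] u.
Proof. by move=> h; apply: cintegrable_cont_itv => t _; exact: h. Qed.

Lemma cint_split (a b c : R) u : a <= b <= c -> cintegrable `[a, c] u ->
  cint `[a, c] u = cint `[a, b] u + cint `[b, c] u.
Proof.
move=> /andP[ab bc] [h1 h2].
have key (f : R -> R) : mu.-integrable `[a, c] (EFin \o f) ->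
    \int[mu]_(t in `[a, c]) f t = \int[mu]_(t in `[a, b]) f t + \int[mu]_(t in `[b, c]) f t.
  move=> h; have := @Rintegral_itvB R f (BLeft a) (BRight c) b h.
  rewrite !bnd_simp => /(_ ab bc); rewrite Rintegral_itv_obnd_cbnd; first by move=> <-; ring.
  by apply: integrableS h => //; apply: subset_itv; rewrite bnd_simp.
by apply: complex_eqP; rewrite ?cReD ?cImD /=; exact: key.
Qed.

Lemma cint_FTC (a b : R) (U u : R -> R[i]) : a <= b ->
  (forall t, a <= t <= b -> u s @[s --> t] --> u t) ->
  (forall t, a <= t <= b -> is_derive t 1 (fun s => complex.Re (U s)) (complex.Re (u t)) /\
     is_derive t 1 (fun s => complex.Im (U s)) (complex.Im (u t))) ->
  cint `[a, b] u = U b - U a.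
Proof.
rewrite le_eqVlt => /predU1P[<-|ab] cu dU.
  by rewrite subrr set_itv1; apply: complex_eqP; rewrite /= Rintegral_set1.
have key (F f : R -> R) : (forall t, a <= t <= b -> f s @[s --> t] --> f t) ->
    (forall t, a <= t <= b -> is_derive t 1 F (f t)) ->
    \int[mu]_(t in `[a, b]) f t = F b - F a.
  move=> cf dF; rewrite /Rintegral (continuous_FTC2 ab (F := F)) //.
  - exact: cont_itv_within.
  - have cF t : a <= t <= b -> F s @[s --> t] --> F t.
      by move=> /dF[d _]; exact/differentiable_continuous/derivable1_diffP.
    split.
    + by move=> t /[!in_itv]/= /andP[/ltW ? /ltW ?]; case: (dF t) => //; apply/andP.
    + by apply: cvg_at_right_filter; apply: cF; rewrite lexx ltW.
    + by apply: cvg_at_left_filter; apply: cF; rewrite lexx ltW.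
  - move=> t /[!in_itv]/= /andP[/ltW ? /ltW ?].
    by rewrite derive1E; case: (dF t) => //; apply/andP.
apply: complex_eqP; rewrite !(cReD, cImD, cReN, cImN) /=.
  apply: (key (fun s => complex.Re (U s))) => t; first by move=> /cu/cvgc_ReIm[].
  by move=> /dU[].
apply: (key (fun s => complex.Im (U s))) => t; first by move=> /cu/cvgc_ReIm[].
by move=> /dU[].
Qed.

End Measurability.

(** * Derivatives along curves *)

Section CurveDerivative.
Variable R : realType.
Implicit Types (U V : R -> R[i]) (t : R) (p : {poly R[i]}).

Definition cder U t (d : R[i]) :=
  is_derive t 1 (fun s => complex.Re (U s)) (complex.Re d) /\
  is_derive t 1 (fun s => complex.Im (U s)) (complex.Im d).

Lemma cder_cst c t : cder (fun=> c) t 0.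
Proof. by split; exact: is_derive_cst. Qed.

Lemma cderD U V t d e : cder U t d -> cder V t e -> cder (fun s => U s + V s) t (d + e).
Proof.
move=> [h1 h2] [k1 k2]; split.
  by under eq_fun do rewrite cReD; rewrite cReD; exact: is_deriveD.
by under eq_fun do rewrite cImD; rewrite cImD; exact: is_deriveD.
Qed.

Lemma cderM U V t d e : cder U t d -> cder V t e ->
  cder (fun s => U s * V s) t (d * V t + U t * e).
Proof.
move=> [h1 h2] [k1 k2]; split.
  under eq_fun do rewrite cReM.
  apply: is_derive_eq.
  by rewrite !(cReM, cReD, cImM) /GRing.scale /=; ring.
under eq_fun do rewrite cImM.
apply: is_derive_eq.
by rewrite !(cImM, cImD, cReM) /GRing.scale /=; ring.
Qed.

Lemma cder_expi t : cder (@expi R) t ('i%C * expi t).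
Proof.
split; rewrite ?cReM ?cImM /= ?mul0r ?mul1r ?sub0r ?add0r.
  exact: is_derive_cos.
exact: is_derive_sin.
Qed.

Lemma cder_poly p U t d : cder U t d -> cder (fun s => p.[U s]) t (p^`().[U t] * d).
Proof.
move=> dU; elim/poly_ind: p => [|p c IH].
  under eq_fun do rewrite horner0; rewrite deriv0 horner0 mul0r; exact: cder_cst.
under eq_fun do rewrite hornerMXaddC.
have := cderD (cderM IH dU) (cder_cst c t).
rewrite addr0 derivD derivM derivX derivC addr0 mulr1 hornerD hornerM hornerX.
by congr cder; ring.
Qed.

End CurveDerivative.

(** * Means over the circle *)

Section Mean.
Variable R : realType.
Notation mu := (@lebesgue_measure R).
Notation A := (@angles R).
Implicit Types (u v : R -> R[i]) (t : R).

Lemma pi2_gt0 : 0 < 2 * pi :> R.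
Proof. by rewrite mulr_gt0 // pi_gt0. Qed.

Lemma measurable_angles : measurable A.
Proof. exact: measurable_itv. Qed.
Hint Resolve measurable_angles : core.

Lemma mu_angles : mu A = (2 * pi)%:E.
Proof. by rewrite /angles lebesgue_measure_itv /= lte_fin pi2_gt0 oppr0 adde0. Qed.

Lemma mu_angles_lty : (mu A < +oo)%E.
Proof. by rewrite mu_angles ltry. Qed.
Hint Resolve mu_angles_lty : core.

Lemma anglesP t : A t <-> 0 <= t <= 2 * pi.
Proof. by rewrite /angles /= in_itv. Qed.

Lemma cintegrable_angles u : ccont u -> cintegrable A u.
Proof. exact: cintegrable_cont. Qed.

Lemma cintegrable_cst c : cintegrable A (fun=> c).
Proof. by apply: cintegrable_angles; exact: ccont_cst. Qed.

Definition mean u : R[i] := ((2 * pi)^-1)%:C * cint A u.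

Lemma eq_mean u v : (forall t, A t -> u t = v t) -> mean u = mean v.
Proof. by move=> h; rewrite /mean (eq_cint h). Qed.

Lemma meanZ c u : cintegrable A u -> mean (fun t => c * u t) = c * mean u.
Proof. by move=> h; rewrite /mean cintZ // mulrCA. Qed.

Lemma meanD u v : cintegrable A u -> cintegrable A v ->
  mean (fun t => u t + v t) = mean u + mean v.
Proof. by move=> h k; rewrite /mean cintD // mulrDr. Qed.

Lemma meanB u v : cintegrable A u -> cintegrable A v ->
  mean (fun t => u t - v t) = mean u - mean v.
Proof. by move=> h k; rewrite /mean cintB // mulrBr. Qed.

Lemma Rintegral_angles_cst (c : R) : \int[mu]_(t in A) c = c * (2 * pi).
Proof. by rewrite Rintegral_cst //; congr (_ * _); exact: (congr1 fine mu_angles). Qed.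

Lemma mean_cst c : mean (fun=> c) = c.
Proof.
have pi2 : (2 * pi)^-1 * (2 * pi) = 1 :> R by rewrite mulVf // gt_eqF // pi2_gt0.
apply: complex_eqP; rewrite /mean ?cReM ?cImM /= !Rintegral_angles_cst.
  by rewrite mul0r subr0 mulrCA pi2 mulr1.
by rewrite mul0r addr0 mulrCA pi2 mulr1.
Qed.

Lemma normc_mean_le u v : cintegrable A u -> cintegrable A v ->
  (forall t, A t -> normc (u t) <= complex.Re (v t)) -> normc (mean u) <= complex.Re (mean v).
Proof.
move=> iu iv h; rewrite /mean normcM normc_real cReM /= mul0r subr0.
rewrite ger0_norm ?invr_ge0 ?(ltW pi2_gt0) // ler_wpM2l ?invr_ge0 ?(ltW pi2_gt0) //.
by apply: normc_cint_le => //; case: iv.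
Qed.

Lemma mean_bound u B : cintegrable A u -> (forall t, A t -> normc (u t) <= B) ->
  normc (mean u) <= B.
Proof.
move=> iu h; have := @normc_mean_le u (fun=> B%:C) iu (cintegrable_cst _).
by rewrite mean_cst; apply.
Qed.

Lemma mean_FTC (U u : R -> R[i]) : ccont u -> (forall t, cder U t (u t)) ->
  mean u = ((2 * pi)^-1)%:C * (U (2 * pi) - U 0).
Proof.
move=> cu dU; rewrite /mean; congr (_ * _); apply: cint_FTC => [|t _|t _].
- by rewrite ltW ?pi2_gt0.
- exact: cu.
- exact: dU.
Qed.

Lemma expi2pi : expi (2 * pi) = 1 :> R[i].
Proof.
have e : 2 * pi = pi *+ 2 :> R by rewrite mulr_natl.
by rewrite /expi e cos2pi sin2pi.
Qed.

Lemma mean_expiX n : mean (fun t => expi t ^+ n.+1) = 0.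
Proof.
have c0 : n.+1%:R * 'i%C != 0 :> R[i].
  by rewrite mulf_neq0 ?pnatr_eq0 // eq_complex /= oner_eq0 andbF.
have cX : ccont (fun t : R => expi t ^+ n.+1) by apply: ccontX; exact: ccont_expi.
apply: (mulfI c0); rewrite mulr0 -meanZ; last exact: cintegrable_angles.
pose U (t : R) := ('X^(n.+1) : {poly R[i]}).[expi t].
have dU t : cder U t (n.+1%:R * 'i%C * expi t ^+ n.+1).
  have := cder_poly 'X^(n.+1) (cder_expi t).
  rewrite derivXn hornerMn hornerXn -mulr_natl /= => h.
  have e (a b c d : R[i]) : a * b * (c * d) = a * c * (b * d) by ring.
  by rewrite exprSr -e.
have cu : ccont (fun t : R => n.+1%:R * 'i%C * expi t ^+ n.+1).
  by apply: ccontM cX; exact: ccont_cst.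
have -> := mean_FTC cu dU.
by rewrite /U expi2pi expi0 subrr mulr0.
Qed.

Lemma mean_conj u : cintegrable A u -> mean (fun t => (u t)^*%C) = (mean u)^*%C.
Proof.
move=> [h1 h2]; rewrite /mean rmorphM; congr (_ * _); first exact/esym/conjc_real.
apply: complex_eqP => /=; first by apply: eq_Rintegral => t _; case: (u t).
rewrite -[RHS]mulN1r -RintegralZl //; apply: eq_Rintegral => t _.
by case: (u t) => a b /=; rewrite mulN1r.
Qed.

Lemma ccont_expiX n : ccont (fun t : R => expi t ^+ n).
Proof. by apply: ccontX; exact: ccont_expi. Qed.

Lemma ccont_cexpiX n : ccont (fun t : R => (expi t)^*%C ^+ n).
Proof. by apply: ccontX; apply: ccont_conj; exact: ccont_expi. Qed.

Lemma mean_cexpiX n : mean (fun t => (expi t)^*%C ^+ n.+1) = 0.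
Proof.
rewrite -[RHS]conjc0 -(mean_expiX n) -mean_conj; last exact/cintegrable_angles/ccont_expiX.
by apply: eq_mean => t _; rewrite rmorphXn.
Qed.

Lemma mean_dominated (u_ : nat -> R -> R[i]) u B :
  (forall n, cmeasurable A (u_ n)) -> cmeasurable A u ->
  (forall n t, A t -> normc (u_ n t) <= B) ->
  {ae mu, forall t, A t -> u_ n t @[n --> \oo] --> u t} ->
  mean (u_ n) @[n --> \oo] --> mean u.
Proof.
move=> m1 m2 uB cu.
have iB : mu.-integrable A (fun=> B%:E).
  by apply: (integrable_le_bound (f := cst B) (B := `|B|)) => //; exact: mu_angles_lty.
have [_ h] := cint_dominated measurable_angles iB m1 m2 uB cu.
by apply: cvgM h; exact: cvg_cst.
Qed.

End Mean.
#[export] Hint Resolve measurable_angles mu_angles_lty : core.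

Lemma ccont_at (R : realType) (u : R -> R[i]) t : ccont u -> u s @[s --> t] --> u t.
Proof. by move=> cu; exact: cu. Qed.

Lemma ccontI (R : realType) (u : R -> R[i]) : (forall t, u s @[s --> t] --> u t) -> ccont u.
Proof. by []. Qed.

Lemma cintegrable_ReIm (R : realType) (D : set R) (u : R -> R[i]) : cintegrable D u <->
  lebesgue_measure.-integrable D (fun t => (complex.Re (u t))%:E) /\
  lebesgue_measure.-integrable D (fun t => (complex.Im (u t))%:E).
Proof. by []. Qed.

Lemma cmeasurable_ReIm (R : realType) (D : set R) (u : R -> R[i]) : cmeasurable D u <->
  measurable_fun D (fun t => complex.Re (u t)) /\
  measurable_fun D (fun t => complex.Im (u t)).
Proof. by []. Qed.

Lemma mean_real (R : realType) (f : R -> R) : complex.Re (mean (fun t => (f t)%:C)) =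
  (2 * pi)^-1 * \int[lebesgue_measure]_(t in @angles R) f t.
Proof. by rewrite /mean cReM /= mul0r subr0. Qed.

Lemma cint_ReE (R : realType) (D : set R) (u : R -> R[i]) :
  complex.Re (cint D u) = \int[lebesgue_measure]_(t in D) complex.Re (u t).
Proof. by []. Qed.

Lemma cint_ImE (R : realType) (D : set R) (u : R -> R[i]) :
  complex.Im (cint D u) = \int[lebesgue_measure]_(t in D) complex.Im (u t).
Proof. by []. Qed.

Lemma circle_integralE (R : realType) (h : R[i] -> R[i]) :
  circle_integral h = cint (@angles R) (fun t => h (expi t) * ('i%C * expi t)).
Proof. by []. Qed.

Lemma meanE (R : realType) (u : R -> R[i]) :
  mean u = ((2 * pi)^-1)%:C * cint (@angles R) u.
Proof. by []. Qed.

(* From here on these notions are used only through the lemmas stated above; keeping them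
   opaque keeps unification from unfolding integrals. *)
Global Opaque ccont cintegrable cmeasurable cint mean.
#[global] Arguments expi {R} t : simpl never.
#[global] Arguments conjc {R} x : simpl never.
#[global] Arguments normc {R} x : simpl never.
#[global] Arguments ccont_cst {R} c.
#[global] Arguments ccont_expi {R}.
#[global] Arguments ccont_expiX {R} n.
#[global] Arguments ccont_cexpiX {R} n.
#[global] Arguments ccont_poly {R} p {u}.

(** * The Cauchy kernel *)

Section PoissonKernel.
Variable R : realType.
Notation mu := (@lebesgue_measure R).
Notation A := (@angles R).
Implicit Types (u v : R -> R[i]) (t r : R) (z : R[i]) (p : {poly R[i]}).

Lemma ccont_sum n (u : nat -> R -> R[i]) : (forall k, ccont (u k)) ->
  ccont (fun t => \sum_(k < n) u k t).
Proof.
move=> cu; elim: n => [|n IH].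
  have -> : (fun t => \sum_(k < 0) u k t) = fun=> 0 by apply/funext => t; rewrite big_ord0.
  exact: ccont_cst.
have -> : (fun t => \sum_(k < n.+1) u k t) = fun t => \sum_(k < n) u k t + u n t.
  by apply/funext => t; rewrite big_ord_recr.
exact: (ccontD IH (cu n)).
Qed.

Lemma mean0 : mean (fun=> 0) = 0 :> R[i].
Proof. exact: mean_cst. Qed.

Lemma mean_sum n (u : nat -> R -> R[i]) : (forall k, ccont (u k)) ->
  mean (fun t => \sum_(k < n) u k t) = \sum_(k < n) mean (u k).
Proof.
move=> cu; elim: n => [|n IH].
  by rewrite big_ord0 -[RHS]mean0; apply: eq_mean => t _; rewrite big_ord0.
rewrite big_ord_recr /= -IH -meanD.
- by apply: eq_mean => t _; rewrite big_ord_recr.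
- exact/cintegrable_angles/ccont_sum.
- exact: cintegrable_angles.
Qed.

Lemma mean_poly p (K : R -> R[i]) : ccont K ->
  mean (fun t => p.[expi t] * K t) = \sum_(i < size p) p`_i * mean (fun t => expi t ^+ i * K t).
Proof.
move=> cK.
pose w k t := p`_k * (expi t ^+ k * K t).
have cm k : ccont (fun t => expi t ^+ k * K t) by apply: ccontM cK; exact: ccont_expiX.
have cw k : ccont (w k) by apply: ccontM (cm k); exact: ccont_cst.
have -> : (fun t => p.[expi t] * K t) = (fun t => \sum_(k < size p) w k t).
  apply/funext => t; rewrite horner_coef mulr_suml.
  by apply: eq_bigr => i _; rewrite /w mulrA.
rewrite mean_sum //; apply: eq_bigr => i _.
exact: (meanZ p`_i (cintegrable_angles (cm i))).
Qed.

Definition cauchy_ker z t : R[i] := (1 - z * (expi t)^*%C)^-1.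

Lemma normc_mul_expi z t : normc (z * (expi t)^*%C) = normc z.
Proof. by rewrite normcM normc_conj expi_norm mulr1. Qed.

Lemma normc_1B_ge z t : 1 - normc z <= normc (1 - z * (expi t)^*%C).
Proof.
have := ler_normcD (1 - z * (expi t)^*%C) (z * (expi t)^*%C).
by rewrite subrK normc1 normc_mul_expi; lra.
Qed.

Lemma cauchy_den_neq0 z t : normc z < 1 -> 1 - z * (expi t)^*%C != 0.
Proof.
move=> z1; rewrite -normc_gt0; have := normc_1B_ge z t; lra.
Qed.

Lemma ccont_cauchy_ker z : normc z < 1 -> ccont (cauchy_ker z).
Proof.
move=> z1; apply: ccontV => [t|]; first exact: cauchy_den_neq0.
apply: ccontB; first exact: ccont_cst.
by apply: ccontM; [exact: ccont_cst|apply: ccont_conj; exact: ccont_expi].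
Qed.

Lemma cauchy_kerE z t : normc z < 1 ->
  cauchy_ker z t = 1 + z * (expi t)^*%C * cauchy_ker z t.
Proof.
move=> z1; apply/eqP; rewrite -subr_eq; apply/eqP.
by rewrite -[X in X - _]mul1r -mulrBl divff // cauchy_den_neq0.
Qed.

Lemma cauchy_ker_bound z t : normc z < 1 -> normc (cauchy_ker z t) <= (1 - normc z)^-1.
Proof.
move=> z1; rewrite normcV lef_pV2 ?posrE ?subr_gt0 //; first exact: normc_1B_ge.
by rewrite normc_gt0 cauchy_den_neq0.
Qed.

(** The truncated geometric series, by iterating [cauchy_kerE]. *)
Lemma cauchy_ker_geom z t n : normc z < 1 ->
  cauchy_ker z t = \sum_(k < n) z ^+ k * (expi t)^*%C ^+ k
    + z ^+ n * (expi t)^*%C ^+ n * cauchy_ker z t.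
Proof.
move=> z1; elim: n => [|n IH]; first by rewrite big_ord0 add0r !expr0 !mul1r.
rewrite {1}IH big_ord_recr /= -addrA; congr (_ + _).
by rewrite {1}cauchy_kerE // !exprS; ring.
Qed.

Lemma expr_le_eps (q C e : R) : 0 <= q -> q < 1 -> 0 < e -> exists n, C * q ^+ n < e.
Proof.
move=> q0 q1 e0.
have h : C * q ^+ n @[n --> \oo] --> C * 0.
  by apply: cvgM; [exact: cvg_cst|apply: cvg_expr; rewrite ger0_norm].
move/cvgRP: h => /(_ e e0) [n _ /(_ n (leqnn n))] /= h.
by exists n; move: h; rewrite mulr0 subr0; apply: le_lt_trans; exact: ler_norm.
Qed.

Lemma normc_small_eq0 (x : R[i]) : (forall e : R, 0 < e -> normc x <= e) -> x = 0.
Proof.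
move=> h; apply: eq0_normc; apply/eqP; rewrite eq_le normc_ge0 andbT.
by apply/ler_addgt0Pl => e e0; rewrite addr0; exact: h.
Qed.

(** Iterating the recursion gives [a m = z ^+ n * a (m + n)], which tends to 0. *)
Lemma bounded_backward_rec (a : nat -> R[i]) z B : normc z < 1 ->
  (forall m, normc (a m) <= B) -> (forall m, a m = z * a m.+1) -> forall m, a m = 0.
Proof.
move=> z1 aB rec m; apply: normc_small_eq0 => e e0.
have h n : a m = z ^+ n * a (m + n)%N.
  elim: n => [|n IH]; first by rewrite expr0 mul1r addn0.
  by rewrite IH rec addnS exprSr mulrA.
have [n hn] := expr_le_eps B (normc_ge0 z) z1 e0.
rewrite (h n) normcM normcX; apply: le_trans (ltW hn).
by rewrite mulrC ler_wpM2r // exprn_ge0 // normc_ge0.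
Qed.

Lemma normc_expiX t n : normc (expi t ^+ n) = 1.
Proof. by rewrite normcX expi_norm expr1n. Qed.

Lemma normc_cexpiX t n : normc ((expi t)^*%C ^+ n) = 1.
Proof. by rewrite normcX normc_conj expi_norm expr1n. Qed.

Lemma mul_expi_conj t : expi t * (expi t)^*%C = 1.
Proof. by rewrite mul_conjc expi_norm expr1n. Qed.

(** By [cauchy_kerE] these means satisfy the recursion of [bounded_backward_rec]. *)
Lemma mean_cauchy_neg z n : normc z < 1 ->
  mean (fun t => (expi t)^*%C ^+ n.+1 * cauchy_ker z t) = 0.
Proof.
move=> z1; pose a m := mean (fun t => (expi t)^*%C ^+ m.+1 * cauchy_ker z t).
have cK m : ccont (fun t => (expi t)^*%C ^+ m * cauchy_ker z t).
  by apply: ccontM; [exact: ccont_cexpiX|exact: ccont_cauchy_ker].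
apply: (bounded_backward_rec (a := a) (B := (1 - normc z)^-1) z1) => m.
  apply: mean_bound => [|t _]; first exact/cintegrable_angles.
  by rewrite normcM normc_cexpiX mul1r cauchy_ker_bound.
rewrite /a -meanZ; last exact/cintegrable_angles.
rewrite -[LHS]subr0 -(mean_cexpiX R m) -meanB; [|exact/cintegrable_angles..|].
  apply: eq_mean => t _; rewrite {1}cauchy_kerE // mulrDr mulr1 addrAC subrr add0r.
  by rewrite [in RHS]exprS; ring.
exact/cintegrable_angles/ccont_cexpiX.
Qed.

(** By induction from [cauchy_kerE], as the mean of [expi t ^+ n.+1] is 0; the case of [n = 0]
    is reduced to [mean_cauchy_neg]. *)
Lemma mean_cauchy_pos z n : normc z < 1 ->
  mean (fun t => expi t ^+ n * cauchy_ker z t) = z ^+ n.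
Proof.
move=> z1.
have cK : ccont (cauchy_ker z) by exact: ccont_cauchy_ker.
have cE m : ccont (fun t => expi t ^+ m * cauchy_ker z t).
  exact: (ccontM (ccont_expiX m) cK).
elim: n => [|n IH].
  have := mean_cauchy_neg 0 z1 => h.
  have -> : (fun t => expi t ^+ 0 * cauchy_ker z t) =
    (fun t => 1 + z * ((expi t)^*%C ^+ 1 * cauchy_ker z t)).
    by apply/funext => t; rewrite expr0 mul1r {1}cauchy_kerE // expr1 mulrA.
  have cC : ccont (fun t => (expi t)^*%C ^+ 1 * cauchy_ker z t).
    exact: (ccontM (ccont_cexpiX 1) cK).
  rewrite (meanD (cintegrable_cst 1) (cintegrableZ z (@measurable_angles R) (cintegrable_angles cC))).
  by rewrite mean_cst (meanZ z (cintegrable_angles cC)) h mulr0 addr0.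
have -> : (fun t => expi t ^+ n.+1 * cauchy_ker z t) =
  (fun t => expi t ^+ n.+1 + z * (expi t ^+ n * cauchy_ker z t)).
  apply/funext => t; rewrite {1}cauchy_kerE // mulrDr mulr1; congr (_ + _).
  by rewrite exprSr -[in RHS](mulr1 (expi t ^+ n)) -(mul_expi_conj t); ring.
rewrite (meanD (cintegrable_angles (ccont_expiX n.+1))
  (cintegrableZ z (@measurable_angles R) (cintegrable_angles (cE n)))).
by rewrite mean_expiX add0r (meanZ z (cintegrable_angles (cE n))) IH exprS.
Qed.

Lemma mean_cauchy_poly z p : normc z < 1 ->
  mean (fun t => p.[expi t] * cauchy_ker z t) = p.[z].
Proof.
move=> z1; rewrite mean_poly; last exact: ccont_cauchy_ker.
by rewrite horner_coef; apply: eq_bigr => i _; rewrite mean_cauchy_pos.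
Qed.

Lemma mean_ccauchy_pos z n : normc z < 1 ->
  mean (fun t => expi t ^+ n * (cauchy_ker z t)^*%C) = (n == 0%N)%:R.
Proof.
move=> z1; have cK : ccont (cauchy_ker z) by exact: ccont_cauchy_ker.
have -> : (fun t => expi t ^+ n * (cauchy_ker z t)^*%C) =
   (fun t => ((expi t)^*%C ^+ n * cauchy_ker z t)^*%C).
  by apply/funext => t; rewrite rmorphM rmorphXn /= conjcK.
rewrite mean_conj; last first.
  exact: (cintegrable_angles (ccontM (ccont_cexpiX n) cK)).
case: n => [|n]; last by rewrite mean_cauchy_neg ?conjc0.
have -> : (fun t => (expi t)^*%C ^+ 0 * cauchy_ker z t) = fun t => expi t ^+ 0 * cauchy_ker z t.
  by apply/funext => t; rewrite !expr0.
by rewrite mean_cauchy_pos // expr0 conjc1.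
Qed.

End PoissonKernel.

Section RealEmbedding.
Variable R : realType.
Implicit Types (a b : R) (z w : R[i]).
Lemma rcM a b : (a * b)%:C = a%:C * b%:C. Proof. exact: rmorphM. Qed.
Lemma rcD a b : (a + b)%:C = a%:C + b%:C. Proof. exact: rmorphD. Qed.
Lemma rcB a b : (a - b)%:C = a%:C - b%:C. Proof. exact: rmorphB. Qed.
Lemma rc1 : 1%:C = 1 :> R[i]. Proof. exact: rmorph1. Qed.
Lemma rcX a n : (a ^+ n)%:C = a%:C ^+ n. Proof. exact: rmorphXn. Qed.
Lemma rc_nat n : n%:R%:C = n%:R :> R[i]. Proof. exact: rmorph_nat. Qed.
Lemma conjM z w : (z * w)^*%C = z^*%C * w^*%C. Proof. exact: rmorphM. Qed.
Lemma conjB z w : (z - w)^*%C = z^*%C - w^*%C. Proof. exact: rmorphB. Qed.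
Lemma conjX z n : (z ^+ n)^*%C = z^*%C ^+ n. Proof. exact: rmorphXn. Qed.
End RealEmbedding.

(** * The Poisson kernel *)

Section PoissonIntegral.
Variable R : realType.
Notation mu := (@lebesgue_measure R).
Notation A := (@angles R).
Implicit Types (u v : R -> R[i]) (t r : R) (z : R[i]) (p : {poly R[i]}).

Definition poisson_ker z t : R := (1 - normc z ^+ 2) * normc (cauchy_ker z t) ^+ 2.

Lemma poisson_ker_ge0 z t : normc z < 1 -> 0 <= poisson_ker z t.
Proof.
move=> z1; rewrite mulr_ge0 ?sqr_ge0 // subr_ge0 expr_le1 ?normc_ge0 //; exact: ltW.
Qed.

Lemma poisson_kerE z t : normc z < 1 ->
  (poisson_ker z t)%:C = cauchy_ker z t + (cauchy_ker z t)^*%C - 1.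
Proof.
move=> z1; rewrite /poisson_ker rcM rcB rc1 -!mul_conjc.
have d0 := cauchy_den_neq0 t z1.
have d1 : (1 - z * (expi t)^*%C)^*%C != 0 by rewrite conjc_eq0.
have hw : z * z^*%C = (z * (expi t)^*%C) * (z * (expi t)^*%C)^*%C.
  by rewrite conjM conjcK mulrACA (mulrC _ (expi t)) mul_expi_conj mulr1.
rewrite {}hw /cauchy_ker conjc_inv.
move: d0 d1; set w := z * (expi t)^*%C.
by rewrite conjB conjc1 => d0 d1; field; apply/andP.
Qed.

Lemma ccont_poisson_ker z : normc z < 1 -> ccont (fun t => (poisson_ker z t)%:C).
Proof.
move=> z1.
have -> : (fun t => (poisson_ker z t)%:C) = (fun t => cauchy_ker z t + (cauchy_ker z t)^*%C - 1).
  by apply/funext => t; exact: poisson_kerE.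
have cK := ccont_cauchy_ker z1.
exact: (ccontB (ccontD cK (ccont_conj cK)) (ccont_cst (1 : R[i]))).
Qed.

Lemma mean_poisson_split u z : normc z < 1 -> ccont u ->
  mean (fun t => u t * (poisson_ker z t)%:C) =
  mean (fun t => u t * cauchy_ker z t) + mean (fun t => u t * (cauchy_ker z t)^*%C) - mean u.
Proof.
move=> z1 cu; have cK := ccont_cauchy_ker z1.
have c1 := ccontM cu cK; have c2 := ccontM cu (ccont_conj cK).
rewrite -(meanD (cintegrable_angles c1) (cintegrable_angles c2)).
rewrite -(meanB (cintegrable_angles (ccontD c1 c2)) (cintegrable_angles cu)).
by apply: eq_mean => t _; rewrite poisson_kerE //; ring.
Qed.

Lemma mean_poisson_poly z p : normc z < 1 ->
  mean (fun t => p.[expi t] * (poisson_ker z t)%:C) = p.[z].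
Proof.
move=> z1; have cp : ccont (fun t : R => p.[expi t]) by exact: (ccont_poly p ccont_expi).
rewrite (mean_poisson_split z1 cp) mean_cauchy_poly // -addrA.
have -> : mean (fun t => p.[expi t] * (cauchy_ker z t)^*%C) = mean (fun t : R => p.[expi t]).
  rewrite (mean_poly _ (ccont_conj (ccont_cauchy_ker z1))).
  have -> : mean (fun t : R => p.[expi t]) = mean (fun t : R => p.[expi t] * 1).
    by apply: eq_mean => t _; rewrite mulr1.
  rewrite (mean_poly _ (ccont_cst (1 : R[i]))); apply: eq_bigr => i _; congr (_ * _).
  rewrite mean_ccauchy_pos //.
  case: (i : nat) => [|n].
    by rewrite -[LHS](mean_cst (1 : R[i])); apply: eq_mean => t _; rewrite expr0 mul1r.
  by rewrite -[LHS](mean_expiX R n); apply: eq_mean => t _; rewrite mulr1.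
by rewrite subrr addr0.
Qed.

Lemma mean_poisson1 z : normc z < 1 -> mean (fun t => (poisson_ker z t)%:C) = 1.
Proof.
move=> z1; rewrite -[RHS](hornerC 1 z) -(mean_poisson_poly 1%:P z1).
by apply: eq_mean => t _; rewrite hornerC mul1r.
Qed.

Lemma normc_radial r (th : R) : 0 <= r -> normc (r%:C * expi th) = r.
Proof. by move=> r0; rewrite normcM normc_real expi_norm mulr1 ger0_norm. Qed.

Lemma sqr_chord t (th : R) : (normc (expi t - expi th) ^+ 2)%:C =
  2 - (expi t * (expi th)^*%C + (expi t * (expi th)^*%C)^*%C).
Proof.
rewrite -mul_conjc conjB conjM conjcK.
have h1 := mul_expi_conj t; have h2 := mul_expi_conj th.
have -> : 2 = expi t * (expi t)^*%C + expi th * (expi th)^*%C by rewrite h1 h2.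
ring.
Qed.

(** The second moment of the Poisson kernel, around the point where it concentrates, is the
    only quantitative information that the estimates below need. *)
Lemma mean_poisson_chord r (th : R) : 0 <= r < 1 ->
  mean (fun t => (normc (expi t - expi th) ^+ 2 * poisson_ker (r%:C * expi th) t)%:C)
  = (2 - 2 * r)%:C.
Proof.
move=> /andP[r0 r1]; set z := r%:C * expi th.
have z1 : normc z < 1 by rewrite normc_radial.
have cP := ccont_poisson_ker z1; have cE := @ccont_expi R.
pose m t := (expi th)^*%C * (expi t * (poisson_ker z t)%:C).
have cm : ccont m by exact: (ccontM (ccont_cst (expi th)^*%C) (ccontM cE cP)).
have mm : mean m = r%:C.
  rewrite /m (meanZ _ (cintegrable_angles (ccontM cE cP))).
  have := mean_poisson_poly 'X z1.
  rewrite hornerX (eq_mean (v := fun t => expi t * (poisson_ker z t)%:C)); last first.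
    by move=> t _; rewrite hornerX.
  by move=> ->; rewrite /z mulrCA (mulrC _ (expi th)) mul_expi_conj mulr1.
have c2 : ccont (fun t => 2 * (poisson_ker z t)%:C) by exact: (ccontM (ccont_cst _) cP).
have cs : ccont (fun t => m t + (m t)^*%C) by exact: (ccontD cm (ccont_conj cm)).
have := meanB (cintegrable_angles c2) (cintegrable_angles cs).
rewrite (meanZ _ (cintegrable_angles cP)) mean_poisson1 // mulr1.
rewrite (meanD (cintegrable_angles cm) (cintegrable_angles (ccont_conj cm))).
rewrite (mean_conj (cintegrable_angles cm)) mm conjc_real => h.
rewrite rcB rcM !rc_nat.
have -> : 2 - 2 * r%:C = 2 - (r%:C + r%:C) :> R[i] by ring.
rewrite -h; apply: eq_mean => t _; rewrite rcM sqr_chord /m.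
by rewrite !conjM !conjcK conjc_real; ring.
Qed.

Lemma poisson_estimate u r (th eps C : R) : 0 <= r < 1 -> cintegrable A u ->
  (forall t, A t -> normc (u t) <=
     (eps + C * normc (expi t - expi th) ^+ 2) * poisson_ker (r%:C * expi th) t) ->
  normc (mean u) <= eps + C * (2 - 2 * r).
Proof.
move=> r01 iu h; have /andP[r0 r1] := r01; set z := r%:C * expi th in h *.
have z1 : normc z < 1 by rewrite normc_radial.
have cP := ccont_poisson_ker z1; have cE := @ccont_expi R.
have cX : ccont (fun t => (normc (expi t - expi th) ^+ 2 * poisson_ker z t)%:C).
  have -> : (fun t => (normc (expi t - expi th) ^+ 2 * poisson_ker z t)%:C) =
     fun t => ((expi t - expi th) * (expi t - expi th)^*%C) * (poisson_ker z t)%:C.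
    by apply/funext => t; rewrite mul_conjc rcM.
  have cd := ccontB cE (ccont_cst (expi th)).
  exact: (ccontM (ccontM cd (ccont_conj cd)) cP).
have c1 : ccont (fun t => eps%:C * (poisson_ker z t)%:C) by exact: (ccontM (ccont_cst _) cP).
have c2 : ccont (fun t => C%:C * (normc (expi t - expi th) ^+ 2 * poisson_ker z t)%:C).
  exact: (ccontM (ccont_cst _) cX).
have := @normc_mean_le R u _ iu (cintegrable_angles (ccontD c1 c2)).
rewrite (meanD (cintegrable_angles c1) (cintegrable_angles c2)).
rewrite (meanZ _ (cintegrable_angles cP)) (meanZ _ (cintegrable_angles cX)).
rewrite mean_poisson1 // mean_poisson_chord // mulr1.
have -> : complex.Re (eps%:C + C%:C * (2 - 2 * r)%:C) = eps + C * (2 - 2 * r).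
  by rewrite -rcM -rcD.
apply=> t At; apply: le_trans (h t At) _.
by rewrite -!rcM -rcD /= le_eqVlt; apply/orP; left; apply/eqP; ring.
Qed.

(** Korovkin's argument: a modulus of continuity of the form [eps + C * chord ^+ 2] is
    integrated against the kernel exactly. *)
Lemma poisson_korovkin u r (th eps C : R) : 0 <= r < 1 -> ccont u ->
  (forall t, normc (u t - u th) <= eps + C * normc (expi t - expi th) ^+ 2) ->
  normc (mean (fun t => u t * (poisson_ker (r%:C * expi th) t)%:C) - u th)
    <= eps + C * (2 - 2 * r).
Proof.
move=> r01 cu h; have /andP[r0 r1] := r01; set z := r%:C * expi th.
have z1 : normc z < 1 by rewrite normc_radial.
have cP := ccont_poisson_ker z1.
have e : mean (fun t => u th * (poisson_ker z t)%:C) = u th.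
  by rewrite (meanZ _ (cintegrable_angles cP)) mean_poisson1 // mulr1.
have c1 := ccontM cu cP; have c2 := ccontM (ccont_cst (u th)) cP.
rewrite -[X in _ - X]e -(meanB (cintegrable_angles c1) (cintegrable_angles c2)).
apply: (poisson_estimate (th := th) r01); first exact: (cintegrable_angles (ccontB c1 c2)).
move=> t _; rewrite -mulrBl normcM normc_real ger0_norm ?poisson_ker_ge0 //.
by rewrite ler_wpM2r ?poisson_ker_ge0.
Qed.

(** The maximum principle, from the positivity of the kernel. *)
Lemma poly_max_modulus p B z : (forall w, normc w = 1 -> normc p.[w] <= B) ->
  normc z <= 1 -> normc p.[z] <= B.
Proof.
move=> h; rewrite le_eqVlt => /predU1P[|z1]; first exact: h.
have cP := ccont_poisson_ker z1.
have cp : ccont (fun t : R => p.[expi t]) by exact: (ccont_poly p ccont_expi).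
rewrite -(mean_poisson_poly p z1).
have cB : ccont (fun t => B%:C * (poisson_ker z t)%:C) by exact: (ccontM (ccont_cst _) cP).
have := @normc_mean_le R _ _ (cintegrable_angles (ccontM cp cP)) (cintegrable_angles cB).
rewrite (meanZ _ (cintegrable_angles cP)) mean_poisson1 // mulr1 /=; apply=> t _.
rewrite normcM normc_real ger0_norm ?poisson_ker_ge0 // mul0r subr0.
by rewrite ler_wpM2r ?poisson_ker_ge0 // h // expi_norm.
Qed.

End PoissonIntegral.

(** * Continuous functions on the circle *)

Section CircleFunctions.
Variable R : realType.
Notation A := (@angles R).
Implicit Types (F : R[i] -> R[i]) (u v : R -> R[i]) (t r : R) (z : R[i]) (p : {poly R[i]}).

Lemma cvg_near_lt (T : topologicalType) (f : T -> R) x c : f y @[y --> x] --> f x ->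
  f x < c -> \forall y \near x, f y < c.
Proof.
move=> /cvgRP h fc; have c0 : 0 < c - f x by rewrite subr_gt0.
by have := h _ c0; apply: filterS => y; rewrite ltr_norml; lra.
Qed.

(** Near a point of [K], either [phi] is negative or [psi] is bounded below by a positive
    constant; compactness makes the constant uniform. *)
Lemma compact_dominate (T : topologicalType) (K : set T) (phi psi : T -> R) :
  compact K -> (forall x, K x -> phi y @[y --> x] --> phi x) ->
  (forall x, K x -> psi y @[y --> x] --> psi x) -> (forall x, 0 <= psi x) ->
  (forall x, K x -> 0 <= phi x -> 0 < psi x) ->
  exists2 C, 0 <= C & forall x, K x -> phi x <= C * psi x.
Proof.
move=> /compact_near_coveringP cK cphi cpsi psi0 h.
have := cK R +oo%R (fun C x => 0 <= C -> phi x <= C * psi x) _.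
have FF : Filter (+oo%R : set_system R) by exact: proper_pinfty_nbhs.
move=> /(_ FF) [].
  move=> x Kx; case: (ltP (phi x) 0) => [p0|p0].
    have n1 := cvg_near_lt (cphi x Kx) p0.
    exists ([set y | phi y < 0], setT); first by split => //; exact: filterT.
    move=> [y C] /= [py _] C0; apply: ltW; apply: lt_le_trans py _.
    by rewrite mulr_ge0.
  have s0 := h x Kx p0.
  have n1 : \forall y \near x, phi y < phi x + 1.
    by apply: cvg_near_lt (cphi x Kx) _; rewrite ltrDl.
  have n2 : \forall y \near x, - psi y < - (psi x / 2).
    apply: (@cvg_near_lt _ (fun y => - psi y)); first by apply: cvgN; exact: cpsi.
    by rewrite ltrN2 ltr_pdivrMr // ltr_pMr // ltr1n.
  exists ([set y | phi y < phi x + 1] `&` [set y | - psi y < - (psi x / 2)],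
          [set C | 2 * (phi x + 1) / psi x < C]).
    split; first exact: filterI.
    exact: nbhs_pinfty_gt (num_real _).
  move=> [y C] /= [[p1 p2] p3] C0.
  have : (phi x + 1) <= C * (psi x / 2).
    by rewrite mulrA ler_pdivlMr // mulrC -ler_pdivrMr // ltW.
  move=> p4; apply: ltW; apply: lt_le_trans p1 _; apply: le_trans p4 _.
  by rewrite ler_wpM2l // ltW // -ltrN2.
move=> M [Mr hM]; exists (Num.max 0 (M + 1)); first by rewrite le_max lexx.
move=> x Kx; apply: hM => //; last by rewrite le_max lexx.
by rewrite lt_max ltrDl ltr01 orbT.
Qed.

(** Where the increment of [u] is at least [e], the chord does not vanish, so that
    [compact_dominate] applies to its square. *)
Lemma circle_modulus u e : ccont u -> (forall s t, expi s = expi t -> u s = u t) -> 0 < e ->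
  exists2 C, 0 <= C & forall s t, normc (u s - u t) <= e + C * normc (expi s - expi t) ^+ 2.
Proof.
move=> cu per e0.
pose K : set (R * R) := `[0, 2 * pi] `*` `[0, 2 * pi].
have cK : compact K by apply: compact_setX; exact: segment_compact.
have cdiff (v : R -> R[i]) : ccont v -> forall x : R * R,
    normc (v y.1 - v y.2) @[y --> x] --> normc (v x.1 - v x.2).
  move=> cv x; apply: cvg_normc; apply: cvgB.
    by apply: (@cvg_comp _ _ _ _ v); [exact: cvg_fst|exact: ccont_at].
  by apply: (@cvg_comp _ _ _ _ v); [exact: cvg_snd|exact: ccont_at].
have [||||C C0 hC] := @compact_dominate _ K (fun x => normc (u x.1 - u x.2) - e)
    (fun x => normc (expi x.1 - expi x.2) ^+ 2) cK.
- by move=> x _; apply: cvgB; [exact: cdiff|exact: cvg_cst].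
- move=> x _; under eq_fun do rewrite expr2; rewrite expr2.
  by apply: cvgM; apply: cdiff; exact: ccont_expi.
- by move=> x; rewrite sqr_ge0.
- move=> [s t] _ /= h; rewrite exprn_gt0 // normc_gt0 subr_eq0; apply/eqP => /per st.
  by move: h; rewrite st subrr normc0 sub0r oppr_ge0 leNgt e0.
exists C => // s t.
have [s' s1 es] := circle_expi (expi_circle s).
have [t' t1 et] := circle_expi (expi_circle t).
have := hC (s', t'); rewrite /K /= !in_itv /= -es -et -(per _ _ es) -(per _ _ et).
move=> h; rewrite [leRHS]addrC -lerBlDr; apply: h.
by move: s1 t1 => /andP[-> /ltW ->] /andP[-> /ltW ->].
Qed.

Lemma ccont_circle F : {within unit_circle, continuous F} -> ccont (F \o expi).
Proof.
move=> /subspace_continuousP h; apply: ccontI => t.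
apply: (@cvg_comp _ _ _ expi F _ (within unit_circle (nbhs (expi t)))); last first.
  by apply: h; exact: expi_circle.
move=> S; rewrite /within /= => hS.
have h' : \forall s \near t, unit_circle (expi s) -> S (expi s) by exact: (@ccont_at R expi t ccont_expi) _ hS.
by apply: filterS h' => s; apply; exact: expi_circle.
Qed.

(** Integrating the truncated geometric series of the kernel; the sum is a truncated Abel mean
    of the Fourier series of [u]. *)
Lemma poisson_trig_approx u z n B : normc z < 1 -> ccont u -> (forall t, normc (u t) <= B) ->
  normc (mean (fun t => u t * cauchy_ker z t) -
     \sum_(k < n) mean (fun t => u t * (expi t)^*%C ^+ k) * z ^+ k)
  <= B * normc z ^+ n / (1 - normc z).
Proof.
move=> z1 cu uB; have cK := ccont_cauchy_ker z1.
pose w k t := z ^+ k * (u t * (expi t)^*%C ^+ k).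
have cuk k := ccontM cu (ccont_cexpiX k).
have cw k : ccont (w k) by exact: (ccontM (ccont_cst (z ^+ k)) (cuk k)).
have c1 := ccontM cu cK.
have -> : \sum_(k < n) mean (fun t => u t * (expi t)^*%C ^+ k) * z ^+ k =
    mean (fun t => \sum_(k < n) w k t).
  rewrite mean_sum //; apply: eq_bigr => k _.
  by rewrite /w (meanZ _ (cintegrable_angles (cuk k))) mulrC.
rewrite -(meanB (cintegrable_angles c1) (cintegrable_angles (ccont_sum (n := n) cw))).
apply: mean_bound; first exact: (cintegrable_angles (ccontB c1 (ccont_sum (n := n) cw))).
move=> t _.
have -> : u t * cauchy_ker z t - \sum_(k < n) w k t =
   u t * (z ^+ n * (expi t)^*%C ^+ n * cauchy_ker z t).
  have e : u t * (\sum_(k < n) z ^+ k * (expi t)^*%C ^+ k) = \sum_(k < n) w k t.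
    by rewrite mulr_sumr; apply: eq_bigr => k _; rewrite /w mulrCA.
  by rewrite {1}(cauchy_ker_geom t n z1) mulrDr e addrAC subrr add0r.
rewrite !normcM normc_cexpiX mulr1 normcX -mulrA ler_pM ?normc_ge0 //.
- by rewrite mulr_ge0 ?exprn_ge0 ?normc_ge0.
- by rewrite ler_wpM2l ?exprn_ge0 ?normc_ge0 // cauchy_ker_bound.
Qed.

Lemma ccont_per_bounded u : ccont u -> (forall s t, expi s = expi t -> u s = u t) ->
  exists B, forall t, normc (u t) <= B.
Proof.
move=> cu per; have [C C0 h] := circle_modulus cu per (@ltr01 R).
exists (normc (u 0) + (1 + C * 4)) => t.
have := normc_triangle (u 0) (u t) 0; rewrite !subr0 => /le_trans; apply.
rewrite addrC lerD2l; apply: le_trans (h _ _) _; rewrite lerD2l ler_wpM2l //.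
have -> : 4 = 2 ^+ 2 :> R by ring.
rewrite lerXn2r ?nnegrE ?normc_ge0 //.
by apply: le_trans (ler_normcB _ _) _; rewrite !expi_norm.
Qed.

(** The Poisson integral of [u] on a circle of radius close to 1 is uniformly close to [u], and
    truncating the Cauchy kernel and its conjugate turns it into a trigonometric polynomial. The
    factor [(expi t)^*%C ^+ n] carries the negative frequencies. *)
Lemma trig_approx u e : ccont u -> (forall s t, expi s = expi t -> u s = u t) -> 0 < e ->
  exists n p, forall t, normc (u t - (expi t)^*%C ^+ n * p.[expi t]) <= e.
Proof.
move=> cu per e0; have e2 : 0 < e / 2 by rewrite divr_gt0.
have e4 : 0 < e / 4 by rewrite divr_gt0.
have [C C0 hC] := circle_modulus cu per e4.
have [B hB] := ccont_per_bounded cu per.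
have B0 : 0 <= B by apply: le_trans (hB 0); exact: normc_ge0.
pose r := 1 - Num.min (1 / 2) (e / (8 * (C + 1))).
have C1 : 0 < C + 1 by rewrite ltr_wpDl.
have d0 : 0 < Num.min (1 / 2) (e / (8 * (C + 1))).
  by rewrite lt_min divr_gt0 ?ltr01 //= divr_gt0 // mulr_gt0.
have r01 : 0 <= r < 1.
  have : Num.min (1 / 2) (e / (8 * (C + 1))) <= 1 / 2 by rewrite ge_min lexx.
  by rewrite /r; lra.
have /andP[r0 r1] := r01.
have Cr : e / 4 + C * (2 - 2 * r) <= e / 2.
  have h1 : Num.min (1 / 2) (e / (8 * (C + 1))) <= e / (8 * (C + 1)).
    by rewrite ge_min lexx orbT.
  have h2 : (C + 1) * Num.min (1 / 2) (e / (8 * (C + 1))) <= e / 8.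
    apply: le_trans (ler_wpM2l (ltW C1) h1) _.
    by rewrite le_eqVlt; apply/orP; left; apply/eqP; field; rewrite gt_eqF.
  by rewrite /r; move: h2 d0; set d := Num.min _ _; nra.
have er : 0 < e / 4 by [].
have [n hn] := expr_le_eps (B / (1 - r)) r0 r1 er.
pose a k := mean (fun t => u t * (expi t)^*%C ^+ k).
pose b k := mean (fun t => (u t)^*%C * (expi t)^*%C ^+ k).
pose p1 := \poly_(k < n) (a k * r%:C ^+ k).
pose p2 := \sum_(k < n) ((b k)^*%C * r%:C ^+ k) *: 'X^(n - k) : {poly R[i]}.
(* The constant term occurs both in [p1] and in [p2]. *)
exists n, ('X^n * p1 + p2 - (mean u) *: 'X^n) => t.
set z := r%:C * expi t.
have zr : normc z = r by exact: normc_radial.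
have z1 : normc z < 1 by rewrite zr.
have h1 := poisson_korovkin r01 cu (fun s => hC s t).
have h2 := poisson_trig_approx n z1 cu hB.
have hB' s : normc ((u s)^*%C) <= B by rewrite normc_conj.
have h3 := poisson_trig_approx n z1 (ccont_conj cu) hB'.
have cK := ccont_cauchy_ker z1.
have e3 : mean (fun s => (u s)^*%C * cauchy_ker z s) =
    (mean (fun s => u s * (cauchy_ker z s)^*%C))^*%C.
  rewrite -(mean_conj (cintegrable_angles (ccontM cu (ccont_conj cK)))).
  by apply: eq_mean => s _; rewrite conjM conjcK.
rewrite e3 -normc_conj conjB conjcK zr in h3.
rewrite zr in h2.
rewrite (mean_poisson_split z1 cu) in h1.
have ez k : (expi t)^*%C ^+ n * expi t ^+ (n - k) = (expi t)^*%C ^+ minn k n.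
  case: (leqP k n) => kn.
    rewrite -[in X in X * _](subnKC kn) exprD -mulrA -exprMn.
    by rewrite (mulrC (_^*)%C) mul_expi_conj expr1n mulr1.
  have -> : (n - k = 0)%N by apply/eqP; rewrite subn_eq0 ltnW.
  by rewrite expr0 mulr1.
have eP : (expi t)^*%C ^+ n * ('X^n * p1 + p2 - mean u *: 'X^n).[expi t] =
  \sum_(k < n) a k * z ^+ k + (\sum_(k < n) b k * z ^+ k)^*%C - mean u.
  have en : (expi t)^*%C ^+ n * expi t ^+ n = 1.
    by rewrite -exprMn (mulrC (_^*)%C) mul_expi_conj expr1n.
  rewrite hornerD hornerN hornerD hornerM hornerZ !hornerXn.
  rewrite mulrBr mulrDr mulrA en mul1r mulrCA en mulr1.
  congr (_ + _ - _).
    rewrite horner_poly; apply: eq_bigr => k _; rewrite /z exprMn; ring.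
  rewrite horner_sum mulr_sumr rmorph_sum; apply: eq_bigr => k _.
  rewrite hornerZ hornerXn mulrCA ez (minn_idPl (ltnW (ltn_ord k))) /z.
  have ec (x y : R[i]) : (x * (r%:C * y) ^+ k)^*%C = x^*%C * (r%:C ^+ k * y^*%C ^+ k).
    by rewrite conjM conjX conjM conjc_real exprMn.
  by rewrite /= ec mulrA.
rewrite eP.
have -> : u t - (\sum_(k < n) a k * z ^+ k + (\sum_(k < n) b k * z ^+ k)^*%C - mean u) =
 (mean (fun s => u s * cauchy_ker z s) - \sum_(k < n) a k * z ^+ k)
 + (mean (fun s => u s * (cauchy_ker z s)^*%C) - (\sum_(k < n) b k * z ^+ k)^*%C)
 - (mean (fun s => u s * cauchy_ker z s) + mean (fun s => u s * (cauchy_ker z s)^*%C) - mean u - u t).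
  by ring.
apply: le_trans (ler_normcB _ _) _.
have hn' : B * r ^+ n / (1 - r) <= e / 4 by rewrite mulrAC ltW.
apply: le_trans (lerD (ler_normcD _ _) (le_trans h1 Cr)) _.
have := le_trans h2 hn'; have := le_trans h3 hn'; rewrite /a /b; lra.
Qed.

End CircleFunctions.

(** * Almost everywhere limits *)

Section AlmostEverywhereLimits.
Variable R : realType.
Notation mu := (@lebesgue_measure R).

(** The sum is integrable by monotone convergence, hence finite almost everywhere. *)
Lemma ae_nneseries_lty (D : set R) (g : nat -> R -> R) (c : R) : measurable D ->
  (forall n, measurable_fun D (g n)) -> (forall n t, 0 <= g n t) ->
  (forall n, (\int[mu]_(t in D) (g n t)%:E <= (c / 2 ^+ n)%:E)%E) ->
  {ae mu, forall t, D t -> (\sum_(0 <= n <oo) (g n t)%:E < +oo)%E}.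
Proof.
move=> mD mg g0 gc.
pose S t := (\sum_(0 <= n <oo) (g n t)%:E)%E.
have mE n : measurable_fun D (fun t => (g n t)%:E) by exact: measurable_fun_EFin.
have S0 t : D t -> (0 <= S t)%E by move=> _; apply: nneseries_ge0 => n _ _; rewrite lee_fin.
have mS : measurable_fun D S.
  apply: ge0_emeasurable_sum => // n t _ _; by rewrite lee_fin.
have iS : mu.-integrable D S.
  apply/integrableP; split => //.
  have -> : (\int[mu]_(t in D) `|S t| = \int[mu]_(t in D) S t)%E.
    by apply: eq_integral => t /[!inE] Dt; rewrite gee0_abs // S0.
  rewrite integral_nneseries //; last by move=> n t _; rewrite lee_fin.
  apply: (@le_lt_trans _ _ (\sum_(0 <= n <oo) (c / 2 ^+ n)%:E)%E).
    apply: lee_nneseries => [n _ _|n _]; last exact: gc.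
    by apply: integral_ge0 => t _; rewrite lee_fin.
  have c0 : 0 <= c.
    have := gc 0%N; rewrite expr0 divr1; rewrite -lee_fin; apply: le_trans.
    by apply: integral_ge0 => t _; rewrite lee_fin.
  apply: (@le_lt_trans _ _ (2 * c)%:E); last exact: ltry.
  apply: lime_le; first by apply: is_cvg_nneseries => n _ _; rewrite lee_fin divr_ge0 // exprn_ge0.
  apply: nearW => n; rewrite sumEFin lee_fin.
  have -> : \sum_(0 <= i < n) c / 2 ^+ i = 2 * c - 2 * c / 2 ^+ n.
    elim: n => [|n IH]; first by rewrite big_geq // expr0 divr1 subrr.
    rewrite big_nat_recr //= IH exprS; field; exact: lt0r_neq0 (exprn_gt0 _ _).
  by rewrite gerBl divr_ge0 ?mulr_ge0 ?exprn_ge0.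
have h : {ae mu, forall t, D t -> S t \is a fin_num} by apply: integrable_ae iS.
apply: ae_imply h _ => t h Dt.
by have := h Dt; rewrite ge0_fin_numE //; exact: S0.
Qed.

Lemma cvg_of_summable_steps (x g : nat -> R) : (forall n, `|x n.+1 - x n| <= g n) ->
  (\sum_(0 <= n <oo) (g n)%:E < +oo)%E -> cvgn x.
Proof.
move=> xg gS.
have g0 n : 0 <= g n by apply: le_trans (xg n).
have cs : cvgn (series (telescope x)).
  apply: normed_cvg; apply: nondecreasing_is_cvgn.
    by apply: nondecreasing_series => k _ _ /=; exact: normr_ge0.
  exists (fine (\sum_(0 <= n <oo) (g n)%:E)%E) => _ [n _ <-].
  rewrite -lee_fin fineK; last first.
    by rewrite ge0_fin_numE // nneseries_ge0 // => k _ _; rewrite lee_fin.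
  apply: le_trans (nneseries_lim_ge n _); last by move=> k _ _; rewrite lee_fin.
  rewrite sumEFin lee_fin; apply: ler_sum => k _; exact: xg.
have -> : x = (fun n => x 0%N + series (telescope x) n).
  by apply/funext => n; exact: eq_sum_telescope.
by apply: is_cvgD => //; exact: is_cvg_cst.
Qed.

Definition clamp (B x : R) := Num.max (- B) (Num.min B x).

Lemma clamp_norm B x : 0 <= B -> `|clamp B x| <= B.
Proof.
move=> B0; rewrite /clamp ler_norml le_max lexx /= ge_max ge_min lexx /= andbT.
by rewrite (le_trans _ B0) ?oppr_le0.
Qed.

Lemma clamp_id B x : `|x| <= B -> clamp B x = x.
Proof.
by rewrite ler_norml /clamp => /andP[h1 h2]; rewrite (min_idPr h2) (max_idPr h1).
Qed.

(** The limit superior is measurable; clamping it makes the bound hold at every point. *)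
Lemma ae_limit_measurable (D : set R) (f : nat -> R -> R) (B : R) : measurable D ->
  (forall n, measurable_fun D (f n)) -> (forall n t, D t -> `|f n t| <= B) -> 0 <= B ->
  exists h : R -> R, [/\ measurable_fun D h, forall t, `|h t| <= B &
    forall t, D t -> cvgn (fun n => f n t) -> f n t @[n --> \oo] --> h t].
Proof.
move=> mD mf fB B0; exists (fun t => clamp B (limn_sup (fun n => f n t))); split.
- apply: measurable_maxr; first exact: measurable_cst.
  apply: measurable_minr; first exact: measurable_cst.
  apply: measurable_fun_limn_sup => // t Dt.
    by exists B => _ [n _ <-]; apply: le_trans (ler_norm _) _; exact: fB.
  by exists (- B) => _ [n _ <-]; have := fB n t Dt; rewrite ler_norml => /andP[].
- by move=> t; exact: clamp_norm.
- move=> t Dt ct; rewrite cvg_limn_supE // clamp_id //.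
  rewrite ler_norml; apply/andP; split.
    by apply: limr_ge => //; apply: nearW => n; have := fB n t Dt; rewrite ler_norml => /andP[].
  by apply: limr_le => //; apply: nearW => n; have := fB n t Dt; rewrite ler_norml => /andP[].
Qed.

End AlmostEverywhereLimits.

(** * Convex combinations of tails *)

Section ConvexTails.
Variable R : realType.
Notation mu := (@lebesgue_measure R).
Notation A := (@angles R).
Implicit Types (F : nat -> R[i] -> R[i]) (G H : R[i] -> R[i]) (u v : R -> R[i]).

(** Binary combinations generate the convex hull of the tail [F N, F N.+1, ...], and make each
    property stable under convex combinations an induction. *)
Inductive tail_hull F (N : nat) : (R[i] -> R[i]) -> Prop :=
| tail_hull_base n : (N <= n)%N -> tail_hull F N (F n)
| tail_hull_comb G H (l : R) : 0 <= l <= 1 -> tail_hull F N G -> tail_hull F N H ->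
    tail_hull F N (fun z => l%:C * G z + (1 - l)%:C * H z).

Lemma tail_hullW F N N' G : (N <= N')%N -> tail_hull F N' G -> tail_hull F N G.
Proof.
move=> NN'; elim=> [n N'n|G1 H1 l l01 _ IG _ IH]; last exact: tail_hull_comb.
by apply: tail_hull_base; exact: leq_trans N'n.
Qed.

(** Closed discs are convex. *)
Lemma tail_hull_disc F N G z c (B : R) : (forall n, (N <= n)%N -> normc (F n z - c) <= B) ->
  tail_hull F N G -> normc (G z - c) <= B.
Proof.
move=> FB; elim=> [n /FB//|G1 H1 l /andP[l0 l1] _ IG _ IH].
have -> : l%:C * G1 z + (1 - l)%:C * H1 z - c =
  l%:C * (G1 z - c) + (1 - l)%:C * (H1 z - c) by rewrite rcB rc1; ring.
apply: le_trans (ler_normcD _ _) _; rewrite !normcM !normc_real !ger0_norm ?subr_ge0 //.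
have := ler_wpM2l l0 IG; have l1' : 0 <= 1 - l by rewrite subr_ge0.
have := ler_wpM2l l1' IH; lra.
Qed.

Lemma tail_hull_bound F N G z (B : R) : (forall n, normc (F n z) <= B) ->
  tail_hull F N G -> normc (G z) <= B.
Proof.
move=> FB hG; rewrite -[G z]subr0; apply: tail_hull_disc hG => n _; rewrite subr0; exact: FB.
Qed.

Lemma tail_hull_cvg F (G : nat -> R[i] -> R[i]) z (c : R[i]) : (forall j, tail_hull F j (G j)) ->
  F n z @[n --> \oo] --> c -> G n z @[n --> \oo] --> c.
Proof.
move=> hG /cvgcP h; apply/cvgcP => e e0; have [N _ hN] := h _ (divr_gt0 e0 (@ltr0n R 2)).
exists N => // j /= Nj.
apply: (@le_lt_trans _ _ (e / 2)); last by rewrite ltr_pdivrMr // ltr_pMr // ltr1n.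
apply: tail_hull_disc (hG j) => n jn; apply: ltW; apply: hN => /=; exact: leq_trans jn.
Qed.

Lemma tail_hull_cont F N G : (forall n, ccont (F n \o expi)) -> tail_hull F N G ->
  ccont (G \o expi).
Proof.
move=> cF; elim=> [n _|G1 H1 l _ _ IG _ IH]; first exact: cF.
exact: (ccontD (ccontM (ccont_cst l%:C) IG) (ccontM (ccont_cst (1 - l)%:C) IH)).
Qed.

Lemma tail_hull_poly (P : nat -> {poly R[i]}) N G : tail_hull (fun n z => (P n).[z]) N G ->
  exists p : {poly R[i]}, G = (fun z => p.[z]).
Proof.
elim=> [n _|G1 H1 l _ _ [p ->] _ [q ->]]; first by exists (P n).
exists (l%:C *: p + (1 - l)%:C *: q); apply/funext => z.
by rewrite hornerD !hornerZ.
Qed.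

Definition energy u : R := complex.Re (mean (fun t => (normc (u t) ^+ 2)%:C)).

Lemma ccont_sqr u : ccont u -> ccont (fun t => (normc (u t) ^+ 2)%:C).
Proof.
move=> cu; have -> : (fun t => (normc (u t) ^+ 2)%:C) = (fun t => u t * (u t)^*%C).
  by apply/funext => t; rewrite mul_conjc.
exact: (ccontM cu (ccont_conj cu)).
Qed.

Lemma Re_mean_le u v : ccont u -> ccont v ->
  (forall t, A t -> normc (u t) <= complex.Re (v t)) -> complex.Re (mean u) <= complex.Re (mean v).
Proof.
move=> cu cv h; apply: le_trans (normc_mean_le (cintegrable_angles cu) (cintegrable_angles cv) h).
by apply: le_trans (ler_norm _) (Re_le_normc _).
Qed.

Lemma energy_ge0 u : ccont u -> 0 <= energy u.
Proof.
move=> cu; have -> : 0 = complex.Re (mean (fun=> 0 : R[i])) by rewrite mean_cst.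
apply: Re_mean_le; [exact: ccont_cst|exact: ccont_sqr|].
by move=> t _; rewrite normc0 /= sqr_ge0.
Qed.

Lemma energy_bound u B : ccont u -> (forall t, normc (u t) <= B) -> energy u <= B ^+ 2.
Proof.
move=> cu uB; have -> : B ^+ 2 = complex.Re (mean (fun=> (B ^+ 2)%:C)) by rewrite mean_cst.
apply: Re_mean_le; [exact: ccont_sqr|exact: ccont_cst|].
move=> t _; rewrite normc_real ger0_norm ?sqr_ge0 //= lerXn2r ?nnegrE ?normc_ge0 //.
by apply: le_trans (uB t); exact: normc_ge0.
Qed.

Lemma energy_parallelogram u v : ccont u -> ccont v ->
  energy (fun t => u t - v t) =
  2 * energy u + 2 * energy v - 4 * energy (fun t => (1 / 2)%:C * u t + (1 - 1 / 2)%:C * v t).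
Proof.
move=> cu cv.
have cd := ccontB cu cv.
have cm := ccontD (ccontM (ccont_cst (1 / 2)%:C) cu) (ccontM (ccont_cst (1 - 1 / 2)%:C) cv).
have s1 := ccont_sqr cu; have s2 := ccont_sqr cv; have s3 := ccont_sqr cm.
have e : mean (fun t => (normc (u t - v t) ^+ 2)%:C) =
  2%:C * mean (fun t => (normc (u t) ^+ 2)%:C) + 2%:C * mean (fun t => (normc (v t) ^+ 2)%:C) -
  4%:C * mean (fun t => (normc ((1 / 2)%:C * u t + (1 - 1 / 2)%:C * v t) ^+ 2)%:C).
  have m1 := ccontM (ccont_cst (2%:C : R[i])) s1; have m2 := ccontM (ccont_cst (2%:C : R[i])) s2.
  have m3 := ccontM (ccont_cst (4%:C : R[i])) s3.
  rewrite -(meanZ _ (cintegrable_angles s1)) -(meanZ _ (cintegrable_angles s2)).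
  rewrite -(meanZ _ (cintegrable_angles s3)) -(meanD (cintegrable_angles m1) (cintegrable_angles m2)).
  rewrite -(meanB (cintegrable_angles (ccontD m1 m2)) (cintegrable_angles m3)).
  apply: eq_mean => t _; rewrite -!rcM -rcD -rcB; congr (_ %:C).
  rewrite !normc_sqr; case: (u t) (v t) => a b [c d] /=; by field.
by rewrite /energy e cReD cReN cReD !cReM /= !mul0r !subr0.
Qed.

(** The inequality [2 * x <= l^-1 + l * x ^+ 2], integrated; it replaces the inequality of
    Cauchy and Schwarz. *)
Lemma mean_normc_energy u (l : R) : ccont u -> 0 < l ->
  complex.Re (mean (fun t => (normc (u t))%:C)) <= (l^-1 + l * energy u) / 2.
Proof.
move=> cu l0; have s1 := ccont_sqr cu.
have c1 := ccontD (ccont_cst (l^-1 / 2)%:C) (ccontM (ccont_cst (l / 2)%:C) s1).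
have -> : (l^-1 + l * energy u) / 2 =
    complex.Re (mean (fun t => (l^-1 / 2)%:C + (l / 2)%:C * (normc (u t) ^+ 2)%:C)).
  rewrite (meanD (cintegrable_cst _) (cintegrable_angles (ccontM (ccont_cst (l / 2)%:C) s1))).
  rewrite (meanZ _ (cintegrable_angles s1)) mean_cst cReD cReM /= mul0r subr0 /energy.
  by field; rewrite gt_eqF.
apply: Re_mean_le c1 _; first by apply: ccont_real; exact: ccont_normc.
move=> t _; rewrite normc_real ger0_norm ?normc_ge0 // -rcM -rcD /=.
set x := normc (u t).
have : 0 <= (l * x - 1) ^+ 2 / (2 * l) by rewrite divr_ge0 ?sqr_ge0 // mulr_ge0 // ltW.
have -> : (l * x - 1) ^+ 2 / (2 * l) = l^-1 / 2 + l / 2 * x ^+ 2 - x by field; rewrite gt_eqF.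
by rewrite subr_ge0.
Qed.

(** Nearly minimal elements of the tail hulls form a Cauchy sequence in mean square, by the
    parallelogram identity; a fast Cauchy sequence converges almost everywhere. *)
Lemma tail_hull_cvg_ae F (M : R) : (forall n, ccont (F n \o expi)) ->
  (forall n t, normc (F n (expi t)) <= M) ->
  exists (G : nat -> R[i] -> R[i]) (h : R -> R[i]),
   [/\ forall j, tail_hull F j (G j), cmeasurable A h, exists B, forall t, normc (h t) <= B &
       {ae mu, forall t, A t -> G j (expi t) @[j --> \oo] --> h t}].
Proof.
move=> cF FM.
have M0 : 0 <= M by apply: le_trans (FM 0%N 0); exact: normc_ge0.
pose En N := [set energy (G \o expi) | G in tail_hull F N].
pose d N := inf (En N).
have En0 N : En N !=set0 by exists (energy (F N \o expi)); exists (F N) => //; exact: tail_hull_base.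
have Elb N : lbound (En N) 0.
  by move=> _ [G hG <-]; apply: energy_ge0; exact: tail_hull_cont hG.
have dle N G : tail_hull F N G -> d N <= energy (G \o expi).
  by move=> hG; apply: ge_inf; [exists 0; exact: Elb|exists G].
have dM N : d N <= M ^+ 2.
  apply: le_trans (dle N (F N) (tail_hull_base _ (leqnn N))) _.
  by apply: energy_bound => //; exact: FM.
(* The infima [d N] increase with [N]; beyond an index where they are almost equal to their
   supremum, midpoints cannot have much less energy than the points. *)
pose dd := sup (range d).
have hsd : has_sup (range d).
  by split; [exists (d 0%N); exists 0%N|exists (M ^+ 2) => _ [N _ <-]].
have ddge N : d N <= dd by apply: (ub_le_sup hsd.2); exists N.
have dmono N N' : (N <= N')%N -> d N <= d N'.
  move=> NN'; apply: lb_le_inf; first exact: En0.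
  by move=> _ [G hG <-]; apply: dle; exact: tail_hullW hG.
(* With this choice two consecutive elements differ by at most [4 ^- j] in mean square. *)
pose eps j : R := (8 * 4 ^+ j)^-1.
have eps0 j : 0 < eps j by rewrite invr_gt0 mulr_gt0 // exprn_gt0.
have pick j : exists NG : nat * (R[i] -> R[i]), [/\ (j <= NG.1)%N, dd - eps j < d NG.1,
    tail_hull F NG.1 NG.2 & energy (NG.2 \o expi) < d NG.1 + eps j].
  have [_ [N _ <-] hN] := sup_adherent (eps0 j) hsd.
  have hi : has_inf (En (maxn j N)) by split; [exact: En0|exists 0; exact: Elb].
  have [_ [G hG <-] hE] := inf_adherent (eps0 j) hi.
  exists (maxn j N, G); split=> //=; first exact: leq_maxl.
  by apply: lt_le_trans hN _; apply: dmono; exact: leq_maxr.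
have [NG hNG] := choice pick.
pose G j := (NG j).2.
have cG j : ccont (G j \o expi) by have [_ _ h _] := hNG j; exact: tail_hull_cont h.
have step j : energy (fun t => G j.+1 (expi t) - G j (expi t)) <= (4 ^+ j)^-1.
  have [_ a1 a2 a3] := hNG j; have [_ b1 b2 b3] := hNG j.+1.
  rewrite (energy_parallelogram (cG j.+1) (cG j)).
  have half : 0 <= (1 / 2 : R) <= 1 by lra.
  pose m := minn (NG j).1 (NG j.+1).1.
  have hm := tail_hull_comb half (tail_hullW (geq_minr _ _ : (m <= _)%N) b2)
     (tail_hullW (geq_minl _ _ : (m <= _)%N) a2).
  have := dle _ _ hm.
  have ee : eps j.+1 <= eps j.
    rewrite lef_pV2 ?posrE ?mulr_gt0 ?exprn_gt0 // exprS ler_pM2l //.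
    by rewrite ler_peMl ?exprn_ge0 // ler1n.
  have em : dd - eps j <= d m.
    by rewrite /m /minn; case: ifP => _; [exact: ltW|apply: le_trans (ltW b1); lra].
  have -> : (4 ^+ j)^-1 = 8 * eps j :> R by rewrite /eps invfM mulrA divff ?mul1r.
  have := ddge (NG j).1; have := ddge (NG j.+1).1.
  rewrite /comp in a3 b3 *; move: a3 b3; rewrite /G.
  set E1 := energy _; set E2 := energy _; set E3 := energy _.
  lra.
pose g j t := normc (G j.+1 (expi t) - G j (expi t)).
have cg j : ccont (fun t => G j.+1 (expi t) - G j (expi t)) by exact: (ccontB (cG j.+1) (cG j)).
have mg j : measurable_fun A (g j).
  apply: measurable_funTS; apply: continuous_measurable_fun; exact: ccont_normc.
have ig j : mu.-integrable A (fun t => (g j t)%:E).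
  by have /cintegrable_ReIm[] := cintegrable_angles (ccont_real (ccont_normc (cg j))).
(* [mean_normc_energy] with [l = 2 ^+ j] makes the mean steps summable. *)
have gint j : (\int[mu]_(t in A) (g j t)%:E <= (2 * pi / 2 ^+ j)%:E)%E.
  have -> : (\int[mu]_(t in A) (g j t)%:E)%E = (\int[mu]_(t in A) g j t)%:E.
    rewrite /Rintegral fineK //; apply: integrable_fin_num; first exact: measurable_angles.
    exact: ig.
  rewrite lee_fin [leRHS]mulrC -ler_pdivrMr ?pi2_gt0 // [leLHS]mulrC -mean_real.
  have p2 : 0 < 2 ^+ j :> R by exact: exprn_gt0.
  apply: le_trans (mean_normc_energy (cg j) p2) _.
  have := step j; rewrite -[4]/(2 * 2)%:R natrM exprMn invfM => st.
  rewrite ler_pdivrMr // mulr_natr mulr2n lerD2l.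
  apply: le_trans (ler_wpM2l (ltW p2) st) _.
  by rewrite mulrA divff ?mul1r // gt_eqF.
have g0 j t : 0 <= g j t by exact: normc_ge0.
have aeS := ae_nneseries_lty (@measurable_angles R) mg g0 gint.
have GB j t : normc (G j (expi t)) <= M.
  have [_ _ h _] := hNG j; apply: tail_hull_bound h => n; exact: FM.
have mG j := cmeasurable_cont (@measurable_angles R) (cG j).
have [h1 [m1 b1 c1]] := @ae_limit_measurable R A (fun j t => complex.Re (G j (expi t))) M
  (@measurable_angles R) (fun j => ((cmeasurable_ReIm _ _).1 (mG j)).1)
  (fun j t _ => le_trans (Re_le_normc _) (GB j t)) M0.
have [h2 [m2 b2 c2]] := @ae_limit_measurable R A (fun j t => complex.Im (G j (expi t))) M
  (@measurable_angles R) (fun j => ((cmeasurable_ReIm _ _).1 (mG j)).2)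
  (fun j t _ => le_trans (Im_le_normc _) (GB j t)) M0.
exists G, (fun t => h1 t +i* h2 t); split.
- by move=> j; have [jN _ h _] := hNG j; exact: tail_hullW h.
- by apply/cmeasurable_ReIm.
- exists (M + M) => t; apply: le_trans (normc_le_ReIm _) _; apply: lerD; [exact: b1|exact: b2].
- apply: ae_imply aeS _ => t hS At; have hs := hS At.
  apply/cvgc_ReIm; split=> /=.
    apply: c1 => //; apply: (cvg_of_summable_steps (g := fun j => g j t)) => // n.
    by rewrite -cReN -cReD; exact: Re_le_normc.
  apply: c2 => //; apply: (cvg_of_summable_steps (g := fun j => g j t)) => // n.
  by rewrite -cImN -cImD; exact: Im_le_normc.
Qed.

End ConvexTails.

(** * The Cauchy transform *)

Section CauchyTransform.
Variable R : realType.
Notation mu := (@lebesgue_measure R).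
Notation A := (@angles R).
Implicit Types (h : R -> R[i]) (z w : R[i]) (t : R) (p : {poly R[i]}).

Lemma derivable_quadratic (f : R[i] -> R[i]) z d (rho K : R) : 0 < rho ->
  (forall w, normc (w - z) < rho ->
     normc (f w - f z - d * (w - z)) <= K * normc (w - z) ^+ 2) ->
  derivable f z 1.
Proof.
move=> rho0 hf; apply/cvg_ex; exists d; apply/cvgcP => e e0.
pose m := Num.min rho (e / (`|K| + 1)).
have K1 : 0 < `|K| + 1 by rewrite ltr_wpDl.
have m0 : 0 < m by rewrite lt_min rho0 divr_gt0.
apply/nbhs_ballP; exists m%:C => /=; first by rewrite ltcR.
move=> k; rewrite /ball /= sub0r normrN cnormE ltcR => km k0.
have nk : 0 < normc k by rewrite normc_gt0.
have -> : k^-1 *: (f (k *: 1 + z) - f z) - d = k^-1 * (f (z + k) - f z - d * (z + k - z)).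
  rewrite /GRing.scale /= mulr1 (addrC k z); move: (f (z + k)) (f z) => a b.
  by field.
have zk : normc (z + k - z) = normc k by rewrite addrC addKr.
rewrite normcM normcV mulrC ltr_pdivrMr //.
apply: le_lt_trans (hf _ _) _; first by rewrite zk; apply: lt_le_trans km _; rewrite ge_min lexx.
rewrite zk expr2 mulrA ltr_pM2r //.
have : normc k * (`|K| + 1) < e.
  by rewrite -ltr_pdivlMr //; apply: lt_le_trans km _; rewrite ge_min lexx orbT.
apply: le_lt_trans; rewrite mulrC ler_pM2l //.
by apply: le_trans (ler_norm K) _; rewrite lerDl.
Qed.

Lemma derivable_cvg (f : R[i] -> R[i]) z : derivable f z 1 -> f w @[w --> z] --> f z.
Proof.
by move=> h; apply: differentiable_continuous; apply/derivable1_diffP.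
Qed.

Lemma derivable_poly (p : {poly R[i]}) z : derivable (fun w => p.[w]) z 1.
Proof.
have did : derivable (fun w : R[i] => w) z 1 by exact: derivable_id.
elim/poly_ind: p => [|p c IH].
  have -> : (fun w : R[i] => (0 : {poly R[i]}).[w]) = cst 0 by apply/funext => w; rewrite horner0.
  exact: derivable_cst.
have -> : (fun w => (p * 'X + c%:P).[w]) = (fun w => p.[w] * w + c).
  by apply/funext => w; rewrite hornerMXaddC.
have dc : derivable (fun=> c : R[i]) z 1 by exact: derivable_cst.
exact: (derivableD (derivableM IH did) dc).
Qed.

Definition cauchy_int h z := mean (fun t => h t * cauchy_ker z t).

Lemma cintegrable_mul_cont h v B : cmeasurable A h -> (forall t, A t -> normc (h t) <= B) ->
  ccont v -> cintegrable A (fun t => h t * v t).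
Proof.
move=> mh hB cv; have mv := cmeasurable_cont (@measurable_angles R) cv.
have A0 : A 0 by apply/anglesP; rewrite lexx ltW // pi2_gt0.
have B0 : 0 <= B by apply: le_trans (hB 0 A0); exact: normc_ge0.
have [C hC] : exists C, forall t, A t -> normc (v t) <= C.
  have := @compact_dominate R _ A (fun t => normc (v t)) (fun=> 1) (@segment_compact _ _ _).
  case=> [t _|t _|t|t _ _|C _ hC] //; [exact: ccont_normc|exact: cvg_cst|].
  by exists C => t /hC; rewrite mulr1.
apply: (@cintegrable_bounded R A _ (B * C)).
- exact: measurable_angles.
- exact: mu_angles_lty.
- exact: (cmeasurableM mh mv).
- by move=> t At; rewrite normcM ler_pM ?normc_ge0 //; [exact: hB|exact: hC].
Qed.

Lemma cauchy_ker_sub z w t : normc z < 1 -> normc w < 1 ->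
  cauchy_ker w t - cauchy_ker z t - (w - z) * ((expi t)^*%C * cauchy_ker z t ^+ 2) =
  (w - z) ^+ 2 * ((expi t)^*%C ^+ 2 * cauchy_ker z t ^+ 2 * cauchy_ker w t).
Proof.
move=> z1 w1; have dz := cauchy_den_neq0 t z1; have dw := cauchy_den_neq0 t w1.
rewrite /cauchy_ker; move: dz dw; move: ((expi t)^*%C) => c dz dw.
by field; apply/andP.
Qed.

(** The second-order remainder of the kernel in [z] is uniformly bounded by [cauchy_ker_sub]. *)
Lemma derivable_cauchy_int h z B : cmeasurable A h -> (forall t, normc (h t) <= B) ->
  normc z < 1 -> derivable (cauchy_int h) z 1.
Proof.
move=> mh hB z1.
have B0 : 0 <= B by apply: le_trans (hB 0); exact: normc_ge0.
pose rho := (1 - normc z) / 2.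
have rho0 : 0 < rho by rewrite /rho divr_gt0 // subr_gt0.
have cz := ccont_cauchy_ker z1.
pose D := mean (fun t => h t * ((expi t)^*%C * cauchy_ker z t ^+ 2)).
apply: (@derivable_quadratic _ z D rho (B * (rho^-1) ^+ 3) rho0) => w wz.
have w1 : normc w < 1.
  by have := normc_triangle z w 0; rewrite !subr0; move: wz; rewrite /rho; lra.
have cw := ccont_cauchy_ker w1.
have k1 : ccont (fun t => (expi t)^*%C * cauchy_ker z t ^+ 2).
  exact: (ccontM (ccont_conj ccont_expi) (ccontX (n := 2) cz)).
have k2 : ccont (fun t => (expi t)^*%C ^+ 2 * cauchy_ker z t ^+ 2 * cauchy_ker w t).
  exact: (ccontM (ccontM (ccont_cexpiX 2) (ccontX (n := 2) cz)) cw).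
have hB' t (_ : A t) := hB t.
have i1 := cintegrable_mul_cont mh hB' cw; have i2 := cintegrable_mul_cont mh hB' cz.
have i3 := cintegrable_mul_cont mh hB' k1; have i4 := cintegrable_mul_cont mh hB' k2.
have -> : cauchy_int h w - cauchy_int h z - D * (w - z) =
  (w - z) ^+ 2 * mean (fun t => h t * ((expi t)^*%C ^+ 2 * cauchy_ker z t ^+ 2 * cauchy_ker w t)).
  rewrite /cauchy_int /D [X in _ - X]mulrC -(meanZ (w - z) i3) -(meanZ _ i4).
  rewrite -(meanB i1 i2) -(meanB (cintegrableB (@measurable_angles R) i1 i2)
     (cintegrableZ _ (@measurable_angles R) i3)).
  by apply: eq_mean => t _; rewrite -mulrBr !(mulrCA _ (h t)) -mulrBr cauchy_ker_sub.
rewrite normcM normcX mulrC ler_wpM2r ?sqr_ge0 //.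
apply: mean_bound i4 _ => t _.
have b1 : normc (cauchy_ker z t) <= rho^-1.
  apply: le_trans (cauchy_ker_bound t z1) _; rewrite lef_pV2 ?posrE ?subr_gt0 //.
  by rewrite /rho; have := normc_ge0 z; lra.
have b2 : normc (cauchy_ker w t) <= rho^-1.
  apply: le_trans (cauchy_ker_bound t w1) _; rewrite lef_pV2 ?posrE ?subr_gt0 //.
  by have := normc_triangle z w 0; rewrite !subr0; move: wz; rewrite /rho; lra.
rewrite (normcM (h t)) (normcM (_ * _) (cauchy_ker w t)) (normcM (_ ^+ 2) (_ ^+ 2)).
rewrite normc_cexpiX mul1r normcX ler_pM ?normc_ge0 //.
  by rewrite mulr_ge0 ?exprn_ge0 ?normc_ge0.
by rewrite [X in _ <= X]exprSr ler_pM ?exprn_ge0 ?normc_ge0 // lerXn2r ?nnegrE ?normc_ge0 // ltW ?invr_gt0.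
Qed.

Lemma mean_dominated_mul (u_ : nat -> R -> R[i]) h v B :
  (forall n, ccont (u_ n)) -> cmeasurable A h -> ccont v ->
  (forall n t, A t -> normc (u_ n t) <= B) ->
  {ae mu, forall t, A t -> u_ n t @[n --> \oo] --> h t} ->
  mean (fun t => u_ n t * v t) @[n --> \oo] --> mean (fun t => h t * v t).
Proof.
move=> cu mh cv uB ch; have mv := cmeasurable_cont (@measurable_angles R) cv.
have [C hC] : exists C, forall t, A t -> normc (v t) <= C.
  have := @compact_dominate R _ A (fun t => normc (v t)) (fun=> 1) (@segment_compact _ _ _).
  case=> [t _|t _|t|t _ _|C _ hC] //; [exact: ccont_normc|exact: cvg_cst|].
  by exists C => t /hC; rewrite mulr1.
apply: (@mean_dominated R _ _ (B * C)).
- by move=> n; apply: cmeasurableM mv; apply: (cmeasurable_cont _ (cu n)); exact: measurable_angles.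
- exact: (cmeasurableM mh mv).
- by move=> n t At; rewrite normcM ler_pM ?normc_ge0 //; [exact: uB|exact: hC].
- apply: ae_imply ch _ => t ct At; have := ct At => ct'.
  by apply: cvgM ct' _; exact: cvg_cst.
Qed.

(** The derivative of the Poisson kernel in the argument of [z], divided by the imaginary unit.
    It reproduces [z * p^`().[z]] for polynomials, see [mean_deriv_ker_poly]. *)
Definition deriv_ker z t : R[i] :=
  z * (expi t)^*%C * cauchy_ker z t ^+ 2 - (z * (expi t)^*%C * cauchy_ker z t ^+ 2)^*%C.

Lemma ccont_ker2 z : normc z < 1 -> ccont (fun t => cauchy_ker z t ^+ 2).
Proof. by move=> z1; exact: (ccontX (n := 2) (ccont_cauchy_ker z1)). Qed.

Lemma ccont_deriv_ker z : normc z < 1 -> ccont (deriv_ker z).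
Proof.
move=> z1; have c1 := ccontM (ccontM (ccont_cst z) (ccont_conj ccont_expi)) (ccont_ker2 z1).
exact: (ccontB c1 (ccont_conj c1)).
Qed.

Lemma cauchy_ker2E z t : normc z < 1 ->
  cauchy_ker z t ^+ 2 = cauchy_ker z t + z * (expi t)^*%C * cauchy_ker z t ^+ 2.
Proof.
move=> z1; rewrite expr2 mulrA -[X in _ = X + _]mul1r -mulrDl.
by congr (_ * _); exact: cauchy_kerE.
Qed.

Lemma expiS_cancel t n (a b : R[i]) :
  expi t ^+ n.+1 * (a * (expi t)^*%C * b) = a * (expi t ^+ n * b).
Proof.
have := mul_expi_conj t; move: (expi t) (_^*%C) => e c ec.
have -> : e ^+ n.+1 * (a * c * b) = a * (e ^+ n * (e * c) * b) by rewrite exprSr; ring.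
by rewrite ec mulr1.
Qed.

(** [cauchy_ker2E] gives again a backward recursion, with an additional term that vanishes by
    [mean_cauchy_neg]. *)
Lemma mean_ker2_neg z n : normc z < 1 ->
  mean (fun t => (expi t)^*%C ^+ n.+1 * cauchy_ker z t ^+ 2) = 0.
Proof.
move=> z1; pose a m := mean (fun t => (expi t)^*%C ^+ m.+1 * cauchy_ker z t ^+ 2).
have c2 m := ccontM (ccont_cexpiX m) (ccont_ker2 z1).
have c1 m := ccontM (ccont_cexpiX m) (ccont_cauchy_ker z1).
apply: (bounded_backward_rec (a := a) (B := ((1 - normc z)^-1) ^+ 2) z1) => m.
  apply: (mean_bound (cintegrable_angles (c2 m.+1))) => t _.
  rewrite normcM normc_cexpiX mul1r normcX lerXn2r ?nnegrE ?normc_ge0 //.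
    by rewrite invr_ge0 subr_ge0 ltW.
  exact: cauchy_ker_bound.
rewrite /a -(meanZ _ (cintegrable_angles (c2 m.+2))).
rewrite -[LHS]subr0 -(mean_cauchy_neg m z1).
rewrite -(meanB (cintegrable_angles (c2 m.+1)) (cintegrable_angles (c1 m.+1))).
apply: eq_mean => t _; rewrite {1}(cauchy_ker2E t z1) mulrDr addrAC subrr add0r.
by rewrite [in RHS]exprS; ring.
Qed.

Lemma mean_ker2_pos z n : normc z < 1 ->
  mean (fun t => expi t ^+ n * cauchy_ker z t ^+ 2) = n.+1%:R * z ^+ n.
Proof.
move=> z1.
have c2 m := ccontM (ccont_expiX m) (ccont_ker2 z1).
have c1 m := ccontM (ccont_expiX m) (ccont_cauchy_ker z1).
have c3 m := ccontM (ccont_cexpiX m) (ccont_ker2 z1).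
elim: n => [|n IH].
  have -> : mean (fun t => expi t ^+ 0 * cauchy_ker z t ^+ 2) =
    mean (fun t => expi t ^+ 0 * cauchy_ker z t + z * ((expi t)^*%C ^+ 1 * cauchy_ker z t ^+ 2)).
    by apply: eq_mean => t _; rewrite expr0 !mul1r {1}cauchy_ker2E // expr1 mulrA.
  rewrite (meanD (cintegrable_angles (c1 0%N))
    (cintegrableZ z (@measurable_angles R) (cintegrable_angles (c3 1%N)))).
  rewrite (meanZ _ (cintegrable_angles (c3 1%N))) mean_ker2_neg // mulr0 addr0.
  by rewrite mean_cauchy_pos // mul1r.
have -> : mean (fun t => expi t ^+ n.+1 * cauchy_ker z t ^+ 2) =
  mean (fun t => expi t ^+ n.+1 * cauchy_ker z t + z * (expi t ^+ n * cauchy_ker z t ^+ 2)).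
  apply: eq_mean => t _; rewrite {1}cauchy_ker2E // mulrDr; congr (_ + _).
  exact: expiS_cancel.
rewrite (meanD (cintegrable_angles (c1 n.+1))
    (cintegrableZ z (@measurable_angles R) (cintegrable_angles (c2 n)))).
rewrite (meanZ _ (cintegrable_angles (c2 n))) IH mean_cauchy_pos //.
by rewrite -[in RHS]natr1 exprS; ring.
Qed.

Lemma mean_deriv_ker_pos z n : normc z < 1 ->
  mean (fun t => expi t ^+ n * deriv_ker z t) = n%:R * z ^+ n.
Proof.
move=> z1; have c2 m := ccontM (ccont_expiX m) (ccont_ker2 z1).
have c3 m := ccontM (ccont_cexpiX m) (ccont_ker2 z1).
have cz m := ccontM (ccont_cst z) (c3 m).
have h1 : mean (fun t => expi t ^+ n * (z * (expi t)^*%C * cauchy_ker z t ^+ 2)) = n%:R * z ^+ n.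
  case: n => [|n].
    rewrite mul0r -[RHS](mulr0 z) -(mean_ker2_neg 0 z1) -(meanZ _ (cintegrable_angles (c3 1%N))).
    by apply: eq_mean => t _; rewrite expr0 mul1r expr1 mulrA.
  have -> : n.+1%:R * z ^+ n.+1 = z * (n.+1%:R * z ^+ n) by rewrite exprS mulrCA.
  rewrite -(mean_ker2_pos n z1) -(meanZ _ (cintegrable_angles (c2 n))).
  by apply: eq_mean => t _; exact: expiS_cancel.
have h2 : mean (fun t => expi t ^+ n * (z * (expi t)^*%C * cauchy_ker z t ^+ 2)^*%C) = 0.
  rewrite -[RHS]conjc0 -[X in X^*%C](mulr0 z) -(mean_ker2_neg n z1).
  rewrite -(meanZ _ (cintegrable_angles (c3 n.+1))) -(mean_conj (cintegrable_angles (cz n.+1))).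
  apply: eq_mean => t _; set K := cauchy_ker z t ^+ 2.
  have -> : z * ((expi t)^*%C ^+ n.+1 * K) = (expi t)^*%C ^+ n * (z * (expi t)^*%C * K).
    by rewrite exprS; ring.
  by rewrite [RHS]conjM conjX conjcK.
have k1 := ccontM (ccontM (ccont_cst z) (ccont_conj ccont_expi)) (ccont_ker2 z1).
rewrite -[RHS]subr0 -h1 -h2 -(meanB (cintegrable_angles (ccontM (ccont_expiX n) k1))
  (cintegrable_angles (ccontM (ccont_expiX n) (ccont_conj k1)))).
by apply: eq_mean => t _; rewrite /deriv_ker mulrBr.
Qed.

Lemma mean_deriv_ker_poly z p : normc z < 1 ->
  mean (fun t => p.[expi t] * deriv_ker z t) = z * p^`().[z].
Proof.
move=> z1; rewrite (mean_poly _ (ccont_deriv_ker z1)) /deriv horner_poly.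
under eq_bigr do rewrite mean_deriv_ker_pos //.
case: (size p) => [|n]; first by rewrite !big_ord0 mulr0.
rewrite big_ord_recl /= mul0r mulr0 add0r mulr_sumr; apply: eq_bigr => i _.
by rewrite /bump /= add1n -mulr_natr exprS; ring.
Qed.

(** Near the point [expi th] the derivative of the Poisson kernel loses a factor [chord^-1],
    because [r * chord ^+ 2 <= |1 - z * conj (expi t)| ^+ 2]. *)
Lemma deriv_ker_bound r (th : R) t : 0 <= r < 1 ->
  normc (deriv_ker (r%:C * expi th) t) * normc (expi t - expi th) <=
  2 * poisson_ker (r%:C * expi th) t.
Proof.
move=> /andP[r0 r1]; set z := r%:C * expi th.
have zr : normc z = r by exact: normc_radial.
have z1 : normc z < 1 by rewrite zr.
set x := normc (expi t - expi th); set c := normc (cauchy_ker z t).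
pose a := expi th * (expi t)^*%C.
have wE : z * (expi t)^*%C = r%:C * a by rewrite /z /a mulrA.
have aa : a * a^*%C = 1.
  by rewrite /a conjM conjcK mulrACA mul_expi_conj mul1r mulrC mul_expi_conj.
have xa : normc (a - 1) = x.
  rewrite -(mul_expi_conj t) -mulrBl normcM normc_conj expi_norm mulr1; exact: normcBC.
have d0 := cauchy_den_neq0 t z1.
have dd : (1 - z * (expi t)^*%C)^*%C != 0 by rewrite conjc_eq0.
have kE : deriv_ker z t = (c ^+ 2)%:C * (c ^+ 2)%:C * (r%:C * (a - a^*%C) * (1 - r ^+ 2)%:C).
  rewrite /c -!mul_conjc /deriv_ker (conjM _ (_ ^+ 2)) conjX conjM /cauchy_ker conjc_inv.
  have e1 : z^*%C * (expi t)^*%C^*%C = r%:C * a^*%C by rewrite -conjM wE conjM conjc_real.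
  move: d0 dd; rewrite e1 wE conjB conjc1 conjM conjc_real => d0 dd.
  have e2 : (1 - r ^+ 2)%:C = 1 - (r%:C * a) * (r%:C * a^*%C) :> R[i].
    by rewrite rcB rc1 rcX mulrACA aa mulr1 expr2.
  by rewrite e2; field; apply/andP.
have cx : c ^+ 2 * (r * x ^+ 2) <= 1.
  have n2 : normc (1 - z * (expi t)^*%C) ^+ 2 = (1 - r) ^+ 2 + r * x ^+ 2.
    apply: complexI; rewrite -mul_conjc wE rcD (rcM r) -xa -mul_conjc rcX rcB rc1.
    rewrite !conjB !conjc1 conjM conjc_real.
    have -> : (1 - r%:C * a) * (1 - r%:C * a^*%C) =
      1 - r%:C * a - r%:C * a^*%C + r%:C * r%:C * (a * a^*%C) by ring.
    have -> : (a - 1) * (a^*%C - 1) = a * a^*%C - a - a^*%C + 1 by ring.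
    by rewrite aa; ring.
  have np : 0 < normc (1 - z * (expi t)^*%C) ^+ 2 by rewrite exprn_gt0 // normc_gt0.
  rewrite /c /cauchy_ker normcV exprVn mulrC ler_pdivrMr // mul1r n2.
  by rewrite lerDr sqr_ge0.
have an : normc (a - a^*%C) <= 2 * x.
  have -> : a - a^*%C = (a - 1) - (a - 1)^*%C by rewrite conjB conjc1; ring.
  by apply: le_trans (ler_normcB _ _) _; rewrite normc_conj xa; lra.
have c0 : 0 <= c ^+ 2 by exact: sqr_ge0.
have x0 : 0 <= x by exact: normc_ge0.
have r20 : 0 <= 1 - r ^+ 2 by rewrite subr_ge0 expr_le1 // ltW.
rewrite kE !normcM !normc_real ger0_norm // (ger0_norm r0) (ger0_norm r20).
rewrite /poisson_ker zr -/c.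
have P0 : 0 <= (1 - r ^+ 2) * c ^+ 2 by rewrite mulr_ge0.
have s1 : c ^+ 2 * c ^+ 2 * (r * normc (a - a^*%C) * (1 - r ^+ 2)) * x <=
   c ^+ 2 * c ^+ 2 * (r * (2 * x) * (1 - r ^+ 2)) * x.
  apply: ler_wpM2r => //; apply: ler_wpM2l; first exact: mulr_ge0.
  by apply: ler_wpM2r => //; apply: ler_wpM2l.
apply: le_trans s1 _.
have -> : c ^+ 2 * c ^+ 2 * (r * (2 * x) * (1 - r ^+ 2)) * x =
  (2 * ((1 - r ^+ 2) * c ^+ 2)) * (c ^+ 2 * (r * x ^+ 2)) by ring.
by rewrite ler_piMr // mulr_ge0.
Qed.

End CauchyTransform.

(** * Radial limits *)

Section Fatou.
Variable R : realType.
Notation mu := (@lebesgue_measure R).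
Notation A := (@angles R).
Implicit Types (h : R -> R[i]) (z w : R[i]) (t : R) (p : {poly R[i]}).

Lemma derivable_increment (F : R -> R) x (e : R) : derivable F x 1 -> 0 < e ->
  \forall y \near x, `|F y - F x - (y - x) * derive1 F x| <= e * `|y - x|.
Proof.
move=> dF e0; rewrite derive1E.
have /cvgRP /(_ e e0) : h^-1 *: (F (h *: 1 + x) - F x) @[h --> 0^'] --> 'D_1 F x by exact: dF.
move=> /nbhs_ballP[d /= d0 hd]; apply/nbhs_ballP; exists d => //= y.
rewrite /ball /= => xy; have [->|yx] := eqVneq y x; first by rewrite !subrr mul0r subrr normr0 mulr0.
have yx0 : y - x != 0 by rewrite subr_eq0.
have := hd (y - x); rewrite /ball /= sub0r normrN distrC => /(_ xy yx0).
rewrite /GRing.scale /= mulr1 subrK => h.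
have np : 0 < `|y - x| by rewrite normr_gt0.
have -> : F y - F x - (y - x) * 'D_1 F x = (y - x) * ((y - x)^-1 * (F y - F x) - 'D_1 F x).
  by field.
rewrite normrM [leLHS]mulrC (distrC x y); apply: ler_wpM2r => //; exact: ltW.
Qed.

Lemma ae_primitive (f : R -> R) (B : R) : measurable_fun A f -> (forall t, `|f t| <= B) ->
  {ae mu, forall x, 0 < x < 2 * pi -> forall e, 0 < e -> \forall y \near x,
    `|(\int[mu]_(t in `[0, y]) f t) - (\int[mu]_(t in `[0, x]) f t) - (y - x) * f x|
      <= e * `|y - x|}.
Proof.
move=> mf fB; pose f' := f \_ A.
have intA : mu.-integrable A (EFin \o f).
  apply: (integrable_le_bound (B := B)) => //; exact: mu_angles_lty.
have intT : mu.-integrable setT (EFin \o f').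
  have := intA; rewrite integrable_mkcond /=; first by rewrite (restrict_EFin f).
  exact: measurable_angles.
have loc : locally_integrable [set: R] f'.
  by apply: integrable_locally => //; exact: measurable_angles.
have inty y : mu.-integrable [set` Interval (BLeft 0) (BRight y)] (EFin \o f').
  by apply: integrableS intT.
have := FTC1 inty loc => /= FT.
have Ieq y : 0 < y < 2 * pi -> \int[mu]_(t in `[0, y]) f t = \int[mu]_(t in `[0, y]) f' t.
  move=> /andP[y0 y2]; apply: eq_Rintegral => t; rewrite inE /= in_itv /= => /andP[t0 ty].
  by rewrite /f' patchE mem_set //; apply/anglesP; rewrite t0 (le_trans ty) // ltW.
apply: ae_imply FT _ => x hx x2 e e0; have /andP[x0 x3] := x2.
have [|dF Fx] := hx; first by rewrite lte_fin.
have f'x : f' x = f x by rewrite /f' patchE mem_set //; apply/anglesP; rewrite !ltW.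
have := derivable_increment dF e0; rewrite Fx f'x.
have near2 : \forall y \near x, 0 < y < 2 * pi.
  have n1 : \forall y \near x, 0 < y by exact: lt_nbhsr.
  have n2 : \forall y \near x, y < 2 * pi by exact: lt_nbhsl.
  by apply: filterS2 n1 n2 => y -> ->.
by apply: filterS2 near2 => y y2; rewrite (Ieq _ y2) (Ieq _ x2).
Qed.

(** Lebesgue's differentiation theorem for a complex density. *)
Lemma ae_cprimitive (q : R -> R[i]) (B : R) : cmeasurable A q -> (forall t, normc (q t) <= B) ->
  {ae mu, forall x, 0 < x < 2 * pi -> forall e, 0 < e -> \forall y \near x,
    normc (cint `[0, y] q - cint `[0, x] q - (y - x)%:C * q x) <= e * `|y - x|}.
Proof.
move=> /cmeasurable_ReIm[m1 m2] qB.
have a1 := ae_primitive m1 (fun t => le_trans (Re_le_normc _) (qB t)).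
have a2 := ae_primitive m2 (fun t => le_trans (Im_le_normc _) (qB t)).
apply: ae_imply2 a1 a2 _ => x h1 h2 x2 e e0.
have e2 : 0 < e / 2 by rewrite divr_gt0.
have := h1 x2 _ e2; have := h2 x2 _ e2; apply: filterS2 => y k2 k1.
apply: le_trans (normc_le_ReIm _) _.
rewrite !(cReD, cReN, cImD, cImN, cReM, cImM) !cint_ReE !cint_ImE /= !mul0r subr0 addr0.
by rewrite [X in X * `|_|](splitr e) [X in _ <= X]mulrDl; exact: lerD.
Qed.

Lemma expi_inj (s t : R) : 0 < s < 2 * pi -> 0 <= t <= 2 * pi -> expi s = expi t -> s = t.
Proof.
move=> s1 t1 st.
have h : expi (s - t) = 1 by rewrite expiD expiN st mul_expi_conj.
have c1 : cos (s - t) = 1 by have := congr1 (@complex.Re R) h.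
pose v := (s - t) / 2.
have vE : s - t = v *+ 2 by rewrite /v -mulr_natr divfK.
have sv : sin v = 0.
  move: c1; rewrite vE cos_mulr2n cos2sin2 -mulr_natr => h1.
  by apply/eqP; rewrite -sqrf_eq0; apply/eqP; lra.
have vlt : - pi < v < pi by rewrite /v ltr_pdivlMr // ltr_pdivrMr //; lra.
case: (ltgtP v 0) => v0.
- by have := @sin_gt0_pi R (- v); rewrite sinN sv oppr0 ltxx => /(_ _) h1; exfalso; move: (h1 ltac:(lra)).
- by have := @sin_gt0_pi R v; rewrite sv ltxx => h1; exfalso; move: (h1 ltac:(lra)).
- by move: vE; rewrite v0 mul0rn => /eqP; rewrite subr_eq0 => /eqP.
Qed.

Lemma expi_increment (th e : R) : 0 < e -> \forall t \near th,
  normc (expi t - expi th - (t - th)%:C * ('i%C * expi th)) <= e * `|t - th|.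
Proof.
move=> e0; have e4 : 0 < e / 2 by rewrite divr_gt0.
have := derivable_increment (@derivable_cos R th) e4.
have := derivable_increment (@derivable_sin R th) e4.
apply: filterS2 => t.
have -> : derive1 sin th = cos th by rewrite derive1E; apply: derive_val.
have -> : derive1 cos th = - sin th by rewrite derive1E; apply: derive_val.
move=> hs hc.
apply: le_trans (normc_le_ReIm _) _.
rewrite !(cReD, cReN, cImD, cImN, cReM, cImM) /= !mul0r !mul1r.
rewrite !addr0 ?add0r ?sub0r ?subr0.
have -> : e * `|t - th| = e / 2 * `|t - th| + e / 2 * `|t - th| by field.
exact: lerD.
Qed.

Lemma chord_near (th : R) : \forall t \near th, `|t - th| <= 2 * normc (expi t - expi th).
Proof.
have e2 : 0 < 1 / 2 :> R by lra.
apply: filterS (expi_increment th e2) => t d.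
have := normc_triangle (expi t - expi th) ((t - th)%:C * ('i%C * expi th)) 0.
rewrite !subr0 normcM normc_real normcM expi_norm mulr1.
have -> : normc ('i%C : R[i]) = 1 by rewrite /normc /= expr0n /= add0r expr1n sqrtr1.
by rewrite mulr1 normcBC; move: d; lra.
Qed.

(** Away from [th] the chord is bounded below by compactness, so that a bound by
    [o(|t - th|)] at [th] is a bound by [e * chord + C * chord ^+ 3] everywhere. *)
Lemma chord_modulus (L : R -> R[i]) (th B e : R) : 0 < th < 2 * pi ->
  (forall t, A t -> normc (L t) <= B) ->
  (forall e, 0 < e -> \forall t \near th, normc (L t) <= e * `|t - th|) -> 0 < e ->
  exists2 C, 0 <= C & forall t, A t ->
    normc (L t) <= e * normc (expi t - expi th) + C * normc (expi t - expi th) ^+ 3.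
Proof.
move=> th2 LB Lo e0.
have e2 : 0 < e / 2 by rewrite divr_gt0.
have /nbhs_ballP[d /= d0 hd] : \forall t \near th,
    normc (L t) <= e / 2 * `|t - th| /\ `|t - th| <= 2 * normc (expi t - expi th).
  by apply: filterS2 (Lo _ e2) (chord_near th).
pose K : set R := `[0, th - d] `|` `[th + d, 2 * pi].
have cK : compact K by apply: compactU; exact: segment_compact.
have cx : continuous (fun t => normc (expi t - expi th)).
  exact: (ccont_normc (ccontB ccont_expi (ccont_cst (expi th)))).
have cx3 : continuous (fun t => normc (expi t - expi th) ^+ 3).
  have -> : (fun t => normc (expi t - expi th) ^+ 3) = fun t =>
     normc (expi t - expi th) * (normc (expi t - expi th) * normc (expi t - expi th)).
    by apply/funext => t; rewrite !exprS expr0 mulr1.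
  by move=> t; do 2 (apply: cvgM; first exact: cx); exact: cx.
have [||||C C0 hC] := @compact_dominate R _ K (fun=> `|B|) (fun t => normc (expi t - expi th) ^+ 3) cK.
- by move=> t _; exact: cvg_cst.
- by move=> t _; exact: cx3.
- by move=> t; rewrite exprn_ge0 // normc_ge0.
- move=> t Kt _; rewrite exprn_gt0 // normc_gt0 subr_eq0; apply/eqP => /esym h.
  have tA : 0 <= t <= 2 * pi.
    by case: Kt; rewrite /= in_itv /= => /andP[h1 h2]; apply/andP; split => //; lra.
  have := expi_inj th2 tA h => tth.
  by case: Kt; rewrite /= in_itv /= -tth; lra.
exists C => // t At; have /anglesP At2 := At.
have x0 := normc_ge0 (expi t - expi th).
case: (ltP `|t - th| d) => td.
  have [|h1 h2] := hd t; first by rewrite /ball /= distrC.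
  apply: (@le_trans _ _ (e * normc (expi t - expi th))); last by rewrite lerDl mulr_ge0 ?exprn_ge0.
  by apply: le_trans h1 _; rewrite -mulrA ler_pM2l // ler_pdivrMl.
apply: (@le_trans _ _ (C * normc (expi t - expi th) ^+ 3)); last by rewrite lerDr mulr_ge0 // ltW.
apply: le_trans (LB t At) _; apply: le_trans (ler_norm _) _; apply: hC.
have [tt|tt] := leP th t.
  by right; rewrite /= in_itv /=; move: td; rewrite ger0_norm ?subr_ge0 //; lra.
by left; rewrite /= in_itv /=; move: td; rewrite ltr0_norm ?subr_lt0 //; lra.
Qed.

Lemma poly_antiderivative p : exists q : {poly R[i]}, deriv q = p.
Proof.
exists (\sum_(i < size p) (p`_i / i.+1%:R) *: 'X^(i.+1)).
rewrite raddf_sum /= -[RHS]coefK poly_def; apply: eq_bigr => i _.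
by rewrite derivZ derivXn /= -(scaler_nat i.+1 ('X^i : {poly R[i]})) scalerA divfK // pnatr_eq0.
Qed.

Lemma poly_primitive p q t : 0 <= t -> deriv q = p ->
  cint `[0, t] (fun s => p.[expi s] * ('i%C * expi s)) = q.[expi t] - q.[1].
Proof.
move=> t0 <-; rewrite -expi0; apply: (cint_FTC (U := fun s => q.[expi s])) => // s _.
  have c := ccontM (ccont_poly (deriv q) (@ccont_expi R)) (ccontM (ccont_cst 'i%C) ccont_expi).
  exact: (ccont_at (t := s) c).
exact: (cder_poly q (cder_expi s)).
Qed.

Lemma subset_angles t : A t -> `[0, t] `<=` A.
Proof.
move=> /anglesP /andP[t0 t2] s /=; rewrite in_itv /= => /andP[s0 st].
by apply/anglesP; rewrite s0 (le_trans st).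
Qed.

Lemma ae_interior : {ae mu, forall t, A t -> 0 < t < 2 * pi}.
Proof.
exists ([set 0] `|` [set (2 * pi)]); split.
- by apply: measurableU; exact: measurable_set1.
- by rewrite null_set_setU //; exact: lebesgue_measure_set1.
- move=> t /= /not_implyP[/anglesP /andP[t0 t2] /negP].
  rewrite negb_and -!leNgt => /orP[h|h]; [left|right]; apply/eqP; rewrite eq_le.
    by rewrite h.
  by rewrite h t2.
Qed.

Section BoundaryValues.
Variables (P : nat -> {poly R[i]}) (h : R -> R[i]) (M B : R).
Hypothesis PM : forall n w, normc w = 1 -> normc (P n).[w] <= M.
Hypothesis mh : cmeasurable A h.
Hypothesis hB : forall t, normc (h t) <= B.
Hypothesis Ph : {ae mu, forall t, A t -> (P n).[expi t] @[n --> \oo] --> h t}.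

Let cP n : ccont (fun t : R => (P n).[expi t]).
Proof. exact: (ccont_poly (P n) ccont_expi). Qed.

Let PMe n t : normc (P n).[expi t] <= M.
Proof. by apply: PM; exact: expi_norm. Qed.

Let M0 : 0 <= M.
Proof. by apply: le_trans (PMe 0%N 0); exact: normc_ge0. Qed.

Lemma cvg_cauchy_int z : normc z < 1 -> (P n).[z] @[n --> \oo] --> cauchy_int h z.
Proof.
move=> z1; have c := ccont_cauchy_ker z1.
have := mean_dominated_mul (@cP) mh c (fun n t _ => PMe n t) Ph.
by under eq_fun do rewrite mean_cauchy_poly //.
Qed.

Let q t := h t * ('i%C * expi t).
Let H t := cint `[0, t] q.

Let ci : ccont (fun t : R => 'i%C * expi t).
Proof. exact: (ccontM (ccont_cst 'i%C) ccont_expi). Qed.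

Let mq : cmeasurable A q.
Proof. exact: (cmeasurableM mh (cmeasurable_cont (@measurable_angles R) ci)). Qed.

Let normi t : normc ('i%C * expi t) = 1 :> R.
Proof. by rewrite normcM expi_norm mulr1 /normc /= expr0n /= add0r expr1n sqrtr1. Qed.

Let qB t : normc (q t) <= B.
Proof. by rewrite /q normcM normi mulr1. Qed.

Let qP n t := (P n).[expi t] * ('i%C * expi t).

Let HP n t := cint `[0, t] (qP n).

Let HP_bound n t : A t -> normc (HP n t) <= M * (2 * pi).
Proof.
move=> /anglesP /andP[t0 t2].
have cq : ccont (qP n) by exact: (ccontM (@cP n) ci).
apply: (@le_trans _ _ (\int[mu]_(s in `[0, t]) M)).
  apply: normc_cint_le => //.
  - exact: cintegrable_cont.
  - by have /cintegrable_ReIm[] := cintegrable_cont 0 t (ccont_cst M%:C).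
  - by move=> s _; rewrite /qP normcM normi mulr1.
rewrite Rintegral_cst // ler_wpM2l //.
have -> : fine (mu `[0, t]) = t.
  rewrite lebesgue_measure_itv /= lte_fin; case: ifP => [_|/negbT]; first by rewrite /= subr0.
  by rewrite -leNgt => t1; apply/eqP; rewrite eq_le t0 t1.
by [].
Qed.

Let HP_cvg t : A t -> HP n t @[n --> \oo] --> H t.
Proof.
move=> At; have sA := subset_angles At.
have mt : measurable (`[0, t] : set R) by exact: measurable_itv.
pose I : set R := `[0, t]%classic.
have ft : (mu I < +oo)%E.
  apply: le_lt_trans (mu_angles_lty R); apply: le_measure; rewrite ?inE //.
  exact: measurable_angles.
have m1 n : cmeasurable `[0, t] (qP n).
  have cq : ccont (qP n) by exact: (ccontM (@cP n) ci).
  exact: (cmeasurable_cont mt cq).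
have m2 : cmeasurable `[0, t] q.
  have /cmeasurable_ReIm[k1 k2] := mq.
  by apply/cmeasurable_ReIm; split; [apply: measurable_funS k1|apply: measurable_funS k2] => //;
    exact: measurable_angles.
have iM : mu.-integrable I (fun=> M%:E).
  by apply: (integrable_le_bound (f := cst M) (B := `|M|)).
have [||_ cvH] := @cint_dominated R I qP q (fun=> M) mt iM m1 m2.
- by move=> n s _; rewrite /qP normcM normi mulr1.
- by apply: ae_imply Ph _ => s hs st; apply: cvgM; [exact: hs (sA _ st)|exact: cvg_cst].
exact: cvH.
Qed.

Let HP_cont n : exists u, ccont u /\ forall t, A t -> HP n t = u t.
Proof.
have [X dX] := poly_antiderivative (P n).
exists (fun t => X.[expi t] - X.[1]); split.
  exact: (ccontB (ccont_poly X ccont_expi) (ccont_cst X.[1])).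
by move=> t /anglesP /andP[t0 _]; exact: poly_primitive.
Qed.

Let mH : cmeasurable A H.
Proof.
have mHP n : cmeasurable A (HP n).
  have [u [cu e]] := HP_cont n.
  have /cmeasurable_ReIm[m1 m2] := cmeasurable_cont (@measurable_angles R) cu.
  apply/cmeasurable_ReIm; split; [apply: eq_measurable_fun m1|apply: eq_measurable_fun m2];
    by move=> t /[!inE] At; rewrite e.
apply/cmeasurable_ReIm; split.
  apply: (measurable_fun_cvg (h := fun n t => complex.Re (HP n t))).
    by move=> n; have /cmeasurable_ReIm[] := mHP n.
  by move=> t /HP_cvg /cvgc_ReIm[].
apply: (measurable_fun_cvg (h := fun n t => complex.Im (HP n t))).
  by move=> n; have /cmeasurable_ReIm[] := mHP n.
by move=> t /HP_cvg /cvgc_ReIm[].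
Qed.

Let Lam th t := H t - (H th + h th * (expi t - expi th)).

(** For polynomials this is [mean_deriv_ker_poly] applied to an antiderivative, as adding an
    affine function to it changes the derivative by a constant; the general case is a limit of
    polynomials. *)
Lemma cauchy_int_remainder z th : normc z < 1 ->
  z * (cauchy_int h z - h th) = mean (fun t => Lam th t * deriv_ker z t).
Proof.
move=> z1; have cK := ccont_deriv_ker z1.
pose c := h th.
have lim1 : z * ((P n).[z] - c) @[n --> \oo] --> z * (cauchy_int h z - c).
  apply: cvgM; first exact: cvg_cst.
  by apply: cvgB; [exact: cvg_cauchy_int|exact: cvg_cst].
have [X dX] := choice (fun n => poly_antiderivative (P n)).
pose u n t := (X n).[expi t] - (X n).[1] - (H th + c * (expi t - expi th)).
have uE n t : A t -> u n t = HP n t - (H th + c * (expi t - expi th)).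
  by move=> /anglesP /andP[t0 _]; rewrite /u /HP /qP (poly_primitive t0 (dX n)).
have cc : ccont (fun t => H th + c * (expi t - expi th)).
  exact: (ccontD (ccont_cst (H th)) (ccontM (ccont_cst c) (ccontB ccont_expi (ccont_cst (expi th))))).
have cu n : ccont (u n).
  exact: (ccontB (ccontB (ccont_poly (X n) ccont_expi) (ccont_cst (X n).[1])) cc).
have lim2 : mean (fun t => u n t * deriv_ker z t) @[n --> \oo] -->
    mean (fun t => Lam th t * deriv_ker z t).
  apply: (mean_dominated_mul (B := M * (2 * pi) + (normc (H th) + normc c * 2)) cu _ cK).
  - exact: (cmeasurableB mH (cmeasurable_cont (@measurable_angles R) cc)).
  - move=> n t At; rewrite uE //; apply: le_trans (ler_normcB _ _) _.
    apply: lerD; first exact: HP_bound.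
    apply: le_trans (ler_normcD _ _) _; rewrite lerD2l normcM ler_wpM2l ?normc_ge0 //.
    by apply: le_trans (ler_normcB _ _) _; rewrite !expi_norm.
  - apply: aeW => t At.
    have : HP n t - (H th + c * (expi t - expi th)) @[n --> \oo] --> Lam th t.
      by apply: cvgB; [exact: HP_cvg|exact: cvg_cst].
    by under eq_fun do rewrite -(uE _ _ At).
apply: (cvgc_unique lim1).
suff -> : (fun n => z * ((P n).[z] - c)) = (fun n => mean (fun t => u n t * deriv_ker z t)) by [].
apply/funext => n.
(* [Y] is the function under the mean, as a polynomial in [expi t]. *)
pose Y := X n - ((X n).[1] + H th - c * expi th)%:P - c *: 'X.
have <- : mean (fun t => Y.[expi t] * deriv_ker z t) = mean (fun t => u n t * deriv_ker z t).
  apply: eq_mean => t _; congr (_ * _).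
  by rewrite /Y /u !hornerE; ring.
rewrite mean_deriv_ker_poly // /Y !derivB derivZ derivX derivC dX subr0 hornerD hornerN.
by rewrite hornerZ hornerC mulr1.
Qed.

(** At each point [th] where the primitive of the boundary data is differentiable, its first-order
    remainder [Lam th] is at most [e * chord + C * chord ^+ 3]. By [deriv_ker_bound], the integral of
    [cauchy_int_remainder] is then controlled by the Poisson kernel and its second moment. *)
Theorem fatou_radial_limit : {ae mu, forall t, A t ->
  cauchy_int h (r%:C * expi t) @[r --> (1 : R)^'-] --> h t}.
Proof.
apply: ae_imply2 (ae_cprimitive mq qB) ae_interior _ => th hth hA Ath.
have th2 := hA Ath; have dH := hth th2.
have dlin e : 0 < e -> \forall t \near th, normc (Lam th t) <= e * `|t - th|.
  move=> e0; have e2 : 0 < e / 2 by rewrite divr_gt0.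
  have h1 := dH _ e2.
  have B0 : 0 < B + 1 by apply: lt_le_trans (ltr01) _; rewrite lerDr; apply: le_trans (hB 0); exact: normc_ge0.
  have e4 : 0 < e / (2 * (B + 1)) by rewrite divr_gt0 // mulr_gt0.
  have h2 : \forall t \near th, normc (expi t - expi th - (t - th)%:C * ('i%C * expi th))
      <= e / (2 * (B + 1)) * `|t - th| by exact: expi_increment.
  apply: filterS2 h1 h2 => t k1 k2.
  have -> : Lam th t = (cint `[0, t] q - cint `[0, th] q - (t - th)%:C * q th) -
     h th * (expi t - expi th - (t - th)%:C * ('i%C * expi th)).
    by rewrite /Lam /H /q; ring.
  apply: le_trans (ler_normcB _ _) _.
  rewrite [X in _ <= X * _](splitr e) mulrDl lerD // normcM.
  apply: (@le_trans _ _ ((B + 1) * (e / (2 * (B + 1)) * `|t - th|))).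
    apply: ler_pM; rewrite ?normc_ge0 //; apply: le_trans (hB _) _; by rewrite lerDl.
  by rewrite le_eqVlt; apply/orP; left; apply/eqP; field; rewrite gt_eqF.
pose LB := M * (2 * pi) + (normc (H th) + B * 2).
have HB t : A t -> normc (H t) <= M * (2 * pi).
  move=> At; rewrite -[H t]subr0; apply: (cvgc_le (HP_cvg At)).
  by apply: nearW => n; rewrite subr0; exact: HP_bound.
have LBd t : A t -> normc (Lam th t) <= LB.
  move=> At; apply: le_trans (ler_normcB _ _) _; apply: lerD; first exact: HB.
  apply: le_trans (ler_normcD _ _) _; rewrite lerD2l normcM.
  apply: ler_pM; rewrite ?normc_ge0 //.
  by apply: le_trans (ler_normcB _ _) _; rewrite !expi_norm.
have mLam : cmeasurable A (Lam th).
  have cc : ccont (fun t => H th + h th * (expi t - expi th)).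
    exact: (ccontD (ccont_cst (H th)) (ccontM (ccont_cst (h th))
       (ccontB ccont_expi (ccont_cst (expi th))))).
  exact: (cmeasurableB mH (cmeasurable_cont (@measurable_angles R) cc)).
apply/cvgcP => e e0.
have e8 : 0 < e / 8 by rewrite divr_gt0.
have [C C0 hC] := chord_modulus th2 LBd dlin e8.
have C1 : 0 < 32 * (C + 1) by rewrite mulr_gt0 // ltr_wpDl.
have eC : 1 - e / (32 * (C + 1)) < 1.
  by rewrite ltrBlDr ltrDl; exact: divr_gt0.
near=> r.
have r0 : 1 / 2 < r by near: r; apply: nbhs_left_gt; lra.
have r1 : r < 1 by near: r; exact: nbhs_left_lt.
have r01 : 0 <= r < 1 by lra.
have z1 : normc (r%:C * expi th) < 1 by rewrite normc_radial // ltW //; lra.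
have iL := cintegrable_mul_cont mLam LBd (ccont_deriv_ker z1).
have est := @poisson_estimate R _ r th (2 * (e / 8)) (2 * C) r01 iL.
have {}est : normc (mean (fun t => Lam th t * deriv_ker (r%:C * expi th) t))
    <= 2 * (e / 8) + 2 * C * (2 - 2 * r).
  apply: est => t At; rewrite normcM.
  apply: le_trans (ler_wpM2r (normc_ge0 _) (hC t At)) _.
  have := deriv_ker_bound th t r01; set x := normc (expi t - expi th).
  set k := normc (deriv_ker _ _); set p := poisson_ker _ _ => kx.
  have x0 : 0 <= x by exact: normc_ge0.
  have -> : (e / 8 * x + C * x ^+ 3) * k = (e / 8 + C * x ^+ 2) * (k * x) by ring.
  have -> : (2 * (e / 8) + 2 * C * x ^+ 2) * p = (e / 8 + C * x ^+ 2) * (2 * p) by ring.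
  by apply: ler_wpM2l kx; rewrite addr_ge0 ?mulr_ge0 ?sqr_ge0 // ltW.
rewrite -(cauchy_int_remainder th z1) normcM normc_radial in est; last by lra.
have r2 : 2 * C * (2 - 2 * r) <= e / 8.
  have : 1 - e / (32 * (C + 1)) < r by near: r; exact: nbhs_left_gt.
  rewrite ltrBlDr -ltrBlDl => h1.
  have : (1 - r) * (32 * (C + 1)) < e by rewrite -ltr_pdivlMr.
  have d0 : 0 <= 1 - r by rewrite subr_ge0 ltW.
  lra.
have : 1 / 2 * normc (cauchy_int h (r%:C * expi th) - h th) <= 3 * (e / 8).
  apply: (@le_trans _ _ (r * normc (cauchy_int h (r%:C * expi th) - h th))).
    by rewrite ler_wpM2r ?normc_ge0 // ltW.
  by apply: le_trans est _; lra.
lra.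
Unshelve. all: by end_near. Qed.

End BoundaryValues.

End Fatou.

(** * The theorem of Goursat *)

Section Goursat.
Variable R : realType.
Notation mu := (@lebesgue_measure R).
Implicit Types (f g : R[i] -> R[i]) (z w : R[i]) (p : {poly R[i]}) (x y r t : R).

Lemma derivable_cincrement f z : derivable f z 1 -> exists d, forall e : R, 0 < e ->
  exists2 rho : R, 0 < rho & forall w, normc (w - z) < rho ->
    normc (f w - f z - d * (w - z)) <= e * normc (w - z).
Proof.
move=> df; exists ('D_1 f z) => e e0.
have /cvgcP /(_ e e0) : k^-1 *: (f (k *: 1 + z) - f z) @[k --> 0^'] --> 'D_1 f z by exact: df.
move=> /nbhs_ballP[[d1 d2] /=]; rewrite ltcE /= => /andP[/eqP -> d0] hd.
exists d1 => // w wz; have [->|wz0] := eqVneq w z.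
  by rewrite !subrr mulr0 subrr normc0 mulr0.
have wz1 : w - z != 0 by rewrite subr_eq0.
have := hd (w - z); rewrite /ball /= sub0r normrN cnormE ltcR => /(_ wz wz1).
rewrite /GRing.scale /= mulr1 subrK => h.
have -> : f w - f z - 'D_1 f z * (w - z) = (w - z) * ((w - z)^-1 * (f w - f z) - 'D_1 f z).
  by move: (f w) (f z) => a b; field.
by rewrite normcM mulrC; apply: ler_wpM2r; [exact: normc_ge0|exact: ltW].
Qed.

Definition annulus : set R[i] := [set z | 0 < normc z < 1].

Definition annulus_cont f := forall z, annulus z -> f w @[w --> z] --> f z.

Definition radial_int f x x' t :=
  cint `[x, x'] (fun s => f (s%:C * expi t) * expi t).

Definition arc_int f r y y' :=
  cint `[y, y'] (fun s => f (r%:C * expi s) * (r%:C * ('i%C * expi s))).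

(** The integral of [f(z) dz] along the boundary of a rectangle in polar coordinates. For angles
    from 0 to [2 * pi] the two radial sides cancel, and two full circles remain. *)
Definition polar_boundary_int f x x' y y' :=
  radial_int f x x' y + arc_int f x' y y' - radial_int f x x' y' - arc_int f x y y'.

Lemma cvg_real_complex x : (s%:C : R[i]) @[s --> x] --> (x%:C : R[i]).
Proof. by apply/cvgc_ReIm; split => /=; [exact: cvg_id|exact: cvg_cst]. Qed.

Lemma radial_cont f t x : annulus_cont f -> 0 < x < 1 ->
  f (s%:C * expi t) * expi t @[s --> x] --> f (x%:C * expi t) * expi t.
Proof.
move=> cf /andP[x0 x1]; apply: cvgM; last exact: cvg_cst.
apply: (@cvg_comp _ _ _ (fun s : R => s%:C * expi t) f _ (nbhs (x%:C * expi t))); last first.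
  by apply: cf; rewrite /annulus /= normc_radial ?x0 // ltW.
by apply: cvgM; [exact: cvg_real_complex|exact: cvg_cst].
Qed.

Lemma arc_cont f r : annulus_cont f -> 0 < r < 1 ->
  ccont (fun s => f (r%:C * expi s) * (r%:C * ('i%C * expi s))).
Proof.
move=> cf /andP[r0 r1]; apply: ccontM; last first.
  exact: (ccontM (ccont_cst r%:C) (ccontM (ccont_cst 'i%C) ccont_expi)).
apply: ccontI => t.
apply: (@cvg_comp _ _ _ (fun s : R => r%:C * expi s) f _ (nbhs (r%:C * expi t))); last first.
  by apply: cf; rewrite /annulus /= normc_radial ?r0 // ltW.
by apply: cvgM; [exact: cvg_cst|exact: (ccont_at ccont_expi)].
Qed.

Lemma radial_integrable f t x x' : annulus_cont f -> 0 < x -> x' < 1 ->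
  cintegrable `[x, x'] (fun s => f (s%:C * expi t) * expi t).
Proof.
move=> cf x0 x1; apply: cintegrable_cont_itv => s /andP[xs sx].
by apply: radial_cont => //; rewrite (lt_le_trans x0) //= (le_lt_trans sx).
Qed.

Lemma polar_boundary_int_split f x m x' y n y' : annulus_cont f ->
  0 < x -> x <= m <= x' -> x' < 1 -> y <= n <= y' ->
  polar_boundary_int f x x' y y' =
    polar_boundary_int f x m y n + polar_boundary_int f m x' y n +
    polar_boundary_int f x m n y' + polar_boundary_int f m x' n y'.
Proof.
move=> cf x0 xm x1 yn; have /andP[xm1 xm2] := xm.
have r t : radial_int f x x' t = radial_int f x m t + radial_int f m x' t.
  by apply: cint_split => //; exact: radial_integrable.
have a s : 0 < s < 1 -> arc_int f s y y' = arc_int f s y n + arc_int f s n y'.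
  by move=> s1; apply: cint_split => //; apply: cintegrable_cont; exact: arc_cont.
have x01 : 0 < x < 1 by rewrite x0 (le_lt_trans xm1) // (le_lt_trans xm2).
have x02 : 0 < x' < 1 by rewrite (lt_le_trans x0) ?(le_trans xm1).
have m01 : 0 < m < 1 by rewrite (lt_le_trans x0 xm1) (le_lt_trans xm2).
have e (A1 A2 A3 A4 A5 A6 B1 B2 B3 B4 B5 B6 : R[i]) :
  A1 + A2 + (B1 + B2) - (A3 + A4) - (B3 + B4) =
  A1 + B5 - A5 - B3 + (A2 + B1 - A6 - B5) + (A5 + B6 - A3 - B4) + (A6 + B2 - A4 - B6) by ring.
by rewrite /polar_boundary_int !r (a x x01) (a x' x02); exact: e.
Qed.

Lemma cder_radial t x : cder (fun s => s%:C * expi t) x (expi t).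
Proof.
have h : cder (fun s => s%:C : R[i]) x 1 by split => /=; [exact: is_derive_id|exact: is_derive_cst].
by have := cderM h (cder_cst (expi t) x); rewrite mul1r mulr0 addr0.
Qed.

Lemma polar_boundary_int_poly p x x' y y' : x <= x' -> y <= y' ->
  polar_boundary_int (horner p) x x' y y' = 0.
Proof.
move=> xx yy; have [q <-] := poly_antiderivative p.
have r t : radial_int (horner (deriv q)) x x' t = q.[x'%:C * expi t] - q.[x%:C * expi t].
  apply: (cint_FTC (U := fun s => q.[s%:C * expi t])) => // s _; last first.
    exact: (cder_poly q (cder_radial t s)).
  have cr : ccont (fun s : R => s%:C * expi t : R[i]).
    exact: (ccontM (ccontI cvg_real_complex) (ccont_cst (expi t))).
  exact: (ccont_at (t := s) (ccontM (ccont_poly (deriv q) cr) (ccont_cst (expi t)))).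
have a s : arc_int (horner (deriv q)) s y y' = q.[s%:C * expi y'] - q.[s%:C * expi y].
  apply: (cint_FTC (U := fun t => q.[s%:C * expi t])) => // t _; last first.
    have := cder_poly q (cderM (cder_cst s%:C t) (cder_expi t)).
    by rewrite mul0r add0r.
  have cr : ccont (fun t : R => s%:C * expi t : R[i]) by exact: (ccontM (ccont_cst s%:C) ccont_expi).
  have ce : ccont (fun t : R => s%:C * ('i%C * expi t)).
    exact: (ccontM (ccont_cst s%:C) (ccontM (ccont_cst 'i%C) ccont_expi)).
  exact: (ccont_at (t := t) (ccontM (ccont_poly (deriv q) cr) ce)).
by rewrite /polar_boundary_int !r !a; ring.
Qed.

Lemma normc_cint_itv (u : R -> R[i]) x x' B : x <= x' -> cintegrable `[x, x'] u ->
  (forall s, x <= s <= x' -> normc (u s) <= B) -> normc (cint `[x, x'] u) <= B * (x' - x).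
Proof.
move=> xx iu uB; apply: (@le_trans _ _ (\int[mu]_(s in `[x, x']) B)).
  apply: normc_cint_le => //.
  by have /cintegrable_ReIm[] := cintegrable_cont x x' (ccont_cst B%:C).
rewrite Rintegral_cst //.
have -> : fine (mu `[x, x']) = x' - x.
  rewrite lebesgue_measure_itv /= lte_fin; case: ifP => [_|/negbT]; first by rewrite /=.
  by rewrite -leNgt => h; apply/eqP; rewrite eq_sym subr_eq0 eq_le h xx.
by [].
Qed.

Lemma polar_boundary_int_bound f x x' y y' e : annulus_cont f ->
  0 < x -> x <= x' -> x' < 1 -> y <= y' ->
  (forall s t, x <= s <= x' -> y <= t <= y' -> normc (f (s%:C * expi t)) <= e) ->
  normc (polar_boundary_int f x x' y y') <= 2 * e * ((x' - x) + (y' - y)).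
Proof.
move=> cf x0 xx x1 yy fe.
have e0 : 0 <= e by apply: le_trans (fe x y _ _); rewrite ?normc_ge0 ?lexx.
have r t : y <= t <= y' -> normc (radial_int f x x' t) <= e * (x' - x).
  move=> ty; apply: normc_cint_itv => //; first exact: radial_integrable.
  by move=> s sx; rewrite normcM expi_norm mulr1; exact: fe.
have a s : x <= s <= x' -> normc (arc_int f s y y') <= e * (y' - y).
  move=> sx; have s1 : 0 < s < 1 by lra.
  apply: normc_cint_itv => //; first exact: (cintegrable_cont y y' (arc_cont cf s1)).
  move=> t ty; have ni : normc ('i%C : R[i]) = 1.
    by rewrite /normc /= expr0n /= add0r expr1n sqrtr1.
  rewrite !normcM expi_norm ni !mulr1 normc_real ger0_norm; last by lra.
  by rewrite -[leRHS]mulr1 ler_pM ?normc_ge0 ?fe //; lra.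
rewrite /polar_boundary_int.
have yl : y <= y <= y' by rewrite lexx.
have yr : y <= y' <= y' by rewrite lexx andbT.
have xl : x <= x <= x' by rewrite lexx.
have xr : x <= x' <= x' by rewrite lexx andbT.
have -> : 2 * e * (x' - x + (y' - y)) =
  e * (x' - x) + e * (y' - y) + e * (x' - x) + e * (y' - y) by ring.
apply: le_trans (ler_normcB _ _) (lerD _ (a x xl)).
apply: le_trans (ler_normcB _ _) (lerD _ (r y' yr)).
exact: le_trans (ler_normcD _ _) (lerD (r y yl) (a x' xr)).
Qed.

Lemma normc_expi_sub t s : normc (expi t - expi s) <= `|t - s|.
Proof.
wlog st : s t / s <= t.
  move=> h; case: (leP s t) => [/h//|/ltW /h]; rewrite normcBC distrC //.
have ci : ccont (fun t : R => 'i%C * expi t) by exact: (ccontM (ccont_cst 'i%C) ccont_expi).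
have <- : cint `[s, t] (fun s => 'i%C * expi s) = expi t - expi s.
  apply: cint_FTC => // u _; [exact: (ccont_at (t := u) ci)|exact: cder_expi].
rewrite ger0_norm ?subr_ge0 // -[leRHS]mul1r.
apply: normc_cint_itv => //; first exact: cintegrable_cont.
by move=> u _; rewrite normcM expi_norm mulr1 /normc /= expr0n /= add0r expr1n sqrtr1.
Qed.

(** The supremum of the left ends of nested intervals lies in all of them. *)
Lemma nested_corner (x : nat -> R) a : (forall n, x n <= x n.+1 <= x n + a / 2 ^+ n.+1) ->
  exists X, forall n, x n <= X <= x n + a / 2 ^+ n.
Proof.
move=> hx.
have up n k : x n <= x (n + k)%N <= x n + a / 2 ^+ n - a / 2 ^+ (n + k).
  elim: k => [|k /andP[h1 h2]]; first by rewrite addn0; lra.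
  have /andP[k1 k2] := hx (n + k)%N; rewrite addnS.
  have e : a / 2 ^+ (n + k).+1 = a / 2 ^+ (n + k) / 2 by rewrite exprS; field; exact: lt0r_neq0 (exprn_gt0 _ _).
  by rewrite e; rewrite e in k2; lra.
have a0 : 0 <= a by have := hx 0%N; rewrite expr1; lra.
have ub n m : x m <= x n + a / 2 ^+ n.
  have p k : 0 <= a / 2 ^+ k by rewrite divr_ge0 // exprn_ge0.
  case: (leqP n m) => nm.
    by have := up n (m - n)%N; rewrite subnKC //; have := p m; lra.
  by have := up m (n - m)%N; rewrite subnKC ?(ltnW nm) //; have := p n; lra.
have hs : has_sup (range x) by split; [exists (x 0%N); exists 0%N|exists (x 0%N + a / 2 ^+ 0) => _ [m _ <-]].
exists (sup (range x)) => n; apply/andP; split; first by apply: (ub_le_sup hs.2); exists n.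
by apply: (sup_le_ub hs.1) => _ [m _ <-].
Qed.

Lemma annulus_contB f p : annulus_cont f -> annulus_cont (fun z => f z - p.[z]).
Proof.
move=> cf z az; have cp := derivable_cvg (@derivable_poly R p z).
exact: (cvgB (F := nbhs z) (FF := nbhs_filter z) (cf z az) cp).
Qed.

Lemma polar_boundary_intB f p x x' y y' : annulus_cont f -> 0 < x -> x <= x' -> x' < 1 ->
  y <= y' -> polar_boundary_int f x x' y y' = polar_boundary_int (fun z => f z - p.[z]) x x' y y'.
Proof.
move=> cf x0 xx x1 yy.
have c0 : annulus_cont (fun=> 0 : R[i]) by move=> z _; exact: (cvg_cst (F := nbhs z) (FF := nbhs_filter z) (0 : R[i])).
have cp : annulus_cont (horner p).
  have := @annulus_contB _ (- p) c0; congr annulus_cont; apply/funext => z.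
  by rewrite hornerN sub0r opprK.
have r t : radial_int (fun z => f z - p.[z]) x x' t =
    radial_int f x x' t - radial_int (horner p) x x' t.
  rewrite /radial_int -(cintB (measurable_itv _) (radial_integrable t cf x0 x1) (radial_integrable t cp x0 x1)).
  by apply: eq_cint => s _; rewrite mulrBl.
have a s : 0 < s < 1 -> arc_int (fun z => f z - p.[z]) s y y' =
    arc_int f s y y' - arc_int (horner p) s y y'.
  move=> s1; rewrite /arc_int -(cintB (measurable_itv _) (cintegrable_cont y y' (arc_cont cf s1))
    (cintegrable_cont y y' (arc_cont cp s1))).
  by apply: eq_cint => t _; rewrite mulrBl.
have := polar_boundary_int_poly p xx yy; rewrite /polar_boundary_int !r a ?a; last 2 first.
- by lra.
- by lra.
by move=> h; rewrite -[LHS]subr0 -h; ring.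
Qed.

Lemma four_pigeons (d : R) (z1 z2 z3 z4 : R[i]) : 4 * d <= normc (z1 + z2 + z3 + z4) ->
  [\/ d <= normc z1, d <= normc z2, d <= normc z3 | d <= normc z4].
Proof.
have := ler_normcD (z1 + z2 + z3) z4; have := ler_normcD (z1 + z2) z3.
have := ler_normcD z1 z2 => h1 h2 h3 h.
case: (leP d (normc z1)) => c1; first by constructor.
case: (leP d (normc z2)) => c2; first by constructor.
case: (leP d (normc z3)) => c3; first by constructor.
constructor; rewrite leNgt; apply/negP => c4; move: h; apply/negP; rewrite -ltNge.
apply: le_lt_trans h3 _; apply: le_lt_trans (lerD h2 (lexx _)) _.
apply: le_lt_trans (lerD (lerD h1 (lexx _)) (lexx _)) _.
have -> : 4 * d = d + d + d + d by ring.
by rewrite !ltrD.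
Qed.

(** Bisection gives nested polar rectangles on which the integral decreases no faster than the
    squares of the sizes, whereas differentiability at the common point makes it
    negligible compared with these squares. *)
Theorem goursat f x x' y y' : (forall z, annulus z -> derivable f z 1) ->
  0 < x -> x <= x' -> x' < 1 -> y <= y' -> polar_boundary_int f x x' y y' = 0.
Proof.
move=> df x0 xx x1 yy.
have cf : annulus_cont f by move=> z /df; exact: derivable_cvg.
pose a := x' - x; pose b := y' - y.
have a0 : 0 <= a by rewrite subr_ge0.
have b0 : 0 <= b by rewrite subr_ge0.
pose rho n (q : R * R) :=
  polar_boundary_int f q.1 (q.1 + a / 2 ^+ n) q.2 (q.2 + b / 2 ^+ n).
pose D := normc (polar_boundary_int f x x' y y').
pose inside n (q : R * R) := x <= q.1 /\ q.1 + a / 2 ^+ n <= x'.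
pose bad n q := inside n q /\ D / 4 ^+ n <= normc (rho n q).
have half c n : c / 2 ^+ n = c / 2 ^+ n.+1 + c / 2 ^+ n.+1 :> R.
  by rewrite exprS; field; exact: lt0r_neq0 (exprn_gt0 _ _).
have an n : 0 <= a / 2 ^+ n by rewrite divr_ge0 // exprn_ge0.
have bn n : 0 <= b / 2 ^+ n by rewrite divr_ge0 // exprn_ge0.
have step nq : exists q' : R * R, bad nq.1 nq.2 -> bad nq.1.+1 q' /\
    (nq.2.1 <= q'.1 <= nq.2.1 + a / 2 ^+ nq.1.+1 /\ nq.2.2 <= q'.2 <= nq.2.2 + b / 2 ^+ nq.1.+1).
  case: nq => n [u v] /=.
  have := an n.+1; have := bn n.+1; have := half a n; have := half b n.
  set an' := a / 2 ^+ n.+1; set bn' := b / 2 ^+ n.+1 => hb ha bn0 an0.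
  case: (pselect (bad n (u, v))) => [[[/= i1 i2] hD]|nb]; last by exists (0, 0).
  have hu : u + a / 2 ^+ n = u + an' + an' by rewrite ha addrA.
  have hv : v + b / 2 ^+ n = v + bn' + bn' by rewrite hb addrA.
  rewrite hu in i2.
  have uv : 0 < u by apply: lt_le_trans i1.
  have e1 : u <= u + an' <= u + an' + an' by rewrite !lerDl an0.
  have e2 : v <= v + bn' <= v + bn' + bn' by rewrite !lerDl bn0.
  have e3 : u + an' + an' < 1 by apply: le_lt_trans i2 x1.
  have spl := polar_boundary_int_split cf uv e1 e3 e2.
  rewrite /rho /= hu hv spl in hD.
  have e4 : D / 4 ^+ n = 4 * (D / 4 ^+ n.+1).
    by rewrite exprS; field; exact: lt0r_neq0 (exprn_gt0 _ _).
  rewrite e4 in hD.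
  have i3 : u + an' <= x' by apply: le_trans i2; rewrite lerDl.
  have i4 : x <= u + an' by apply: le_trans i1 _; rewrite lerDl.
  have b1 : u <= u <= u + an' by rewrite lexx lerDl.
  have b2 : v <= v <= v + bn' by rewrite lexx lerDl.
  have b3 : u <= u + an' <= u + an' by rewrite lexx lerDl an0.
  have b4 : v <= v + bn' <= v + bn' by rewrite lexx lerDl bn0.
  case: (four_pigeons hD) => hc.
  - exists (u, v) => _; exact: (conj (conj (conj i1 i3) hc) (conj b1 b2)).
  - exists (u + an', v) => _; exact: (conj (conj (conj i4 i2) hc) (conj b3 b2)).
  - exists (u, v + bn') => _; exact: (conj (conj (conj i1 i3) hc) (conj b1 b4)).
  - exists (u + an', v + bn') => _; exact: (conj (conj (conj i4 i2) hc) (conj b3 b4)).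
have [next hnext] := choice step.
(* [sq n] is the lower corner of the n-th rectangle, of sides [a / 2 ^+ n] and [b / 2 ^+ n]. *)
pose sq := fix sq n := if n is m.+1 then next (m, sq m) else (x, y).
have bad0 : bad 0%N (x, y).
  split; first by split => /=; rewrite ?expr0 ?divr1 /a; lra.
  rewrite /rho /= !expr0 !divr1 /a /b !(addrC _ (_ - _)) !subrK //.
have badn n : bad n (sq n).
  by elim: n => [//|n IH]; have [] := hnext (n, sq n) IH.
have [X hX] : exists X, forall n, (sq n).1 <= X <= (sq n).1 + a / 2 ^+ n.
  by apply: nested_corner => n; have [_ []] := hnext (n, sq n) (badn n).
have [Y hY] : exists Y, forall n, (sq n).2 <= Y <= (sq n).2 + b / 2 ^+ n.
  by apply: nested_corner => n; have [_ []] := hnext (n, sq n) (badn n).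
have X01 : 0 < X < 1.
  have := hX 0%N; rewrite /= expr0 divr1 /a; lra.
pose P := X%:C * expi Y.
have aP : annulus P by rewrite /annulus /= normc_radial // ltW; case/andP: X01.
have [d hd] := derivable_cincrement (df P aP).
have Dsmall e : 0 < e -> D <= 2 * e * (a + b) ^+ 2.
  move=> e0; have [rh rh0 hr] := hd e e0.
  have half0 : 0 <= (1 / 2 : R) by lra. have half1 : (1 / 2 : R) < 1 by lra.
  have [n hn] := expr_le_eps (a + b) half0 half1 rh0.
  have [[i1 i2] hD] := badn n.
  have := hX n; have := hY n; have := an n; have := bn n.
  move: i1 i2 hD; rewrite /rho; set u := (sq n).1; set v := (sq n).2.
  move: hn; rewrite expr_div_n expr1n => hn.
  have pe : (a + b) * (1 / 2 ^+ n) = a / 2 ^+ n + b / 2 ^+ n by rewrite mul1r mulrDl.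
  rewrite pe in hn.
  set an' := a / 2 ^+ n in hn *; set bn' := b / 2 ^+ n in hn * => i1 i2 hD bn0 an0 hv hu.
  (* The affine approximation of [f] at the common point does not change the integral. *)
  pose p := (f P - d * P)%:P + d *: 'X.
  have pE z : p.[z] = f P + d * (z - P) by rewrite /p hornerD hornerC hornerZ hornerX; move: (f P) => fP; ring.
  have u0 : 0 < u by exact: lt_le_trans x0 i1.
  have uu : u <= u + an' by rewrite lerDl.
  have u1 : u + an' < 1 by exact: le_lt_trans i2 x1.
  have vv : v <= v + bn' by rewrite lerDl.
  have eB := @polar_boundary_intB f p u (u + an') v (v + bn') cf u0 uu u1 vv.
  have cB := @annulus_contB f p cf.
  have := @polar_boundary_int_bound _ u (u + an') v (v + bn') (e * (an' + bn')) cB u0 uu u1 vv.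
  rewrite -eB => bnd.
  have {}bnd : normc (polar_boundary_int f u (u + an') v (v + bn')) <=
     2 * (e * (an' + bn')) * (an' + bn').
    have -> : 2 * (e * (an' + bn')) * (an' + bn') =
      2 * (e * (an' + bn')) * (u + an' - u + (v + bn' - v)) by ring.
    apply: bnd => s t su tv.
    have near : normc (s%:C * expi t - P) <= an' + bn'.
      have -> : s%:C * expi t - P = (s - X)%:C * expi t + X%:C * (expi t - expi Y).
        by rewrite /P rcB; ring.
      apply: le_trans (ler_normcD _ _) _; rewrite !normcM expi_norm mulr1 !normc_real.
      apply: lerD; first by rewrite ler_norml; lra.
      have h1 := normc_expi_sub t Y.
      have h2 : `|t - Y| <= bn' by rewrite ler_norml; lra.
      rewrite -[leRHS]mul1r; apply: ler_pM; rewrite ?normr_ge0 ?normc_ge0 //.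
        by rewrite ger0_norm; lra.
      exact: le_trans h1 h2.
    have := hr (s%:C * expi t) (le_lt_trans near hn).
    rewrite pE opprD addrA => /le_trans; apply; exact: (ler_wpM2l (ltW e0) near).
  have := le_trans hD bnd; rewrite ler_pdivrMr ?exprn_gt0 // => /le_trans; apply.
  have -> : 2 * (e * (an' + bn')) * (an' + bn') * 4 ^+ n = 2 * e * (a + b) ^+ 2; last by [].
  rewrite /an' /bn' -[4]/(2 * 2)%:R natrM exprMn; field; exact: lt0r_neq0 (exprn_gt0 _ _).
apply: eq0_normc; rewrite -/D; apply/eqP; rewrite eq_le normc_ge0 andbT.
apply/ler_addgt0Pl => e e0; rewrite addr0.
have c0 : 0 < 2 * ((a + b) ^+ 2 + 1) by rewrite mulr_gt0 // ltr_wpDl ?sqr_ge0.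
have := Dsmall (e / (2 * ((a + b) ^+ 2 + 1))) (divr_gt0 e0 c0).
move=> /le_trans; apply.
have -> : 2 * (e / (2 * ((a + b) ^+ 2 + 1))) * (a + b) ^+ 2 =
  e * ((a + b) ^+ 2 / ((a + b) ^+ 2 + 1)).
  by field; rewrite gt_eqF // ltr_wpDl ?sqr_ge0.
rewrite -[leRHS]mulr1 ler_pM2l // ler_pdivrMr ?mul1r ?lerDl // ltr_wpDl ?sqr_ge0 //.
Qed.

Corollary circle_integral_const f r1 r2 : (forall z, annulus z -> derivable f z 1) ->
  0 < r1 -> r1 <= r2 -> r2 < 1 -> arc_int f r1 0 (2 * pi) = arc_int f r2 0 (2 * pi).
Proof.
move=> df r0 r12 r21; have := goursat df r0 r12 r21 (ltW (@pi2_gt0 R)).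
rewrite /polar_boundary_int.
have -> : radial_int f r1 r2 (2 * pi) = radial_int f r1 r2 0 by rewrite /radial_int expi2pi expi0.
rewrite -addrA [X in _ + X]addrC => h.
by apply/eqP; rewrite eq_sym -subr_eq0 -h; apply/eqP; ring.
Qed.

End Goursat.

(** * Taylor expansion *)

Section PowerSeries.
Variable R : realType.
Notation A := (@angles R).
Implicit Types (z w : R[i]) (r t : R) (k n : nat).
Variables (f : R[i] -> R[i]) (B : R).
Hypothesis df : forall z, normc z < 1 -> derivable f z 1.
Hypothesis fB : forall z, normc z < 1 -> normc (f z) <= B.

Let B0 : 0 <= B.
Proof. by apply: le_trans (fB (z := 0) _); rewrite ?normc_ge0 // normc0. Qed.

Let u r t := f (r%:C * expi t).

Lemma ccont_radius r : 0 < r < 1 -> ccont (fun t => f (r%:C * expi t)).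
Proof.
move=> /andP[r0 r1]; apply: ccontI => t.
apply: (@cvg_comp _ _ _ (fun s : R => r%:C * expi s) f _ (nbhs (r%:C * expi t))); last first.
  by apply: derivable_cvg; apply: df; rewrite normc_radial // ltW.
by apply: cvgM; [exact: cvg_cst|exact: (ccont_at ccont_expi)].
Qed.

Let cu r : 0 < r < 1 -> ccont (u r).
Proof. exact: ccont_radius. Qed.

Let uB r t : 0 < r < 1 -> normc (u r t) <= B.
Proof. by move=> /andP[r0 r1]; apply: fB; rewrite normc_radial // ltW. Qed.

Let derivable_pow k z : derivable (fun w : R[i] => w ^+ k) z 1.
Proof.
have -> : (fun w : R[i] => w ^+ k) = (fun w => ('X^k : {poly R[i]}).[w]).
  by apply/funext => w; rewrite hornerXn.
exact: derivable_poly.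
Qed.

Let arc_mean (g : R[i] -> R[i]) r (c : R[i]) (v : R -> R[i]) : ccont v ->
  (forall t, g (r%:C * expi t) * (r%:C * ('i%C * expi t)) = c * v t) ->
  arc_int g r 0 (2 * pi) = c * ((2 * pi)%:C * mean v).
Proof.
move=> cv h; rewrite /arc_int.
have -> : (2 * pi)%:C * mean v = cint A v.
  by rewrite meanE mulrA -rcM divff ?rc1 ?mul1r // gt_eqF // pi2_gt0.
rewrite -(cintZ c (@measurable_angles R) (cintegrable_angles cv)).
exact: (eq_cint (fun t _ => h t)).
Qed.

Let pi2_neq0 : (2 * pi)%:C != 0 :> R[i].
Proof. by apply/eqP => -[] /eqP; rewrite gt_eqF // pi2_gt0. Qed.

Let i_neq0 : 'i%C != 0 :> R[i].
Proof. by rewrite eq_complex /= oner_eq0 andbF. Qed.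

(** The integral of [f z / z ^+ k.+1 dz] over a circle does not depend on the radius. *)
Let mean_scaling r1 r2 k : 0 < r1 -> r1 <= r2 -> r2 < 1 ->
  mean (fun t => u r1 t * (expi t)^*%C ^+ k) / r1%:C ^+ k =
  mean (fun t => u r2 t * (expi t)^*%C ^+ k) / r2%:C ^+ k.
Proof.
move=> r10 r12 r21.
have dg z : annulus z -> derivable (fun z => f z * (z ^+ k.+1)^-1) z 1.
  move=> /andP[z0 z1]; apply: (derivableM (df z1)); apply: derivableV; last exact: derivable_pow.
  by rewrite expf_neq0 // -normc_gt0.
have := circle_integral_const dg r10 r12 r21.
have key r : 0 < r < 1 -> arc_int (fun z => f z * (z ^+ k.+1)^-1) r 0 (2 * pi) =
    'i%C / r%:C ^+ k * ((2 * pi)%:C * mean (fun t => u r t * (expi t)^*%C ^+ k)).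
  move=> r01; apply: arc_mean => [|t]; first exact: (ccontM (cu r01) (ccont_cexpiX k)).
  have r0 : r%:C != 0 :> R[i] by apply/eqP => -[] /eqP; rewrite gt_eqF //; case/andP: r01.
  have e0 := expi_neq0 t.
  rewrite conj_expi /u exprVn !exprMn !exprSr.
  have re0 : r%:C ^+ k != 0 by rewrite expf_neq0.
  have ee0 : expi t ^+ k != 0 by rewrite expf_neq0.
  move: (f _) r0 e0 re0 ee0 => F r0 e0; move: (r%:C ^+ k) (expi t ^+ k) => a b a0 b0.
  by field; rewrite r0 e0 a0 b0.
have r101 : 0 < r1 < 1 by rewrite r10 (le_lt_trans r12).
have r201 : 0 < r2 < 1 by rewrite r21 (lt_le_trans r10).
rewrite (key _ r101) (key _ r201).
move: (mean _) (mean _) => m2 m1 h.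
have {}h : 'i%C * (2 * pi)%:C * (m1 / r1%:C ^+ k) = 'i%C * (2 * pi)%:C * (m2 / r2%:C ^+ k).
  have e (a b c d : R[i]) : a / b * (c * d) = a * c * (d / b) by ring.
  have h1 := e 'i%C (r1%:C ^+ k) (2 * pi)%:C m1.
  have h2 := e 'i%C (r2%:C ^+ k) (2 * pi)%:C m2.
  by apply: (eq_trans (esym h1)); apply: (eq_trans h).
by apply: mulfI h; rewrite mulf_neq0.
Qed.

Let normc_scaling (a b : R) k (m1 m2 : R[i]) : 0 <= a -> 0 <= b ->
  'i%C * a%:C ^+ k * ((2 * pi)%:C * m1) = 'i%C * b%:C ^+ k * ((2 * pi)%:C * m2) ->
  a ^+ k * normc m1 = b ^+ k * normc m2.
Proof.
move=> a0 b0 h.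
have {}h : 'i%C * (2 * pi)%:C * (a%:C ^+ k * m1) = 'i%C * (2 * pi)%:C * (b%:C ^+ k * m2).
  have e (x y z t : R[i]) : x * y * (z * t) = x * z * (y * t) by ring.
  by rewrite -e h e.
have ip : 'i%C * (2 * pi)%:C != 0 :> R[i] by rewrite mulf_neq0.
have /(congr1 (@normc R)) := mulfI ip h.
by rewrite !normcM !normcX !normc_real !ger0_norm.
Qed.

(** The integral of [f z * z ^+ k dz] over a circle does not depend on the radius, and tends to 0
    with it. *)
Let mean_neg r k : 0 < r < 1 -> mean (fun t => u r t * expi t ^+ k.+1) = 0.
Proof.
move=> r01; have /andP[r0 r1] := r01.
have dg z : annulus z -> derivable (fun z => f z * z ^+ k) z 1.
  by move=> /andP[z0 z1]; apply: (derivableM (df z1)); exact: derivable_pow.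
have key s : 0 < s < 1 -> arc_int (fun z => f z * z ^+ k) s 0 (2 * pi) =
    'i%C * s%:C ^+ k.+1 * ((2 * pi)%:C * mean (fun t => u s t * expi t ^+ k.+1)).
  move=> s01; apply: arc_mean => [|t]; first exact: (ccontM (cu s01) (ccont_expiX k.+1)).
  by rewrite /u exprMn !exprSr; move: (f _) => F; ring.
have bnd s : 0 < s < 1 -> normc (mean (fun t => u s t * expi t ^+ k.+1)) <= B.
  move=> s01; apply: mean_bound => [|t _].
    exact: (cintegrable_angles (ccontM (cu s01) (ccont_expiX k.+1))).
  by rewrite normcM normc_expiX mulr1 uB.
apply: normc_small_eq0 => e e0.
have [n hn] := expr_le_eps B (ltW r0) r1 (mulr_gt0 e0 (exprn_gt0 k.+1 r0)).
have s01 : 0 < r ^+ n.+1 < 1 by rewrite exprn_gt0 //= exprn_ilt1 // ltW.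
have sr : r ^+ n.+1 <= r by rewrite exprS ler_piMr ?exprn_ile1 // ltW.
have /andP[s0 s1] := s01.
have := circle_integral_const dg s0 sr r1; rewrite (key _ r01) (key _ s01) => h.
have {}h := normc_scaling (ltW s0) (ltW r0) h.
rewrite -(ler_pM2l (exprn_gt0 k.+1 r0)) -h.
have q : (r ^+ n.+1) ^+ k.+1 <= r ^+ n.
  rewrite -exprM; apply: ler_wiXn2l; [exact: ltW|exact: ltW|].
  by rewrite mulnS (leq_trans (leqnSn n)) // leq_addr.
apply: (@le_trans _ _ (r ^+ n * B)).
  apply: ler_pM q (bnd _ s01); last exact: normc_ge0.
  by rewrite !exprn_ge0 // ltW.
by rewrite mulrC [leRHS]mulrC ltW.
Qed.

(** The radius [1 / 2] is arbitrary, see [taylor_coefE]. *)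
Definition taylor_coef k := mean (fun t => u (1 / 2) t * (expi t)^*%C ^+ k) / (1 / 2)%:C ^+ k.

Let half01 : 0 < (1 / 2 : R) < 1.
Proof. by lra. Qed.

Lemma taylor_coefE r k : 0 < r < 1 ->
  taylor_coef k * r%:C ^+ k = mean (fun t => f (r%:C * expi t) * (expi t)^*%C ^+ k).
Proof.
move=> r01; have /andP[r0 r1] := r01.
have r0' : r%:C != 0 :> R[i] by apply/eqP => -[] /eqP; rewrite gt_eqF.
have -> : taylor_coef k = mean (fun t => u r t * (expi t)^*%C ^+ k) / r%:C ^+ k.
  have /andP[h0 h1] := half01; rewrite /taylor_coef.
  by case: (leP r (1 / 2)) => [rh|/ltW rh]; [apply/esym|]; exact: mean_scaling.
by rewrite divfK // expf_neq0.
Qed.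

Lemma taylor_coef_bound_at r k C : 0 < r < 1 ->
  (forall t, normc (f (r%:C * expi t)) <= C) -> normc (taylor_coef k) * r ^+ k <= C.
Proof.
move=> r01 fC; have /andP[r0 r1] := r01.
have -> : normc (taylor_coef k) * r ^+ k = normc (taylor_coef k * r%:C ^+ k).
  by rewrite (normcM (taylor_coef k)) normcX normc_real ger0_norm // ltW.
rewrite taylor_coefE //; apply: mean_bound => [|t _].
  exact: (cintegrable_angles (ccontM (cu r01) (ccont_cexpiX k))).
by rewrite normcM normc_cexpiX mulr1 fC.
Qed.

(** Let the radius tend to 1 in [taylor_coef_bound_at]. *)
Lemma taylor_coef_bound k : normc (taylor_coef k) <= B.
Proof.
have h r : 0 < r < 1 -> normc (taylor_coef k) * r ^+ k <= B.
  by move=> r01; apply: taylor_coef_bound_at => // t; exact: uB.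
have c : (normc (taylor_coef k) * r ^+ k)%:C @[r --> (1 : R)^'-] --> (normc (taylor_coef k) * 1 ^+ k)%:C.
  apply: cvg_at_left_filter.
  have cc : ccont (fun r : R => (normc (taylor_coef k))%:C * r%:C ^+ k).
    exact: (ccontM (ccont_cst _) (ccontX (n := k) (ccontI (@cvg_real_complex R)))).
  have := ccont_at (t := 1) cc; under eq_fun do rewrite -rcX -rcM.
  by rewrite -rcX -rcM.
have := @cvgc_le R _ _ _ _ _ 0 B c; rewrite subr0 expr1n mulr1 normc_real ger0_norm ?normc_ge0 //.
apply; near=> r; rewrite subr0 normc_real.
have r01 : 0 < r < 1.
  apply/andP; split; near: r; [exact: nbhs_left_gt|exact: nbhs_left_lt].
rewrite ger0_norm; first exact: h.
by rewrite mulr_ge0 ?normc_ge0 // exprn_ge0 // ltW; case/andP: r01.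
Unshelve. all: by end_near. Qed.

Lemma geo_tail r n N : 0 <= r < 1 -> \sum_(n <= k < N) r ^+ k <= r ^+ n / (1 - r).
Proof.
move=> /andP[r0 r1]; have r2 : 0 < 1 - r by rewrite subr_gt0.
have [nN|Nn] := leqP n N; last first.
  by rewrite big_geq ?(ltnW Nn) // divr_ge0 ?exprn_ge0 // ltW.
rewrite -(subnKC nN); elim: (N - n)%N => [|m IH].
  by rewrite addn0 big_geq // divr_ge0 ?exprn_ge0 // ltW.
have e m' : \sum_(n <= k < n + m') r ^+ k = r ^+ n / (1 - r) - r ^+ (n + m') / (1 - r).
  elim: m' => [|m' IH']; first by rewrite addn0 big_geq // subrr.
  rewrite addnS big_nat_recr ?leq_addr //= IH' exprS; field; exact: lt0r_neq0.
by rewrite e gerBl divr_ge0 ?exprn_ge0 // ltW.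
Qed.

(** The Fourier coefficients of negative index of [f] on a circle vanish, so that its Poisson
    integral inside this circle is the sum of the power series. The value at [z] itself is the limit of
    the Poisson integrals at [rho * z] when [rho] tends to 1. *)
Theorem taylor_remainder z n : 0 < normc z < 1 ->
  normc (f z - \sum_(k < n) taylor_coef k * z ^+ k) <= B * normc z ^+ n / (1 - normc z).
Proof.
move=> z01; have /andP[z0 z1] := z01; set r := normc z in z01 z0 z1 *.
have zc : unit_circle (z / r%:C).
  apply/circleP; rewrite normcM normcV normc_real ger0_norm ?(ltW z0) //.
  by rewrite mulfV // gt_eqF.
have [th _ zE] := circle_expi zc.
have r0' : r%:C != 0 :> R[i] by apply/eqP => -[] /eqP; rewrite gt_eqF.
have {}zE : z = r%:C * expi th by rewrite -zE mulrC divfK.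
have cur := cu z01.
have bnd t := @uB r t z01.
have per s t : expi s = expi t -> u r s = u r t by rewrite /u => ->.
pose Q (rho : R) := \sum_(k < n) taylor_coef k * z ^+ k * rho%:C ^+ k.
have PI rho : 0 <= rho < 1 ->
   normc (mean (fun t => u r t * (poisson_ker (rho%:C * expi th) t)%:C) - Q rho) <=
     B * r ^+ n / (1 - r).
  move=> rho01; have /andP[h0 h1] := rho01; set w := rho%:C * expi th.
  have wn : normc w = rho by exact: normc_radial.
  have w1 : normc w < 1 by rewrite wn.
  have cK := ccont_cauchy_ker w1.
  have ccu := ccont_conj cur.
  have bndc t : normc ((u r t)^*%C) <= B by rewrite normc_conj.
  have m0 : mean (fun t => u r t * (cauchy_ker w t)^*%C) = mean (u r).
    apply/eqP; rewrite -subr_eq0; apply/eqP; apply: normc_small_eq0 => e e0.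
    have e1 : 0 < e * (1 - rho) by rewrite mulr_gt0 // subr_gt0.
    have [N hN] := expr_le_eps B h0 h1 e1.
    have := poisson_trig_approx N.+1 w1 ccu bndc.
    have -> : \sum_(k < N.+1) mean (fun t => (u r t)^*%C * (expi t)^*%C ^+ k) * w ^+ k =
        (mean (u r))^*%C.
      rewrite big_ord_recl big1 ?addr0 => [|k _].
        rewrite expr0 mulr1 -(mean_conj (cintegrable_angles cur)).
        by apply: eq_mean => t _; rewrite expr0 mulr1.
      have -> : mean (fun t => (u r t)^*%C * (expi t)^*%C ^+ lift ord0 k) = 0.
        rewrite -[RHS]conjc0 -(mean_neg k z01).
        rewrite -(mean_conj (cintegrable_angles (ccontM cur (ccont_expiX k.+1)))).
        by apply: eq_mean => t _; rewrite conjM conjX.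
      by rewrite mul0r.
    have -> : mean (fun t => (u r t)^*%C * cauchy_ker w t) =
        (mean (fun t => u r t * (cauchy_ker w t)^*%C))^*%C.
      rewrite -(mean_conj (cintegrable_angles (ccontM cur (ccont_conj cK)))).
      by apply: eq_mean => t _; rewrite conjM conjcK.
    rewrite -conjB normc_conj wn => /le_trans; apply.
    rewrite ler_pdivrMr ?subr_gt0 //; apply: le_trans (ltW hN).
    by rewrite ler_wpM2l // exprS ler_piMl ?exprn_ge0 // ltW.
  rewrite (mean_poisson_split w1 cur) m0 addrK.
  apply/ler_addgt0Pr => e e0.
  have e1 : 0 < e * (1 - rho) by rewrite mulr_gt0 // subr_gt0.
  have [N hN] := expr_le_eps B h0 h1 e1.
  have a1 := poisson_trig_approx (n + N) w1 cur bnd.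
  pose term k := taylor_coef k * z ^+ k * rho%:C ^+ k.
  have tE k : mean (fun t => u r t * (expi t)^*%C ^+ k) * w ^+ k = term k.
    have -> : mean (fun t => u r t * (expi t)^*%C ^+ k) = taylor_coef k * r%:C ^+ k.
      by rewrite (taylor_coefE k z01).
    by rewrite /term /w zE !exprMn; ring.
  have sE : \sum_(k < n + N) mean (fun t => u r t * (expi t)^*%C ^+ k) * w ^+ k =
     Q rho + \sum_(n <= k < n + N) term k.
    have -> : \sum_(k < n + N) mean (fun t => u r t * (expi t)^*%C ^+ k) * w ^+ k =
      \sum_(k < n + N) term k by apply: eq_bigr => k _; exact: tE.
    rewrite /Q -!(big_mkord predT term) -(big_cat_nat (leq0n n) (leq_addr N n)) //.
  rewrite sE opprD addrA in a1.
  have a2 : normc (\sum_(n <= k < n + N) term k) <= B * r ^+ n / (1 - r).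
    apply: (@le_trans _ _ (\sum_(n <= k < n + N) B * r ^+ k)).
      elim/big_ind2: _ => [|x1 x2 y1 y2 k1 k2|k _]; first by rewrite normc0.
        by apply: le_trans (ler_normcD _ _) _; exact: lerD.
      rewrite /term (normcM (_ * _)) (normcM (taylor_coef k)) !normcX -/r normc_real ger0_norm //.
      rewrite -[leRHS]mulr1 ler_pM ?mulr_ge0 ?exprn_ge0 ?normc_ge0 ?exprn_ile1 ?(ltW z0) ?(ltW h1) //.
      by rewrite ler_wpM2r ?exprn_ge0 ?(ltW z0) // taylor_coef_bound.
    by rewrite -mulr_sumr -mulrA ler_wpM2l // geo_tail // z1 ltW.
  have := normc_triangle (\sum_(n <= k < n + N) term k) (mean (fun t => u r t * cauchy_ker w t) - Q rho) 0.
  rewrite !subr0 => /le_trans; apply; rewrite addrC; apply: lerD => //.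
  apply: le_trans a1 _; rewrite wn ler_pdivrMr ?subr_gt0 //; apply: le_trans (ltW hN).
  by rewrite ler_wpM2l // exprD ler_piMl ?exprn_ge0 ?exprn_ile1 // ltW.
have cQ : Q rho @[rho --> (1 : R)^'-] --> Q 1.
  apply: cvg_at_left_filter.
  have cc : ccont Q.
    apply: (ccont_sum (u := fun k (rho : R) => taylor_coef k * z ^+ k * rho%:C ^+ k)) => k.
    exact: (ccontM (ccont_cst _) (ccontX (n := k) (ccontI (@cvg_real_complex R)))).
  exact: (ccont_at (t := 1) cc).
have cP : mean (fun t => u r t * (poisson_ker (rho%:C * expi th) t)%:C) @[rho --> (1 : R)^'-] --> u r th.
  apply/cvgcP => e e0; have e2 : 0 < e / 4 by rewrite divr_gt0.
  have [C C0 hC] := circle_modulus cur per e2.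
  have C1 : 0 < 8 * (C + 1) by rewrite mulr_gt0 // ltr_wpDl.
  have lt1 : 1 - e / (8 * (C + 1)) < 1 by rewrite ltrBlDr ltrDl; exact: divr_gt0.
  near=> rho.
  have h1 : rho < 1 by near: rho; exact: nbhs_left_lt.
  have h0 : 0 < rho by near: rho; exact: nbhs_left_gt.
  have h2 : 1 - e / (8 * (C + 1)) < rho by near: rho; exact: nbhs_left_gt.
  have rho01 : 0 <= rho < 1 by rewrite h1 ltW.
  apply: le_lt_trans (poisson_korovkin rho01 cur (fun t => hC t th)) _.
  move: h2; rewrite ltrBlDr -ltrBlDl ltr_pdivlMr // => h2.
  have d0 : 0 <= 1 - rho by rewrite subr_ge0 ltW.
  by lra.
have eQ : Q 1 = \sum_(k < n) taylor_coef k * z ^+ k.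
  by apply: eq_bigr => k _; rewrite rc1 expr1n mulr1.
have eu : u r th = f z by rewrite /u zE.
have cD : mean (fun t => u r t * (poisson_ker (rho%:C * expi th) t)%:C) - Q rho
    @[rho --> (1 : R)^'-] --> f z - \sum_(k < n) taylor_coef k * z ^+ k.
  by rewrite -eu -eQ; exact: cvgB cP cQ.
rewrite -[X in normc X]subr0; apply: (cvgc_le cD).
near=> rho; rewrite subr0; apply: PI.
by apply/andP; split; [apply: ltW|]; near: rho; [exact: nbhs_left_gt|exact: nbhs_left_lt].
Unshelve. all: by end_near. Qed.

End PowerSeries.

(** * Cutoff polynomials *)

Section Cutoff.
Variable R : realType.
Notation A := (@angles R).
Implicit Types (z : R[i]) (r t : R) (k n m : nat).

Lemma Re_meanE (u : R -> R[i]) :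
  complex.Re (mean u) = complex.Re (mean (fun t => (complex.Re (u t))%:C)).
Proof. by rewrite mean_real meanE cReM /= mul0r subr0 cint_ReE. Qed.

Lemma Re_rcM (a : R) z : complex.Re (a%:C * z) = a * complex.Re z.
Proof. by rewrite cReM /= mul0r subr0. Qed.

Section Herglotz.
Variables (w : R -> R).
Hypothesis cw : continuous w.
Hypothesis w0 : forall t, 0 <= w t.

Let cwc : ccont (fun t => (w t)%:C). Proof. exact: ccont_real. Qed.

(** The analytic function in the disc, real at 0, whose real part is the Poisson integral of [w]. *)
Definition herglotz z := mean (fun t => (w t)%:C * (2 * cauchy_ker z t - 1)).

Let cker z : normc z < 1 -> ccont (fun t => 2 * cauchy_ker z t - 1).
Proof.
move=> z1; exact: (ccontB (ccontM (ccont_cst (2 : R[i])) (ccont_cauchy_ker z1)) (ccont_cst (1 : R[i]))).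
Qed.

Lemma Re_herglotz z : normc z < 1 ->
  complex.Re (herglotz z) = complex.Re (mean (fun t => (w t)%:C * (poisson_ker z t)%:C)).
Proof.
move=> z1; rewrite [LHS]Re_meanE; congr (complex.Re _); apply: eq_mean => t _.
rewrite -rcM; suff -> : complex.Re ((w t)%:C * (2 * cauchy_ker z t - 1)) = w t * poisson_ker z t by [].
rewrite cReM /= mul0r subr0; congr (_ * _).
have /(congr1 (@complex.Re R)) := poisson_kerE t z1; rewrite /= => ->.
by rewrite !(cReD, cReN, cReM) /=; case: (cauchy_ker z t) => a b; rewrite /conjc /=; ring.
Qed.

Lemma Re_herglotz_ge0 z : normc z < 1 -> 0 <= complex.Re (herglotz z).
Proof.
move=> z1; rewrite Re_herglotz //.
have -> : 0 = complex.Re (mean (fun=> 0 : R[i])) by rewrite mean_cst.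
apply: Re_mean_le; [exact: ccont_cst|exact: (ccontM cwc (ccont_poisson_ker z1))|].
by move=> t _; rewrite normc0 -rcM /= mulr_ge0 // poisson_ker_ge0.
Qed.

Lemma herglotz_bound z : normc z <= 1 / 2 ->
  normc (herglotz z) <= 3 * complex.Re (mean (fun t => (w t)%:C)).
Proof.
move=> z2; have z1 : normc z < 1 by lra.
have c3 : ccont (fun t => 3%:C * (w t)%:C) by exact: (ccontM (ccont_cst (3%:C : R[i])) cwc).
have e3 : 3 * complex.Re (mean (fun t => (w t)%:C)) = complex.Re (mean (fun t => 3%:C * (w t)%:C)).
  by rewrite (meanZ _ (cintegrable_angles cwc)) (Re_rcM 3).
rewrite e3; apply: normc_mean_le.
- exact: (cintegrable_angles (ccontM cwc (cker z1))).
- exact: (cintegrable_angles c3).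
- move=> t _; rewrite -rcM /= normcM normc_real ger0_norm // mulrC.
  apply: ler_wpM2r => //.
  have d0 := cauchy_den_neq0 t z1.
  have -> : 2 * cauchy_ker z t - 1 = cauchy_ker z t * (1 + z * (expi t)^*%C).
    rewrite /cauchy_ker; move: d0; set v := z * _ => d0; by field.
  rewrite normcM.
  have h1 : normc (cauchy_ker z t) <= 2.
    apply: le_trans (cauchy_ker_bound t z1) _.
    by rewrite -[leRHS]invrK lef_pV2 ?posrE ?invr_gt0 // ?subr_gt0 //; lra.
  have h2 : normc (1 + z * (expi t)^*%C) <= 3 / 2.
    by apply: le_trans (ler_normcD _ _) _; rewrite normc1 normc_mul_expi; lra.
  have -> : 3 = 2 * (3 / 2) :> R by field.
  by apply: ler_pM; rewrite ?normc_ge0.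
Qed.

Lemma near_disc z : normc z < 1 -> \forall x \near z, normc x < 1.
Proof.
move=> z1; have z2 : 0 < 1 - normc z by rewrite subr_gt0.
have := (@cvgcP R _ (nbhs z) (nbhs_filter z) (fun x => x) z).1 (fun U hU => hU) _ z2.
apply: filterS => x hx.
by have := ler_normcD (x - z) z; rewrite subrK; move: hx; lra.
Qed.

Lemma derivable_herglotz z : (exists B, forall t, w t <= B) -> normc z < 1 ->
  derivable herglotz z 1.
Proof.
move=> [B wB] z1; have near1 := near_disc z1.
have mw := cmeasurable_cont (@measurable_angles R) cwc.
have wB' t : normc ((w t)%:C : R[i]) <= B by rewrite normc_real ger0_norm.
have dc := derivable_cauchy_int mw wB' z1.
have e x : normc x < 1 -> herglotz x = 2 * cauchy_int (fun t => (w t)%:C) x - mean (fun t => (w t)%:C).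
  move=> x1; have ck := ccontM cwc (ccont_cauchy_ker x1).
  rewrite /cauchy_int -(meanZ _ (cintegrable_angles ck)).
  rewrite -(meanB (cintegrable_angles (ccontM (ccont_cst (2 : R[i])) ck)) (cintegrable_angles cwc)).
  by apply: eq_mean => t _; ring.
have d2 : derivable (fun=> 2 : R[i]) z 1 by exact: derivable_cst.
have d3 : derivable (fun=> mean (fun t => (w t)%:C)) z 1 by exact: derivable_cst.
have dd := derivableB (derivableM d2 dc) d3.
exact: (near_eq_derivable (filterS (fun x hx => esym (e x hx)) near1) dd).
Qed.

End Herglotz.


Lemma normc_half : normc (1 / 2 : R[i]) = 1 / 2.
Proof.
have n2 : normc (2 : R[i]) = 2 by rewrite -rc_nat normc_real ger0_norm.
by rewrite normcM normcV normc1 n2.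
Qed.

(** The inverse of [1 + a] maps the right half-plane into the disc of diameter [0, 1]. *)
Lemma normc_inv1D_half (a : R[i]) : 0 <= complex.Re a ->
  normc ((1 + a)^-1 - 1 / 2) <= 1 / 2 /\ normc (1 - (1 + a)^-1) <= normc a.
Proof.
move=> a0.
have Re1 : 1 + complex.Re a = complex.Re (1 + a) by rewrite cReD.
have n1 : 1 <= normc (1 + a).
  apply: le_trans (Re_le_normc _); rewrite -Re1 ger0_norm; last by rewrite addr_ge0.
  by rewrite lerDl.
have d0 : 1 + a != 0 by rewrite -normc_gt0 (lt_le_trans ltr01).
have n0 : 0 < normc (1 + a) by rewrite normc_gt0.
split.
  have -> : (1 + a)^-1 - 1 / 2 = (1 - a) * ((1 + a)^-1 * (1 / 2)) by field; rewrite d0.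
  rewrite (normcM (1 - a)) (normcM (1 + a)^-1) normcV normc_half mulrA ler_piMl // ler_pdivrMr // mul1r.
  rewrite -(@ler_pXn2r _ 2) ?nnegrE ?normc_ge0 // !normc_sqr !cReD !cImD cReN cImN /=.
  move: a0; move: (complex.Re a) (complex.Im a) => x y; nra.
have -> : 1 - (1 + a)^-1 = a / (1 + a) by field.
by rewrite normcM normcV ler_pdivrMr // ler_peMr ?normc_ge0.
Qed.

(** With [w] proportional to [|D|], the function [1 / (1 + herglotz w)] has values in the disc of
    diameter [0, 1]. Near the unit circle it is at most [1 / w], since [Re (herglotz w)] is almost [w]
    there. It is close to 1 near 0, because [herglotz w] is bounded there by the mean of [w]; so the first
    coefficients of [1 - 1 / (1 + herglotz w)] are small. The polynomial is a Taylor polynomial of this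
    function, on a circle slightly smaller than the unit circle, shrunk towards [1 / 2] to absorb
    the error. *)
Lemma cutoff_poly (D : R -> R[i]) (eta kap : R) m : ccont D ->
  (forall s t, expi s = expi t -> D s = D t) -> 0 < eta -> 0 < kap ->
  complex.Re (mean (fun t => (normc (D t))%:C)) <= eta * kap / (12 * 2 ^+ m) ->
  exists phi : {poly R[i]},
   [/\ forall t, normc (phi.[expi t] - 1 / 2) <= 1 / 2,
       forall t, normc (D t * (1 - phi.[expi t])) <= eta &
       forall k, (k < m)%N -> normc phi`_k <= kap].
Proof.
move=> cD perD eta0 kap0 small.
have [B DB] := ccont_per_bounded cD perD.
have B0 : 0 <= B by apply: le_trans (DB 0); exact: normc_ge0.
(* A bound by 1 on [w * |1 - phi|] is a bound by [eta / 2] on [|D * (1 - phi)|]. *)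
pose w t := 2 / eta * normc (D t).
have e20 : 0 < 2 / eta by rewrite divr_gt0.
have cnD := ccont_normc cD.
have cw : continuous w by move=> t; apply: cvgM; [exact: cvg_cst|exact: cnD].
have w0 t : 0 <= w t by rewrite mulr_ge0 ?normc_ge0 ?(ltW e20).
have cwc : ccont (fun t => (w t)%:C) by exact: ccont_real.
have wB : exists B, forall t, w t <= B.
  by exists (2 / eta * B) => t; rewrite ler_wpM2l // ltW.
pose om := complex.Re (mean (fun t => (w t)%:C)).
have omE : 3 * om * 2 ^+ m <= kap / 2.
  have -> : om = 2 / eta * complex.Re (mean (fun t => (normc (D t))%:C)).
    rewrite -Re_rcM -(meanZ _ (cintegrable_angles (ccont_real cnD))); congr (complex.Re _).
    by apply: eq_mean => t _; rewrite -rcM.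
  move: small; move: (complex.Re _) => d; have p2 : 0 < 2 ^+ m :> R by exact: exprn_gt0.
  rewrite ler_pdivlMr ?mulr_gt0 // => small.
  have -> : 3 * (2 / eta * d) * 2 ^+ m = (d * (12 * 2 ^+ m)) / (2 * eta).
    by field; exact: lt0r_neq0.
  rewrite ler_pdivrMr ?mulr_gt0 //; apply: le_trans small _.
  by have -> : kap / 2 * (2 * eta) = eta * kap by field.
have om0 : 0 <= om.
  have := Re_mean_le (ccont_cst (0 : R[i])) cwc; rewrite mean_cst; apply=> t _.
  by rewrite normc0; exact: w0.
pose g z := 1 - (1 + herglotz w z)^-1.
have Re0 z (z1 : normc z < 1) : 0 <= complex.Re (herglotz w z) by exact: Re_herglotz_ge0.
have den z : normc z < 1 -> 1 + herglotz w z != 0.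
  move=> z1; apply/eqP => /(congr1 (@complex.Re R)); rewrite cReD /=.
  by move: (Re0 z z1); lra.
have gdisc z : normc z < 1 -> normc (g z - 1 / 2) <= 1 / 2.
  move=> z1; rewrite normcBC.
  have -> : 1 / 2 - g z = (1 + herglotz w z)^-1 - 1 / 2.
    by rewrite /g; move: ((1 + herglotz w z)^-1) => v; field.
  exact: (normc_inv1D_half (Re0 z z1)).1.
have g1 z : normc z < 1 -> normc (g z) <= 1.
  move=> /gdisc h; have := ler_normcD (g z - 1 / 2) (1 / 2); rewrite subrK normc_half; lra.
have dg z : normc z < 1 -> derivable g z 1.
  move=> z1; have d1 : derivable (fun=> 1 : R[i]) z 1 by exact: derivable_cst.
  have d2 := derivableD d1 (derivable_herglotz cw w0 wB z1).
  have d3 := derivableV (den z z1 : (cst (1 : R[i]) + herglotz w) z != 0) d2.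
  have d4 := derivableB d1 d3.
  exact: d4.
pose b := taylor_coef g.
have b_small k : (k < m)%N -> normc (b k) <= kap / 2.
  move=> km; have := @taylor_coef_bound_at _ g dg (1 / 2) k (3 * om).
  have -> : 0 < (1 / 2 : R) < 1 by lra.
  move=> /(_ isT) h.
  have {}h : normc (b k) * (1 / 2) ^+ k <= 3 * om.
    apply: h => t; have r2 : normc ((1 / 2 : R)%:C * expi t) = 1 / 2.
      by rewrite normc_radial // divr_ge0.
    have z1 : normc ((1 / 2 : R)%:C * expi t) < 1 by rewrite r2; lra.
    apply: le_trans (normc_inv1D_half (Re0 _ z1)).2 _.
    by apply: herglotz_bound => //; rewrite r2.
  move: h; rewrite mul1r exprVn ler_pdivrMr ?exprn_gt0 // => h.
  apply: le_trans h _; apply: le_trans omE; apply: ler_wpM2l.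
    by rewrite mulr_ge0.
  by apply: ler_weXn2l; [rewrite ler1n|exact: ltnW].
have perw (s t : R) : expi s = expi t -> (w s)%:C = (w t)%:C by move=> /perD h; rewrite /w h.
(* On the circle of radius [rho] the real part of [herglotz w] is at least [w - 1]. *)
have h2 : 0 < (1 / 2 : R) by rewrite divr_gt0.
have [C C0 hC] := circle_modulus cwc perw h2.
pose rho := 1 - (4 * (C + 1))^-1.
have C1 : 0 < 4 * (C + 1) by rewrite mulr_gt0 // ltr_wpDl.
have C4 : 4 * (C + 1) * (4 * (C + 1))^-1 = 1 by rewrite divff // lt0r_neq0.
have iC : 0 < (4 * (C + 1))^-1 by rewrite invr_gt0.
have rho1 : rho < 1 by rewrite /rho; lra.
have rho0 : 0 < rho.
  rewrite /rho; move: C4 iC C0; move: (_^-1) => x; nra.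
have rho01 : 0 <= rho < 1 by rewrite rho1 ltW.
have Dg t : normc (D t * (1 - g (rho%:C * expi t))) <= eta / 2.
  set z := rho%:C * expi t; have z1 : normc z < 1 by rewrite normc_radial // ltW.
  have -> : 1 - g z = (1 + herglotz w z)^-1 by rewrite /g; ring.
  have n1 : w t <= normc (1 + herglotz w z).
    apply: le_trans (Re_le_normc _); apply: le_trans (ler_norm _); rewrite cReD /=.
    rewrite Re_herglotz //.
    have := poisson_korovkin rho01 cwc (fun s => hC s t) => /(le_trans (Re_le_normc _)).
    rewrite cReD cReN [complex.Re (w t)%:C]/= ler_norml -/z => /andP[h _].
    have hr : C * (2 - 2 * rho) <= 1 / 2.
      by move: C4 iC C0; rewrite /rho; move: (_^-1) => x; nra.
    move: h hr; move: (complex.Re (mean _)) (w t) (C * _) => x y q; lra.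
  rewrite normcM normcV ler_pdivrMr ?normc_gt0 ?den //.
  have -> : normc (D t) = eta / 2 * w t by rewrite /w; field; exact: lt0r_neq0.
  by rewrite ler_wpM2l // divr_ge0 // ltW.
(* The error [e] of the Taylor polynomial is doubled by the shrinking. *)
pose e := Num.min (kap / 2) (eta / (4 * (B + 1))).
have B1 : 0 < 4 * (B + 1) by rewrite mulr_gt0 // ltr_wpDl.
have e0 : 0 < e by rewrite lt_min !divr_gt0.
have ek : e <= kap / 2 by rewrite ge_min lexx.
have eB : e * B <= eta / 4.
  have : e <= eta / (4 * (B + 1)) by rewrite ge_min lexx orbT.
  rewrite ler_pdivlMr // => h; move: h e0 B0; nra.
have r1 : 0 < 1 - rho by rewrite subr_gt0.
have [n hn] := expr_le_eps 1 (ltW rho0) rho1 (mulr_gt0 e0 r1).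
pose p := \poly_(k < n) (b k * rho%:C ^+ k).
have pE t : normc (g (rho%:C * expi t) - p.[expi t]) <= e.
  have zr : normc (rho%:C * expi t) = rho by rewrite normc_radial // ltW.
  have := @taylor_remainder _ g 1 dg g1 (rho%:C * expi t) n; rewrite zr rho0 rho1 => /(_ isT).
  have -> : \sum_(k < n) taylor_coef g k * (rho%:C * expi t) ^+ k = p.[expi t].
    by rewrite horner_poly; apply: eq_bigr => k _; rewrite exprMn mulrA.
  by move=> /le_trans; apply; rewrite ler_pdivrMr ?subr_gt0 // ltW.
pose a := (1 + 2 * e)^-1.
have d0 : 0 < 1 + 2 * e by rewrite addr_gt0 ?mulr_gt0.
have a0 : 0 < a by rewrite invr_gt0.
have a1 : a * (1 + 2 * e) = 1 by rewrite mulVf // lt0r_neq0.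
have a1c : a%:C * (1 + 2 * e%:C) = 1 :> R[i].
  by rewrite -rc1 -[2]rc_nat -rcM -rcD -rcM a1.
have al1 : a <= 1 by move: a1 a0 e0; nra.
pose phi := a%:C *: (p + (e%:C)%:P).
have phiE t : phi.[expi t] = a%:C * (p.[expi t] + e%:C) by rewrite hornerZ hornerD hornerC.
exists phi; split.
- move=> t; rewrite phiE.
  set z := rho%:C * expi t; have z1 : normc z < 1 by rewrite normc_radial // ltW.
  have -> : a%:C * (p.[expi t] + e%:C) - 1 / 2 = a%:C * ((g z - 1 / 2) - (g z - p.[expi t])).
    move: (g z) (p.[_]) a1c => G P a1c; apply/eqP; rewrite -subr_eq0.
    have -> : a%:C * (P + e%:C) - 1 / 2 - a%:C * (G - 1 / 2 - (G - P)) =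
      (a%:C * (1 + 2 * e%:C) - 1) / 2 by field.
    by rewrite a1c subrr mul0r.
  rewrite normcM normc_real ger0_norm ?(ltW a0) //.
  have := ler_normcB (g z - 1 / 2) (g z - p.[expi t]).
  have := pE t; have := gdisc z z1; rewrite -/z.
  move: (normc _) (normc _) (normc _) => x y u; move: a0 a1; nra.
- move=> t; rewrite phiE.
  set z := rho%:C * expi t; have z1 : normc z < 1 by rewrite normc_radial // ltW.
  have -> : D t * (1 - a%:C * (p.[expi t] + e%:C)) =
      a%:C * (D t * (1 - g z) + D t * ((g z - p.[expi t]) + e%:C)).
    by rewrite -[X in _ * (X - _) = _]a1c; ring.
  rewrite (normcM a%:C) normc_real ger0_norm ?(ltW a0) //.
  have h1 := ler_normcD (D t * (1 - g z)) (D t * ((g z - p.[expi t]) + e%:C)).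
  have h3 := Dg t.
  have h4 : normc (D t * ((g z - p.[expi t]) + e%:C)) <= B * (2 * e).
    rewrite normcM; apply: ler_pM; rewrite ?normc_ge0 //.
    apply: le_trans (ler_normcD _ _) _; rewrite normc_real ger0_norm ?(ltW e0) //.
    by rewrite mulr2n mulrDl mul1r lerD2r; exact: pE.
  rewrite -/z in h3; apply: (@le_trans _ _ (1 * eta)); last by rewrite mul1r.
  apply: ler_pM => //; [exact: ltW|exact: normc_ge0|].
  by move: h1 h3 h4 eB; move: (normc _) (normc _) (normc _) => x y u; lra.
- move=> k km; rewrite coefZ coefD coefC coef_poly normcM normc_real ger0_norm ?(ltW a0) //.
  have h1 : normc (if (k < n)%N then b k * rho%:C ^+ k else 0) <= kap / 2.
    case: ifP => _; last by rewrite normc0 divr_ge0 // ltW.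
    rewrite (normcM (b k)) normcX normc_real ger0_norm ?(ltW rho0) //.
    apply: le_trans (b_small k km); rewrite ler_piMr ?normc_ge0 // exprn_ile1 ?(ltW rho0) //.
    exact: ltW.
  have h3 : normc (if k == 0 then e%:C else 0 : R[i]) <= kap / 2.
    case: ifP => _; first by rewrite normc_real ger0_norm // ltW.
    by rewrite normc0 divr_ge0 // ltW.
  have := ler_normcD (if (k < n)%N then b k * rho%:C ^+ k else 0) (if k == 0 then e%:C else 0 : R[i]).
  move=> h; apply: (@le_trans _ _ (1 * kap)); last by rewrite mul1r.
  apply: ler_pM => //; [exact: ltW|exact: normc_ge0|].
  apply: le_trans h _; lra.
Qed.

End Cutoff.

(** * From the mean to the supremum *)

Section Averaging.
Variable R : realType.
Notation A := (@angles R).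
Implicit Types (p q phi : {poly R[i]}) (G : R[i] -> R[i]) (t : R) (n N : nat).

(** For values of [a] in the disc of diameter [0, 1], the vector [(1 - a, a)] has norm at most 1, so
    that [|S * (1 - a) + D * a| ^+ 2 <= |S| ^+ 2 + |D| ^+ 2]. *)
Lemma normc_half_disc (a : R[i]) : normc (a - 1 / 2) <= 1 / 2 ->
  normc (1 - a) ^+ 2 + normc a ^+ 2 <= 1.
Proof.
move=> h; have h2 : normc (a - 1 / 2) ^+ 2 <= (1 / 2) ^+ 2.
  by rewrite ler_pXn2r ?nnegrE ?normc_ge0 // divr_ge0.
have {}h2 : normc (a * 2 - 1) ^+ 2 <= 1.
  have -> : a * 2 - 1 = (a - 1 / 2) * 2 by field.
  have n2 : normc (2 : R[i]) = 2 by rewrite -rc_nat normc_real ger0_norm.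
  by rewrite normcM n2; move: h2; move: (normc _) => x; nra.
move: h2; have -> : a * 2 - 1 = a + (a - 1) by ring.
rewrite !normc_sqr !cReD !cImD !cReN !cImN /=.
by move: (complex.Re a) (complex.Im a) => x y; nra.
Qed.

Lemma poly_circle_bounded p : exists2 B : R, 0 <= B & forall t, normc p.[expi t] <= B.
Proof.
have per s t : expi s = expi t -> p.[expi s] = p.[expi t] by move=> ->.
have [B hB] := ccont_per_bounded (ccont_poly p (@ccont_expi R)) per.
by exists B => //; apply: le_trans (hB 0); exact: normc_ge0.
Qed.

Lemma normc_sum_le n (a : nat -> R[i]) (B : R) : (forall k, (k < n)%N -> normc (a k) <= B) ->
  normc (\sum_(k < n) a k) <= n%:R * B.
Proof.
elim: n => [|n IH] h; first by rewrite big_ord0 normc0 mul0r.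
rewrite big_ord_recr /= -natr1 mulrDl mul1r; apply: le_trans (ler_normcD _ _) _.
apply: lerD; last exact: h.
by apply: IH => k kn; apply: h; exact: ltnW.
Qed.

(** For a trigonometric polynomial [u], only the coefficients of low degree of [phi] contribute
    negative frequencies to the product. *)
Lemma near_poly_mul (u : R -> R[i]) (del : R) : ccont u ->
  (forall s t, expi s = expi t -> u s = u t) -> 0 < del ->
  exists m (kap : R), 0 < kap /\ forall phi, (forall t, normc phi.[expi t] <= 1) ->
    (forall k, (k < m)%N -> normc phi`_k <= kap) ->
    exists q, forall t, normc (u t * phi.[expi t] - q.[expi t]) <= del.
Proof.
move=> cu per del0; have del2 : 0 < del / 2 by rewrite divr_gt0.
have [n [p hp]] := trig_approx cu per del2.
have [B B0 hB] := poly_circle_bounded p.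
have d0 : 0 < B * n%:R + 1 by rewrite ltr_wpDl // mulr_ge0.
exists n, (del / 2 / (B * n%:R + 1)); split; first by rewrite divr_gt0.
move=> phi phi1 phik; exists (p * drop_poly n phi) => t.
pose T := (take_poly n phi).[expi t].
have T_small : B * normc T <= del / 2.
  have h : normc T <= n%:R * (del / 2 / (B * n%:R + 1)).
    rewrite /T /take_poly horner_poly; apply: (normc_sum_le (a := fun k => phi`_k * expi t ^+ k)).
    by move=> k kn; rewrite (normcM phi`_k) normc_expiX mulr1 phik.
  apply: le_trans (ler_wpM2l B0 h) _; rewrite !mulrA ler_pdivrMr //.
  rewrite -mulrA; move: (mulr_ge0 B0 (ler0n R n)) del2; move: (B * _) (del / 2) => x y; nra.
have split_phi : phi.[expi t] = T + (drop_poly n phi).[expi t] * expi t ^+ n.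
  by rewrite -[in LHS](poly_take_drop n phi) hornerD hornerM hornerXn.
have e1 : (expi t)^*%C ^+ n * expi t ^+ n = 1.
  by rewrite -exprMn mulrC mul_expi_conj expr1n.
have -> : u t * phi.[expi t] - (p * drop_poly n phi).[expi t] =
  (u t - (expi t)^*%C ^+ n * p.[expi t]) * phi.[expi t] + (expi t)^*%C ^+ n * (p.[expi t] * T).
  rewrite hornerM split_phi.
  have -> : p.[expi t] * (drop_poly n phi).[expi t] =
    ((expi t)^*%C ^+ n * expi t ^+ n) * (p.[expi t] * (drop_poly n phi).[expi t]).
    by rewrite e1 mul1r.
  by ring.
have -> : del = del / 2 * 1 + 1 * (del / 2) by field.
apply: le_trans (ler_normcD _ _) _; apply: lerD.
  rewrite normcM; apply: ler_pM; rewrite ?normc_ge0 //.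
rewrite (normcM (_ ^+ n)) normc_cexpiX mul1r mul1r (normcM p.[_]).
by apply: le_trans T_small; rewrite ler_wpM2r ?normc_ge0.
Qed.

Section Averages.
Variables (F : nat -> R[i] -> R[i]) (j : nat) (B : R).
Hypothesis cF : forall n, ccont (F n \o expi).
Hypothesis B0 : 0 <= B.
Hypothesis small_mean : forall e : R, 0 < e -> exists G p, [/\ tail_hull F j G,
  forall t, normc (G (expi t) - p.[expi t]) <= B &
  complex.Re (mean (fun t => (normc (G (expi t) - p.[expi t]))%:C)) <= e].

Let cdiff G p : tail_hull F j G -> ccont (fun t => G (expi t) - p.[expi t]).
Proof.
by move=> hG; exact: (ccontB (tail_hull_cont cF hG) (ccont_poly p (@ccont_expi R))).
Qed.

Let perdiff G p (s t : R) : expi s = expi t -> G (expi s) - p.[expi s] = G (expi t) - p.[expi t].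
Proof. by move=> ->. Qed.

(** [G] is an average of [N.+1] elements of the hull, and [S] is the part of their sum that is not
    close to a polynomial; by [normc_half_disc] it grows only like the square root of the number of
    terms. *)
Let average_step (eta : R) N : 0 < eta ->
  exists G (S : R -> R[i]) q, [/\ tail_hull F j G, ccont S,
     forall s t, expi s = expi t -> S s = S t,
     forall t, normc (S t) ^+ 2 <= N.+1%:R * B ^+ 2 &
     forall t, normc (N.+1%:R * G (expi t) - S t - q.[expi t]) <= N%:R * eta].
Proof.
move=> eta0; have eta2 : 0 < eta / 2 by rewrite divr_gt0.
elim: N => [|N [G [S [q [hG cS perS SB GS]]]]].
  have [G [p [hG GB _]]] := small_mean (@ltr01 R).
  exists G, (fun t => G (expi t) - p.[expi t]), p; split=> //.
  - exact: cdiff.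
  - by move=> s t; exact: perdiff.
  - by move=> t; rewrite mul1r ler_pXn2r ?nnegrE ?normc_ge0.
  - by move=> t; rewrite mul1r opprB addrCA subrr addr0 subrr normc0 mul0r.
(* The new term is chosen after [S], as small in the mean as [S] requires. *)
have [m [kap [kap0 hq]]] := near_poly_mul cS perS eta2.
have e0 : 0 < eta / 2 * kap / (12 * 2 ^+ m) by rewrite divr_gt0 ?mulr_gt0 ?exprn_gt0.
have [G' [p [hG' GB small]]] := small_mean e0.
pose D t := G' (expi t) - p.[expi t].
have [phi [phi_half Dphi phik]] := cutoff_poly (cdiff (p := p) hG') (@perdiff G' p) eta2 kap0 small.
have phi2 t := normc_half_disc (phi_half t).
have phi1 t : normc phi.[expi t] <= 1.
  have := phi2 t; have := sqr_ge0 (normc (1 - phi.[expi t])); have := normc_ge0 phi.[expi t].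
  move: (normc _) (normc _) => x y; nra.
have [q' hq'] := hq phi phi1 phik.
have n0 : N.+2%:R != 0 :> R by rewrite pnatr_eq0.
pose l : R := N.+1%:R / N.+2%:R.
have l01 : 0 <= l <= 1 by rewrite divr_ge0 //= ler_pdivrMr ?ltr0n // mul1r ler_nat.
exists (fun z => l%:C * G z + (1 - l)%:C * G' z).
exists (fun t => S t * (1 - phi.[expi t]) + D t * phi.[expi t]), (q + p + q'); split.
- exact: tail_hull_comb.
- have cphi := ccont_poly phi (@ccont_expi R).
  exact: (ccontD (ccontM cS (ccontB (ccont_cst (1 : R[i])) cphi)) (ccontM (cdiff (p := p) hG') cphi)).
- by move=> s t e; rewrite /D (perS _ _ e) e.
- move=> t; have h1 := ler_normcD (S t * (1 - phi.[expi t])) (D t * phi.[expi t]).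
  have {}h1 : normc (S t * (1 - phi.[expi t]) + D t * phi.[expi t]) ^+ 2 <=
    (normc (S t) * normc (1 - phi.[expi t]) + normc (D t) * normc phi.[expi t]) ^+ 2.
    by rewrite ler_pXn2r ?nnegrE ?normc_ge0 ?addr_ge0 ?mulr_ge0 ?normc_ge0 // -!normcM.
  apply: le_trans h1 _; have h2 := phi2 t; have h3 := SB t.
  have h4 : normc (D t) ^+ 2 <= B ^+ 2 by rewrite ler_pXn2r ?nnegrE ?normc_ge0 //; exact: GB.
  rewrite -[N.+2%:R]natr1 mulrDl mul1r; apply: le_trans (lerD h3 h4).
  move: h2 (sqr_ge0 (normc (S t))) (sqr_ge0 (normc (D t))).
  move: (normc (S t)) (normc (1 - _)) (normc (D t)) (normc phi.[_]) => a c b d h2 ha hb.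
  have cs : (a * c + b * d) ^+ 2 <= (a ^+ 2 + b ^+ 2) * (c ^+ 2 + d ^+ 2).
    have -> : (a ^+ 2 + b ^+ 2) * (c ^+ 2 + d ^+ 2) = (a * c + b * d) ^+ 2 + (a * d - b * c) ^+ 2 by ring.
    by rewrite lerDl sqr_ge0.
  by apply: le_trans cs _; rewrite ler_piMr // addr_ge0.
- move=> t.
  have -> : N.+2%:R * (l%:C * G (expi t) + (1 - l)%:C * G' (expi t)) -
      (S t * (1 - phi.[expi t]) + D t * phi.[expi t]) - (q + p + q').[expi t] =
    (N.+1%:R * G (expi t) - S t - q.[expi t]) +
    (D t * (1 - phi.[expi t]) + (S t * phi.[expi t] - q'.[expi t])).
    have l1 : N.+2%:R * l%:C = N.+1%:R :> R[i] by rewrite -!rc_nat -rcM /l mulrC divfK.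
    have l2 : N.+2%:R * (1 - l)%:C = 1 :> R[i].
      by rewrite rcB rc1 mulrBr l1 mulr1 -natrB // subSnn.
    by rewrite mulrDr !mulrA l1 l2 !hornerD /D; ring.
  have -> : N.+1%:R * eta = N%:R * eta + eta by rewrite -natr1 mulrDl mul1r.
  apply: le_trans (ler_normcD _ _) _.
  apply: lerD; first exact: GS.
  apply: le_trans (ler_normcD _ _) _.
  have -> : eta = eta / 2 + eta / 2 by field.
  by apply: lerD; [exact: Dphi|exact: hq'].
Qed.

(** By [average_step], the distance to a polynomial is at most [B / sqrt N + e / 2] for an average
    of [N] elements. *)
Theorem tail_hull_near_poly (e : R) : 0 < e ->
  exists G p, tail_hull F j G /\ forall t, normc (G (expi t) - p.[expi t]) <= e.
Proof.
move=> e0; have e2 : 0 < e / 2 by rewrite divr_gt0.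
(* For this number of terms [B / sqrt N] is at most [e / 2]. *)
pose N := Num.bound (4 * B ^+ 2 / e ^+ 2).
have hN : 4 * B ^+ 2 / e ^+ 2 <= N.+1%:R.
  apply: ltW; apply: lt_le_trans (archi_boundP _) _; last by rewrite ler_nat leqnSn.
  have b2 := sqr_ge0 B; rewrite divr_ge0 ?sqr_ge0 ?mulr_ge0 //.
have [G [S [q [hG _ _ SB GS]]]] := average_step N e2.
have n0 : 0 < N.+1%:R :> R by rewrite ltr0n.
have n0c : N.+1%:R != 0 :> R[i] by rewrite pnatr_eq0.
exists G, ((N.+1%:R : R)^-1%:C *: q); split=> // t; rewrite hornerZ.
have St : normc (S t) <= N.+1%:R * (e / 2).
  rewrite -(@ler_pXn2r _ 2) ?nnegrE ?normc_ge0 //; last by rewrite mulr_ge0 // ltW.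
  apply: le_trans (SB t) _; move: hN n0; rewrite ler_pdivrMr ?exprn_gt0 //.
  move: (B ^+ 2) (N.+1%:R : R) => b n h n0.
  have -> : (n * (e / 2)) ^+ 2 = n * (n * e ^+ 2 / 4) by field.
  by rewrite ler_pM2l // ler_pdivlMr // mulrC.
have ne : normc (N.+1%:R * (G (expi t) - (N.+1%:R : R)^-1%:C * q.[expi t])) =
  N.+1%:R * normc (G (expi t) - (N.+1%:R : R)^-1%:C * q.[expi t]).
  by rewrite (normcM N.+1%:R) -rc_nat normc_real ger0_norm.
rewrite -(ler_pM2l n0) -ne.
have -> : N.+1%:R * (G (expi t) - (N.+1%:R : R)^-1%:C * q.[expi t]) =
  (N.+1%:R * G (expi t) - S t - q.[expi t]) + S t.
  have h : N.+1%:R * (N.+1%:R : R)^-1%:C = 1 :> R[i].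
    by rewrite -rc_nat -rcM divff ?rc1 // lt0r_neq0.
  by rewrite mulrBr mulrA h; ring.
apply: le_trans (ler_normcD _ _) _; have -> : N.+1%:R * e = N.+1%:R * (e / 2) + N.+1%:R * (e / 2) by field.
apply: lerD => //; apply: le_trans (GS t) _.
by rewrite ler_wpM2r ?(ltW e2) // ler_nat.
Qed.

End Averages.
End Averaging.

(** * Measurability of the boundary function *)

Section BoundaryFunction.
Variable R : realType.
Notation mu := (@lebesgue_measure R).
Notation A := (@angles R).
Implicit Types (z : R[i]) (r s t : R) (m n : nat).

(** A bound on the oscillation at the left of 1, with a discrete radius. *)
Definition radial_osc (u : R -> R[i]) m (e : R) := forall r s,
  1 - m.+1%:R^-1 < r < 1 -> 1 - m.+1%:R^-1 < s < 1 -> normc (u r - u s) <= e.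

Lemma exists_invS_lt (e : R) : 0 < e -> exists n, n.+1%:R^-1 < e.
Proof.
move=> e0; have [N _ hN] := near_infty_natSinv_lt (PosNum e0).
by exists N; exact: hN (leqnn N).
Qed.

(** Cauchy's criterion; its quantifiers range over countable sets, for the sake of
    measurability. *)
Lemma radial_cauchyP (u : R -> R[i]) :
  (exists l : R[i], u r @[r --> (1 : R)^'-] --> l) <->
  forall n, exists m, radial_osc u m n.+1%:R^-1.
Proof.
split=> [[l /cvgcP h] n|h].
  have e0 : 0 < n.+1%:R^-1 / 2 :> R by rewrite divr_gt0 // invr_gt0 ltr0n.
  have := h _ e0; rewrite near_withinE => /nbhs_ballP[d /= d0 hd].
  have [m hm] := exists_invS_lt d0.
  have near1 r : 1 - m.+1%:R^-1 < r < 1 -> normc (u r - l) < n.+1%:R^-1 / 2.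
    move=> /andP[r0 r1]; apply: hd => //; rewrite /ball /= ger0_norm ?subr_ge0 ?(ltW r1) //.
    by move: r0 hm; move: (m.+1%:R^-1) => x; lra.
  exists m => r s /near1 hr /near1 hs; apply: le_trans (normc_triangle l _ _) _.
  by rewrite (normcBC l); move: hr hs; move: (normc _) (normc _) (n.+1%:R^-1) => x y w; lra.
have osc (phi : R[i] -> R) : (forall z w, `|phi z - phi w| <= normc (z - w)) ->
    cvg (phi (u r) @[r --> (1 : R)^'-]).
  move=> lip; apply: cauchy_cvg; apply: cauchy_exP => e e0.
  have [n hn] := exists_invS_lt e0; have [m hm] := h n.
  pose x : R := m.+1%:R^-1; have x0 : 0 < x by rewrite invr_gt0 ltr0n.
  have hs : 1 - x < 1 - x / 2 < 1 by clear -x0; lra.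
  have lt1 : 1 - x < 1 by lra.
  exists (phi (u (1 - x / 2))).
  suff h1 : \forall r \near (1 : R)^'-, ball (phi (u (1 - x / 2))) e (phi (u r)) by exact: h1.
  near=> r; rewrite -ball_normE /=; apply: le_lt_trans (lip _ _) _; apply: le_lt_trans hn.
  apply: hm => //; apply/andP; split; near: r; [exact: nbhs_left_gt|exact: nbhs_left_lt].
have [|l1 h1] := (cvg_ex _).1 (osc (@complex.Re R) _).
  by move=> z w; rewrite -cReN -cReD; exact: Re_le_normc.
have [|l2 h2] := (cvg_ex _).1 (osc (@complex.Im R) _).
  by move=> z w; rewrite -cImN -cImD; exact: Im_le_normc.
by exists (l1 +i* l2); apply/cvgc_ReIm.
Unshelve. all: by end_near. Qed.

Variables (g : R[i] -> R[i]) (B : R).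
Hypothesis dg : forall z, normc z < 1 -> derivable g z 1.
Hypothesis gB : forall z, normc z < 1 -> normc (g z) <= B.

Let u t r := g (r%:C * expi t).

Let B0 : 0 <= B.
Proof. by apply: le_trans (gB (z := 0) _); rewrite ?normc_ge0 // normc0. Qed.

Definition radial_limit_set := [set t | exists l : R[i], u t r @[r --> (1 : R)^'-] --> l].

(** For each oscillation bound the condition on [t] is closed, as an intersection over all radii of
    closed conditions. *)
Lemma measurable_radial_limit_set : measurable radial_limit_set.
Proof.
have -> : radial_limit_set = \bigcap_n \bigcup_m [set t | radial_osc (u t) m n.+1%:R^-1].
  apply/seteqP; split=> [t /radial_cauchyP h n _|t h].
    by have [m hm] := h n; exists m.
  by apply/radial_cauchyP => n; have [m _ hm] := h n I; exists m.
apply: bigcapT_measurable => n; apply: bigcupT_measurable => m; apply: closed_measurable.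
pose J : set (R * R) := [set rs | 1 - m.+1%:R^-1 < rs.1 < 1 /\ 1 - m.+1%:R^-1 < rs.2 < 1].
have -> : [set t | radial_osc (u t) m n.+1%:R^-1] =
   \bigcap_(rs in J) ((fun t => normc (u t rs.1 - u t rs.2)) @^-1` [set x | x <= n.+1%:R^-1]).
  apply/seteqP; split=> [t h [r s] [/= hr hs]|t h r s hr hs]; first exact: h.
  by apply: (h (r, s)).
apply: closed_bigI => -[r s] [/= hr hs]; apply: preimage_closed; last exact: closed_le.
have m1 : m.+1%:R^-1 <= 1 :> R by rewrite invf_le1 ?ltr0n // ler1n.
have r01 : 0 < r < 1.
  by case/andP: hr => h1 ->; rewrite andbT; apply: le_lt_trans h1; rewrite subr_ge0.
have s01 : 0 < s < 1.
  by case/andP: hs => h1 ->; rewrite andbT; apply: le_lt_trans h1; rewrite subr_ge0.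
move=> t _; apply: (ccont_normc (ccontB (ccont_radius dg r01) (ccont_radius dg s01))).
Qed.

(** On the measurable set of radial convergence the boundary function is a limit of continuous
    functions; elsewhere it is the constant default value of limits. *)
Lemma cmeasurable_boundary_fun : cmeasurable A (fun t => boundary_fun g (expi t)).
Proof.
(* With [n.+1] the first radius would be 0. *)
pose rho n : R := 1 - n.+2%:R^-1.
have rho01 n : 0 < rho n < 1.
  have h : 0 < n.+2%:R^-1 :> R by rewrite invr_gt0 ltr0n.
  by rewrite /rho subr_gt0 invf_lt1 ?ltr0n // ltr1n /= ltrBlDr ltrDl.
have crho n := ccont_radius dg (rho01 n).
have mrho n := (cmeasurable_ReIm _ _).1 (cmeasurable_cont (@measurable_angles R) (crho n)).
have bnd n t : normc (u t (rho n)) <= B.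
  by apply: gB; have /andP[r0 r1] := rho01 n; rewrite normc_radial // ltW.
have [h1 [m1 _ c1]] := @ae_limit_measurable R A (fun n t => complex.Re (u t (rho n))) B
  (@measurable_angles R) (fun n => (mrho n).1) (fun n t _ => le_trans (Re_le_normc _) (bnd n t)) B0.
have [h2 [m2 _ c2]] := @ae_limit_measurable R A (fun n t => complex.Im (u t (rho n))) B
  (@measurable_angles R) (fun n => (mrho n).2) (fun n t _ => le_trans (Im_le_normc _) (bnd n t)) B0.
have rho1 : rho n @[n --> \oo] --> (1 : R)^'-.
  move=> U; rewrite /= /at_left /within /= => /nbhs_ballP[d /= d0 hd].
  have [N hN] := exists_invS_lt d0; exists N => // n /= Nn.
  have h : 0 < n.+2%:R^-1 :> R by rewrite invr_gt0 ltr0n.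
  apply: hd; last by rewrite /rho ltrBlDr ltrDl.
  rewrite /ball /= /rho opprB addrC subrK ger0_norm ?(ltW h) //; apply: le_lt_trans hN.
  by rewrite lef_pV2 ?posrE ?ltr0n // ler_nat ltnS ltnW // ltnS.
pose C := radial_limit_set; have mC := measurable_radial_limit_set.
have onC t : A t -> C t -> boundary_fun g (expi t) = h1 t +i* h2 t.
  move=> At [l hl]; have hn : u t (rho n) @[n --> \oo] --> l by exact: cvg_comp rho1 hl.
  have /cvgc_ReIm[n1 n2] := hn.
  have k1 := c1 t At (cvgP _ n1); have k2 := c2 t At (cvgP _ n2).
  have -> : h1 t = complex.Re l by exact: cvg_unique k1 n1.
  have -> : h2 t = complex.Im l by exact: cvg_unique k2 n2.
  have -> : boundary_fun g (expi t) = l by apply: cvg_lim hl; exact: norm_hausdorff.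
  by case: l {hl hn n1 n2}.
have offC t : ~ C t -> boundary_fun g (expi t) = point.
  by move=> nC; apply: xgetPN => l hl; apply: nC; exists l.
have mix (phi : R[i] -> R) (h : R -> R) : measurable_fun A h ->
    (forall t, A t -> C t -> phi (boundary_fun g (expi t)) = h t) ->
    measurable_fun A (fun t => phi (boundary_fun g (expi t))).
  move=> mh hC.
  have mI : measurable_fun A (\1_C : R -> R) by exact: measurable_indic.
  have mJ := measurable_funB (measurable_cst (1 : R)) mI.
  have := measurable_funD (measurable_funM mI mh) (measurable_funM mJ (measurable_cst (phi point))).
  apply: eq_measurable_fun => t; rewrite inE => At /=; rewrite indicE.
  have [Ct|nC] := pselect (C t).
    by rewrite mem_set // mul1r subrr mul0r addr0 hC.
  by rewrite memNset // mul0r subr0 mul1r add0r offC.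
apply/cmeasurable_ReIm; split.
  by apply: (mix (@complex.Re R) h1) => // t At Ct; rewrite onC.
by apply: (mix (@complex.Im R) h2) => // t At Ct; rewrite onC.
Qed.

End BoundaryFunction.

(** * Weak-star convergence *)

Section WeakStar.
Variable R : realType.
Notation mu := (@lebesgue_measure R).
Notation A := (@angles R).
Implicit Types (F G : nat -> R[i] -> R[i]) (H V Q g : R[i] -> R[i]) (z w : R[i]) (r t : R).

(** Dominated convergence, as [F n * Q] is dominated by [M * |Q|]. *)
Lemma weak_star_of_ae F H (M : R) : (forall n, ccont (F n \o expi)) ->
  (forall n t, normc (F n (expi t)) <= M) -> cmeasurable A (H \o expi) ->
  {ae mu, forall t, A t -> F n (expi t) @[n --> \oo] --> H (expi t)} ->
  weak_star_cvg F H.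
Proof.
move=> cF FM mH FH; have mF n := cmeasurable_cont (@measurable_angles R) (cF n).
split.
- move=> n; have /cmeasurable_ReIm[m1 m2] := mF n; split=> //.
  by exists M; apply: aeW => t _; rewrite lecnormE.
- have /cmeasurable_ReIm[m1 m2] := mH; split=> //.
  exists M; apply: ae_imply FH _ => t h At; rewrite lecnormE -[X in normc X]subr0.
  by apply: (cvgc_le (h At)); apply: nearW => n; rewrite subr0.
move=> Q [iR iI].
have mQ : cmeasurable A (fun t => Q (expi t)).
  by apply: cintegrable_measurable; exact/cintegrable_ReIm.
have ci : ccont (fun t : R => 'i%C * expi t) by exact: (ccontM (ccont_cst ('i%C : R[i])) ccont_expi).
have mi := cmeasurable_cont (@measurable_angles R) ci.
pose b t := M * `|complex.Re (Q (expi t))| + M * `|complex.Im (Q (expi t))|.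
have ib : mu.-integrable A (fun t => (b t)%:E).
  apply: integrable_EFin_comb; first exact: measurable_angles.
    have := integrable_abse iR; apply: eq_integrable; first exact: measurable_angles.
    by move=> t _ /=.
  have := integrable_abse iI; apply: eq_integrable; first exact: measurable_angles.
  by move=> t _ /=.
have mm (K : R[i] -> R[i]) : cmeasurable A (K \o expi) ->
    cmeasurable A (fun t => K (expi t) * Q (expi t) * ('i%C * expi t)).
  by move=> mK; exact: (cmeasurableM (cmeasurableM mK mQ) mi).
have [||_ c] := cint_dominated (@measurable_angles R) ib (fun n => mm (F n) (mF n)) (mm H mH).
- move=> n t _; rewrite (normcM (_ * _)) (normcM 'i%C) expi_norm mulr1.
  have -> : normc ('i%C : R[i]) = 1 by rewrite /normc /= expr0n expr1n add0r sqrtr1.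
  rewrite mulr1 (normcM (F n _)) /b -mulrDr.
  by apply: ler_pM; rewrite ?normc_ge0 // normc_le_ReIm.
- apply: ae_imply FH _ => t h At.
  apply: cvgM; last exact: cvg_cst.
  by apply: cvgM; [exact: h|exact: cvg_cst].
have e (K : R[i] -> R[i]) : circle_integral (fun z => K z * Q z) =
    cint A (fun t => K (expi t) * Q (expi t) * ('i%C * expi t)) by exact: circle_integralE.
have -> : (fun n => circle_integral (fun z => F n z * Q z)) =
    (fun n => cint A (fun t => F n (expi t) * Q (expi t) * ('i%C * expi t))).
  by apply/funext => n; exact: e.
by rewrite e.
Qed.

(** The test function [V z / (i * z)] turns the integrals in [dz] into means. *)
Lemma weak_star_mean F H V : weak_star_cvg F H -> ccont (V \o expi) ->
  mean (fun t => F n (expi t) * V (expi t)) @[n --> \oo] -->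
  mean (fun t => H (expi t) * V (expi t)).
Proof.
move=> [_ _ ws] cV.
pose Q z := V z * (- 'i%C * z^*%C).
have cQ : ccont (fun t => Q (expi t)).
  exact: (ccontM cV (ccontM (ccont_cst (- 'i%C : R[i])) (ccont_conj ccont_expi))).
have QL : L1_circle Q by have /cintegrable_ReIm := cintegrable_angles cQ.
have ii : 'i%C * 'i%C = -1 :> R[i] by rewrite -expr2 sqr_i.
have e (K : R[i] -> R[i]) : ((2 * pi)^-1)%:C * circle_integral (fun z => K z * Q z) =
    mean (fun t => K (expi t) * V (expi t)).
  rewrite meanE circle_integralE; congr (_ * _); apply: eq_cint => t _.
  have -> : K (expi t) * Q (expi t) * ('i%C * expi t) =
    K (expi t) * V (expi t) * (- ('i%C * 'i%C)) * (expi t * (expi t)^*%C) by rewrite /Q; ring.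
  by rewrite ii opprK mulr1 mul_expi_conj mulr1.
have -> : (fun n => mean (fun t => F n (expi t) * V (expi t))) =
    (fun n => ((2 * pi)^-1)%:C * circle_integral (fun z => F n z * Q z)).
  by apply/funext => n; rewrite e.
by rewrite -e; apply: cvgM (ws _ QL); exact: cvg_cst.
Qed.

(** Means are linear, so that [tail_hull_cvg] applies to the means of a convex combination. *)
Lemma tail_hull_mean F N (G : R[i] -> R[i]) V : (forall n, ccont (F n \o expi)) ->
  ccont (V \o expi) -> tail_hull F N G ->
  tail_hull (fun n _ => mean (fun t => F n (expi t) * V (expi t))) N
    (fun _ => mean (fun t => G (expi t) * V (expi t))).
Proof.
move=> cF cV; elim=> [n Nn|G1 G2 l l01 h1 I1 h2 I2].
  exact: (tail_hull_base (fun n (_ : R[i]) => mean (fun t => F n (expi t) * V (expi t)))).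
have c1 := ccontM (tail_hull_cont cF h1) cV; have c2 := ccontM (tail_hull_cont cF h2) cV.
have -> : (fun _ : R[i] => mean (fun t => (l%:C * G1 (expi t) + (1 - l)%:C * G2 (expi t)) * V (expi t))) =
  (fun _ => l%:C * mean (fun t => G1 (expi t) * V (expi t)) +
            (1 - l)%:C * mean (fun t => G2 (expi t) * V (expi t))).
  apply/funext => _.
  rewrite -(meanZ _ (cintegrable_angles c1)) -(meanZ _ (cintegrable_angles c2)).
  rewrite -(meanD (cintegrable_angles (ccontM (ccont_cst l%:C) c1))
     (cintegrable_angles (ccontM (ccont_cst (1 - l)%:C) c2))).
  by apply: eq_mean => t _; rewrite mulrDl !mulrA.
exact: tail_hull_comb.
Qed.

(** Taylor polynomials of [g (rho n * z)], where [rho n] tends to 1. *)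
Lemma analytic_poly_approx g (B : R) : (forall z, normc z < 1 -> derivable g z 1) ->
  (forall z, normc z < 1 -> normc (g z) <= B) ->
  exists p : nat -> {poly R[i]}, (forall n z, normc z = 1 -> normc (p n).[z] <= B + 1) /\
    forall z, 0 < normc z < 1 -> (p n).[z] @[n --> \oo] --> g z.
Proof.
move=> dg gB; have B0 : 0 <= B by apply: le_trans (gB 0 _); rewrite ?normc_ge0 // normc0.
pose rho n : R := 1 - n.+2%:R^-1.
have inv0 n : 0 < n.+1%:R^-1 :> R by rewrite invr_gt0 ltr0n.
have rho01 n : 0 < rho n < 1.
  by rewrite /rho subr_gt0 invf_lt1 ?ltr0n // ltr1n /= ltrBlDr ltrDl.
have approx n : exists p : {poly R[i]}, forall z, 0 < normc z <= 1 ->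
    normc (p.[z] - g ((rho n)%:C * z)) <= n.+1%:R^-1.
  have /andP[r0 r1] := rho01 n; have r2 : 0 < 1 - rho n by rewrite subr_gt0.
  have [m hm] := expr_le_eps B (ltW r0) r1 (mulr_gt0 (inv0 n) r2).
  exists (\poly_(k < m) (taylor_coef g k * (rho n)%:C ^+ k)) => z /andP[z0 z1].
  have nz : normc ((rho n)%:C * z) = rho n * normc z by rewrite normcM normc_real ger0_norm // ltW.
  have le_rho : rho n * normc z <= rho n by rewrite ler_piMr // ltW.
  have nz0 : 0 < rho n * normc z by exact: mulr_gt0.
  have := taylor_remainder dg gB (z := (rho n)%:C * z) m.
  rewrite nz nz0 (le_lt_trans le_rho r1) => /(_ isT).
  have -> : \sum_(k < m) taylor_coef g k * ((rho n)%:C * z) ^+ k =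
      (\poly_(k < m) (taylor_coef g k * (rho n)%:C ^+ k)).[z].
    by rewrite horner_poly; apply: eq_bigr => k _; rewrite exprMn mulrA.
  rewrite normcBC => /le_trans; apply.
  apply: (@le_trans _ _ (B * rho n ^+ m / (1 - rho n))).
    apply: ler_pM.
    - by rewrite mulr_ge0 // exprn_ge0 // ltW.
    - by rewrite invr_ge0 subr_ge0 (le_trans le_rho) // ltW.
    - by rewrite ler_wpM2l // lerXn2r ?nnegrE // ltW.
    - by rewrite lef_pV2 ?posrE ?subr_gt0 ?(le_lt_trans le_rho) // lerB.
  by rewrite ler_pdivrMr // ltW.
have [p hp] := choice approx.
exists p; split=> [n z z1|z z01].
  have h : 0 < normc z <= 1 by rewrite z1 ltr01 lexx.
  have := ler_normcD ((p n).[z] - g ((rho n)%:C * z)) (g ((rho n)%:C * z)); rewrite subrK.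
  move=> /le_trans; apply; rewrite addrC; apply: lerD.
    apply: gB; rewrite normcM normc_real z1 mulr1; have /andP[r0 r1] := rho01 n.
    by rewrite ger0_norm // ltW.
  by apply: le_trans (hp _ _ h) _; rewrite invf_le1 ?ltr0n // ler1n.
have /andP[z0 z1] := z01.
have h : 0 < normc z <= 1 by rewrite z0 ltW.
have invc : n.+1%:R^-1 @[n --> \oo] --> (0 : R).
  apply/cvgRP => e e0; have [N hN] := exists_invS_lt e0; exists N => // n /= Nn.
  rewrite subr0 ger0_norm ?(ltW (inv0 n)) //; apply: le_lt_trans hN.
  by rewrite lef_pV2 ?posrE ?ltr0n // ler_nat ltnS.
have crho : (rho n)%:C * z @[n --> \oo] --> z.
  apply/cvgcP => e e0; have [N hN] := exists_invS_lt e0; exists N => // n /= Nn.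
  have -> : (rho n)%:C * z - z = (- n.+2%:R^-1)%:C * z by rewrite /rho rcB rmorphN rc1; ring.
  rewrite normcM normc_real normrN ger0_norm ?(ltW (inv0 _)) //.
  apply: le_lt_trans hN; apply: (@le_trans _ _ (n.+2%:R^-1 * 1)).
    by rewrite ler_wpM2l ?(ltW (inv0 _)) // ltW.
  by rewrite mulr1 lef_pV2 ?posrE ?ltr0n // ler_nat ltnS (leq_trans Nn) // leqnSn.
have cg : g ((rho n)%:C * z) @[n --> \oo] --> g z.
  have dc := derivable_cvg (dg z z1).
  by apply: (@cvg_comp _ _ _ (fun n => (rho n)%:C * z) g _ (nbhs z)); [exact: crho|exact: dc].
apply/cvgcP => e e0; have e2 : 0 < e / 2 by rewrite divr_gt0.
have /cvgcP/(_ _ e2) n1 := cg; have /cvgRP/(_ _ e2) n2 := invc.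
near=> n.
have k1 : normc (g ((rho n)%:C * z) - g z) < e / 2 by near: n; exact: n1.
have k2 : `|n.+1%:R^-1 - 0 : R| < e / 2 by near: n; exact: n2.
rewrite subr0 ger0_norm ?(ltW (inv0 n)) // in k2.
apply: le_lt_trans (normc_triangle (g ((rho n)%:C * z)) _ _) _.
have -> : e = e / 2 + e / 2 by field.
by apply: ltrD => //; apply: le_lt_trans (hp n z h) k2.
Unshelve. all: by end_near. Qed.

(** Polynomials approximating [g] in the disc have convex combinations that converge almost
    everywhere on the circle. The Cauchy transform of their limit is [g], so that Fatou's theorem
    identifies this limit with the radial limits of [g]. *)
Theorem boundary_fun_poly_limit g (B : R) : (forall z, normc z < 1 -> derivable g z 1) ->
  (forall z, normc z < 1 -> normc (g z) <= B) ->
  exists (q : nat -> {poly R[i]}) (h : R -> R[i]) (C C' : R),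
   [/\ forall j w, normc w = 1 -> normc (q j).[w] <= C,
       cmeasurable A h, forall t, normc (h t) <= C',
       {ae mu, forall t, A t -> (q j).[expi t] @[j --> \oo] --> h t} &
       {ae mu, forall t, A t -> boundary_fun g (expi t) = h t}].
Proof.
move=> dg gB; have [p [pB pg]] := analytic_poly_approx dg gB.
have pB' n (t : R) : normc (p n).[expi t] <= B + 1 by apply: pB; exact: expi_norm.
have cp n := ccont_poly (p n) (@ccont_expi R).
have [G [h [hG mh [C' hC] Gh]]] := tail_hull_cvg_ae (F := fun n z => (p n).[z]) cp pB'.
have [q qE] := choice (fun j => tail_hull_poly (hG j)).
have qB j w : normc w = 1 -> normc (q j).[w] <= B + 1.
  move=> w1; have -> : (q j).[w] = G j w by rewrite qE.
  exact: (tail_hull_bound (F := fun n z => (p n).[z]) (fun n => pB n w w1) (hG j)).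
have qh : {ae mu, forall t, A t -> (q j).[expi t] @[j --> \oo] --> h t}.
  have GE : G = fun j z => (q j).[z] by apply/funext => j; exact: qE.
  by move: Gh; rewrite GE.
have gE z : 0 < normc z < 1 -> cauchy_int h z = g z.
  move=> z01; have /andP[z0 z1] := z01.
  apply: (cvgc_unique (cvg_cauchy_int qB mh qh z1)).
  have := tail_hull_cvg hG (pg z z01).
  by have -> : G = (fun j z => (q j).[z]) by apply/funext => j; exact: qE.
exists q, h, (B + 1), C'; split=> //.
apply: ae_imply (fatou_radial_limit qB mh hC qh) _ => t ht At.
apply: cvg_lim; first exact: norm_hausdorff.
apply: cvg_trans (ht At); apply: near_eq_cvg; near=> r.
have r0 : 0 < r by near: r; exact: nbhs_left_gt.
have r1 : r < 1 by near: r; exact: nbhs_left_lt.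
by rewrite gE // normc_radial ?(ltW r0) // r0.
Unshelve. all: by end_near. Qed.

End WeakStar.

(** * The two implications *)

Section TwoDirections.
Variable R : realType.
Notation mu := (@lebesgue_measure R).
Notation A := (@angles R).
Implicit Types (E : set R[i]) (f g : R[i] -> R[i]) (F : nat -> R[i] -> R[i]) (z w : R[i]) (r t : R).

Lemma poly_bound_closed_disc (p : {poly R[i]}) (M : R) :
  (forall z, normc z < 1 -> normc p.[z] <= M) -> forall w, normc w = 1 -> normc p.[w] <= M.
Proof.
move=> pM w w1; have [th _ ->] := circle_expi ((circleP w).2 w1).
have cr : p.[r%:C * expi th] @[r --> (1 : R)^'-] --> p.[expi th].
  apply: cvg_at_left_filter.
  have cc : ccont (fun r : R => p.[r%:C * expi th]).
    exact: (ccont_poly p (ccontM (ccontI (@cvg_real_complex R)) (ccont_cst (expi th)))).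
  by have := ccont_at (t := 1) cc; rewrite rc1 mul1r.
rewrite -[X in normc X]subr0; apply: (cvgc_le cr); near=> r; rewrite subr0; apply: pM.
have r0 : 0 < r by near: r; exact: nbhs_left_gt.
by rewrite normc_radial ?(ltW r0) //; near: r; exact: nbhs_left_lt.
Unshelve. all: by end_near. Qed.

(** The analytic function is the Cauchy transform of the almost everywhere limit of convex
    combinations of the polynomials. *)
Lemma poly_sequence_weak_star (P : nat -> {poly R[i]}) (M : R) :
  (forall n z, normc z = 1 -> normc (P n).[z] <= M) ->
  exists (q : nat -> {poly R[i]}) g,
    [/\ forall j, tail_hull (fun n z => (P n).[z]) j (fun z => (q j).[z]),
        forall j z, normc z = 1 -> normc (q j).[z] <= M, bounded_analytic g &
        weak_star_cvg (fun j z => (q j).[z]) (boundary_fun g)].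
Proof.
move=> PM; have PM' n (t : R) : normc (P n).[expi t] <= M by apply: PM; exact: expi_norm.
have cP n := ccont_poly (P n) (@ccont_expi R).
have [G [h [hG mh [C hC] Gh]]] := tail_hull_cvg_ae (F := fun n z => (P n).[z]) cP PM'.
have [q qE] := choice (fun j => tail_hull_poly (hG j)).
have GE : G = fun j z => (q j).[z] by apply/funext => j; exact: qE.
rewrite GE in hG Gh.
have qM j z : normc z = 1 -> normc (q j).[z] <= M.
  by move=> z1; apply: (tail_hull_bound (F := fun n z => (P n).[z]) (fun n => PM n z z1) (hG j)).
pose g := cauchy_int h.
have dg z : normc z < 1 -> derivable g z 1 by move=> z1; exact: (derivable_cauchy_int mh hC).
have gM z : normc z < 1 -> normc (g z) <= M.
  move=> z1; rewrite -[X in normc X]subr0; apply: (cvgc_le (cvg_cauchy_int qM mh Gh z1)).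
  by apply: nearW => n; rewrite subr0; apply: poly_max_modulus (ltW z1); exact: qM.
exists q, g; split=> //.
  split=> [z /discP z1|]; first exact: dg.
  by exists M => z /discP z1; rewrite lecnormE gM.
apply: (weak_star_of_ae (M := M)).
- by move=> n; exact: (ccont_poly (q n) (@ccont_expi R)).
- by move=> n t; apply: qM; exact: expi_norm.
- exact: (cmeasurable_boundary_fun dg gM).
- apply: ae_imply2 Gh (fatou_radial_limit qM mh hC Gh) _ => t h1 h2 At.
  have -> : boundary_fun g (expi t) = h t by apply: cvg_lim (h2 At); exact: norm_hausdorff.
  exact: h1.
Qed.

Section FromContinuous.
Variables (F : nat -> R[i] -> R[i]) (g : R[i] -> R[i]) (M B : R).
Hypothesis cF : forall n, ccont (F n \o expi).
Hypothesis FM : forall n t, normc (F n (expi t)) <= M.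
Hypothesis dg : forall z, normc z < 1 -> derivable g z 1.
Hypothesis gB : forall z, normc z < 1 -> normc (g z) <= B.
Hypothesis ws : weak_star_cvg F (boundary_fun g).

(** Weak-star convergence passes to convex combinations. So the almost everywhere limit [H] of the
    differences [D j] is orthogonal to each [D j], hence to itself. *)
Lemma hull_poly_energy0 : exists (G : nat -> R[i] -> R[i]) (q : nat -> {poly R[i]}) (C : R),
  [/\ forall j, tail_hull F j (G j),
      forall j t, normc (G j (expi t) - (q j).[expi t]) <= C &
      forall e, 0 < e -> exists N, forall j, (N <= j)%N ->
        energy (fun t => G j (expi t) - (q j).[expi t]) < e].
Proof.
have [G [h' [hG mh' [C1 hC1] Gh]]] := tail_hull_cvg_ae cF FM.
have [q [h [C [C2 [qC mh hC2 qh gh]]]]] := boundary_fun_poly_limit dg gB.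
have GM j t : normc (G j (expi t)) <= M by exact: (tail_hull_bound (fun n => FM n t) (hG j)).
have qC' j (t : R) : normc (q j).[expi t] <= C by apply: qC; exact: expi_norm.
pose D j z := G j z - (q j).[z].
have DM j t : normc (D j (expi t)) <= M + C.
  by apply: le_trans (ler_normcB _ _) _; apply: lerD.
have cG j := tail_hull_cont cF (hG j).
have cq j := ccont_poly (q j) (@ccont_expi R).
have cD j : ccont (D j \o expi) by exact: (ccontB (cG j) (cq j)).
have cV j : ccont ((fun z => (D j z)^*%C) \o expi) by exact: (ccont_conj (cD j)).
exists G, q, (M + C); split=> //.
pose k t := boundary_fun g (expi t).
have mk : cmeasurable A k by case: ws => _ [m1 m2 _] _; exact/cmeasurable_ReIm.
have qk : {ae mu, forall t, A t -> (q j).[expi t] @[j --> \oo] --> k t}.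
  by apply: ae_imply2 qh gh _ => t h1 h2 At; rewrite /k h2 //; exact: h1.
(* Both [h'] and [h] have the same means against [conj (D j)] as the boundary function. *)
have orth j : mean (fun t => (h' t - h t) * (D j (expi t))^*%C) = 0.
  have c1 := tail_hull_cvg (z := 0) (fun i => tail_hull_mean cF (cV j) (hG i)) (weak_star_mean ws (cV j)).
  have c2 := mean_dominated_mul cG mh' (cV j) (fun n t _ => GM n t) Gh.
  have c3 := mean_dominated_mul cq mh (cV j) (fun n t _ => qC' n t) qh.
  have c4 := mean_dominated_mul cq mk (cV j) (fun n t _ => qC' n t) qk.
  have e1 := cvgc_unique c1 c2; have e2 := cvgc_unique c3 c4.
  have i1 := cintegrable_mul_cont mh' (fun t _ => hC1 t) (cV j).
  have i2 := cintegrable_mul_cont mh (fun t _ => hC2 t) (cV j).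
  have -> : mean (fun t => (h' t - h t) * (D j (expi t))^*%C) =
     mean (fun t => h' t * (D j (expi t))^*%C - h t * (D j (expi t))^*%C).
    by apply: eq_mean => t _; rewrite mulrBl.
  by rewrite (meanB i1 i2) -e1 e2 subrr.
pose H t := h' t - h t.
have mH : cmeasurable A H by exact: (cmeasurableB mh' mh).
have mHc := cmeasurable_conj mH.
have DH : {ae mu, forall t, A t -> D j (expi t) @[j --> \oo] --> H t}.
  by apply: ae_imply2 Gh qh _ => t h1 h2 At; exact: (cvgB (h1 At) (h2 At)).
have DHc : {ae mu, forall t, A t -> (D j (expi t))^*%C @[j --> \oo] --> (H t)^*%C}.
  apply: ae_imply DH _ => t h1 At; apply/cvgcP => e e0.
  have /cvgcP/(_ _ e0) := h1 At; apply: filterS => n.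
  by rewrite -conjB normc_conj.
have HB t : normc (H t) <= C1 + C2 by apply: le_trans (ler_normcB _ _) _; apply: lerD.
have mD j := cmeasurable_cont (@measurable_angles R) (cD j).
have mV j := cmeasurable_cont (@measurable_angles R) (cV j).
have lim1 : mean (fun t => H t * (D j (expi t))^*%C) @[j --> \oo] --> mean (fun t => H t * (H t)^*%C).
  apply: (mean_dominated (B := (C1 + C2) * (M + C))).
  - by move=> n; exact: (cmeasurableM mH (mV n)).
  - exact: (cmeasurableM mH mHc).
  - by move=> n t _; rewrite normcM normc_conj; apply: ler_pM; rewrite ?normc_ge0.
  - by apply: ae_imply DHc _ => t h1 At; apply: cvgM (h1 At); exact: cvg_cst.
have lim2 : mean (fun t => D j (expi t) * (D j (expi t))^*%C) @[j --> \oo] --> mean (fun t => H t * (H t)^*%C).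
  apply: (mean_dominated (B := (M + C) * (M + C))).
  - by move=> n; exact: (cmeasurableM (mD n) (mV n)).
  - exact: (cmeasurableM mH mHc).
  - by move=> n t _; rewrite normcM normc_conj; apply: ler_pM; rewrite ?normc_ge0.
  - by apply: ae_imply2 DH DHc _ => t h1 h2 At; exact: (cvgM (h1 At) (h2 At)).
have H0 : mean (fun t => H t * (H t)^*%C) = 0.
  apply: (cvgc_unique lim1).
  have -> : (fun j => mean (fun t => H t * (D j (expi t))^*%C)) = (fun=> 0).
    by apply/funext => j; exact: orth.
  exact: cvg_cst.
rewrite H0 in lim2 => e e0; have /cvgcP/(_ _ e0) [N _ hN] := lim2.
exists N => j Nj; have := hN j Nj; rewrite subr0; apply: le_lt_trans.
apply: le_trans (ler_norm _) _; apply: le_trans (Re_le_normc _) _.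
rewrite le_eqVlt; apply/orP; left; apply/eqP; congr (normc _).
by apply: eq_mean => t _; rewrite /= mul_conjc.
Qed.

Lemma hull_near_poly n (e : R) : 0 < e -> exists G (p : {poly R[i]}),
  tail_hull F n G /\ forall t, normc (G (expi t) - p.[expi t]) <= e.
Proof.
have [G [q [C [hG DC en0]]]] := hull_poly_energy0.
have C0 : 0 <= C by apply: le_trans (DC 0%N 0); exact: normc_ge0.
apply: (tail_hull_near_poly cF C0) => d d0.
have d2 : 0 < d ^+ 2 by exact: exprn_gt0.
have [N hN] := en0 _ d2; exists (G (maxn n N)), (q (maxn n N)); split.
- exact: (tail_hullW (leq_maxl n N) (hG _)).
- exact: DC.
have cD : ccont (fun t => G (maxn n N) (expi t) - (q (maxn n N)).[expi t]).
  exact: (ccontB (tail_hull_cont cF (hG _)) (ccont_poly _ (@ccont_expi R))).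
have di : 0 < d^-1 by rewrite invr_gt0.
apply: le_trans (mean_normc_energy cD di) _; rewrite invrK.
have := hN _ (leq_maxr n N); move: (energy _) => en hen.
have : d^-1 * en <= d.
  by rewrite mulrC ler_pdivrMr // -expr2 ltW.
lra.
Qed.

(** The polynomials closer and closer to elements of the tail hulls converge on [E] as these elements
    do; the factors [c n] bring their bounds [M + ep n] back to [M]. *)
Lemma poly_sequence_of_weak_star (M0 : 0 < M) E f : E `<=` unit_circle ->
  (forall z, E z -> F n z @[n --> \oo] --> f z) ->
  exists P : nat -> {poly R[i]}, (forall z, E z -> (P n).[z] @[n --> \oo] --> f z) /\
    forall n z, normc z <= 1 -> normc (P n).[z] <= M.
Proof.
move=> ET Ff.
pose ep n : R := n.+1%:R^-1; have ep0 n : 0 < ep n by rewrite invr_gt0 ltr0n.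
have ex n : exists Gp : (R[i] -> R[i]) * {poly R[i]}, tail_hull F n Gp.1 /\
    forall t, normc (Gp.1 (expi t) - Gp.2.[expi t]) <= ep n.
  by have [G [p h]] := hull_near_poly n (ep0 n); exists (G, p).
have [Gp hGp] := choice ex.
pose G n := (Gp n).1; pose p n := (Gp n).2.
have hG n : tail_hull F n (G n) by case: (hGp n).
have GM n t : normc (G n (expi t)) <= M by exact: (tail_hull_bound (fun m => FM m t) (hG n)).
have Gpe n t : normc (G n (expi t) - (p n).[expi t]) <= ep n by exact: (hGp n).2 t.
have pM n t : normc (p n).[expi t] <= M + ep n.
  have -> : (p n).[expi t] = G n (expi t) - (G n (expi t) - (p n).[expi t]) by rewrite subKr.
  by apply: le_trans (ler_normcB _ _) _; apply: lerD.
have d0 n : 0 < M + ep n by rewrite addr_gt0.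
pose c n := M / (M + ep n).
have c0 n : 0 < c n by rewrite divr_gt0.
have c1 n : 1 - c n = ep n / (M + ep n) by rewrite /c; field; exact: lt0r_neq0.
pose P n := (c n)%:C *: p n.
have PE n z : (P n).[z] = (c n)%:C * (p n).[z] by rewrite hornerZ.
exists P; split=> [z Ez|n z z1].
  have [t _ zt] := circle_expi (ET z Ez).
  have cG : G n z @[n --> \oo] --> f z by exact: (tail_hull_cvg hG (Ff z Ez)).
  apply/cvgcP => e e0; have e4 : 0 < e / 4 by rewrite divr_gt0.
  have /cvgcP/(_ _ e4) n1 := cG; have [N hN] := exists_invS_lt e4.
  near=> n.
  have k1 : normc (G n z - f z) < e / 4 by near: n; exact: n1.
  have k2 : ep n < e / 4.
    have Nn : (N <= n)%N by near: n; exact: nbhs_infty_ge.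
    by apply: le_lt_trans hN; rewrite lef_pV2 ?posrE ?ltr0n // ler_nat ltnS.
  have k3 : normc (G n z - (p n).[z]) <= ep n by rewrite zt.
  have k4 : normc ((P n).[z] - (p n).[z]) <= ep n.
    have -> : (P n).[z] - (p n).[z] = - ((1 - c n)%:C * (p n).[z]).
      by rewrite PE rcB rc1 mulrBl mul1r opprB.
    rewrite -[leRHS](divfK (lt0r_neq0 (d0 n))) -c1 normcN normcM normc_real ger0_norm.
      by rewrite ler_wpM2l ?c1 ?divr_ge0 ?(ltW (ep0 n)) ?(ltW (d0 n)) // zt.
    by rewrite c1 divr_ge0 // ltW.
  have t1 := normc_triangle (p n).[z] (P n).[z] (f z).
  have t2 := normc_triangle (G n z) (p n).[z] (f z).
  rewrite (normcBC (p n).[z] (G n z)) in t2.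
  move: k1 k2 k3 k4 t1 t2; move: (normc _) (normc _) (normc _) (normc _) (normc _) => a1 a2 a3 a4 a5.
  lra.
rewrite PE normcM normc_real ger0_norm ?(ltW (c0 n)) //.
have h : normc (p n).[z] <= M + ep n.
  apply: poly_max_modulus z1 => w w1.
  by have [t _ ->] := circle_expi ((circleP w).2 w1); exact: pM.
apply: le_trans (ler_wpM2l (ltW (c0 n)) h) _.
by rewrite /c divfK // lt0r_neq0.
Unshelve. all: by end_near. Qed.

End FromContinuous.
End TwoDirections.

Theorem theorem1 (R : realType) (M : R) (E : set R[i]) (f : R[i] -> R[i])
    (M_gt0 : 0 < M) (E_circle : E `<=` unit_circle) :
  (exists P : nat -> {poly R[i]},
     (forall z, E z -> (P n).[z] @[n --> \oo] --> f z) /\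
     (forall n z, unit_disc z -> `|(P n).[z]| <= M%:C))
  <->
  (exists (F : nat -> R[i] -> R[i]) (g : R[i] -> R[i]),
     [/\ forall n, {within unit_circle, continuous (F n)},
         bounded_analytic g,
         (forall n z, unit_circle z -> `|F n z| <= M%:C) /\
         (forall z, E z -> F n z @[n --> \oo] --> f z) &
         weak_star_cvg F (boundary_fun g)]).
Proof.
split=> [[P [Pf PM]]|[F [g [cF [dg [B gB]] [FM Ff] ws]]]].
  have PM' n z : normc z = 1 -> normc (P n).[z] <= M.
    by apply: poly_bound_closed_disc => w w1; rewrite -lecnormE; apply: PM; exact/discP.
  have [q [g [hq qM bg ws]]] := poly_sequence_weak_star PM'.
  exists (fun j z => (q j).[z]), g; split=> //.
    by move=> n; apply: continuous_subspaceT => z; exact: (derivable_cvg (@derivable_poly R (q n) z)).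
  split=> [n z /circleP z1|z Ez]; first by rewrite lecnormE qM.
  exact: (tail_hull_cvg hq (Pf z Ez)).
have cF' n := ccont_circle (cF n).
have FM' n t : normc (F n (expi t)) <= M by rewrite -lecnormE; apply: FM; exact: expi_circle.
have dg' z : normc z < 1 -> derivable g z 1 by move=> z1; apply: dg; exact/discP.
have gB' z : normc z < 1 -> normc (g z) <= B.
  by move=> z1; rewrite -lecnormE; apply: gB; exact/discP.
have [P [Pf PM]] := poly_sequence_of_weak_star cF' FM' dg' gB' ws M_gt0 E_circle Ff.
exists P; split=> // n z /discP z1.
by rewrite lecnormE PM // ltW.
Qed.
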